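(* Let $N\in\{2,3,5,7\}$ and let $\tilde E_N(\tau)=\frac{1}{N-1}\bigl(NE_2(N\tau)-E_2(\tau)\bigr)$ for $\tau$ in the upper half plane $\mathbb{H}$. Let $\rho=e^{2\pi i/3}$. Then the set of zeros of $\tilde E_N$ lying in the fundamental domain $F_N$ of $\Gamma_0(N)$ is exactly: - for $N=2$: $\left\{-\frac{1}{i+1}\right\}$; - for $N=3$: $\left\{-\frac{1}{\rho+2}\right\}$; - for $N=5$: $\left\{-\frac{1}{i+2},\,-\frac{1}{i+3}\right\}$; - for $N=7$: $\left\{-\frac{1}{\rho+3},\,-\frac{1}{\rho+5}\right\}$. In particular $\tilde E_N$ vanishes at each of these points and at no other point of $F_N$.
   Context: $q=e^{2\pi i\tau}$ with $\tau\in\mathbb{H}$. $E_2(\tau)=1-24\sum_{n\ge1}\sigma_1(n)q^n$, where $\sigma_1(n)$ is the sum of the positive divisors of $n$. For $N$ prime, $\tilde E_N$ is a holomorphic modular form of weight $2$ for $\Gamma_0(N)$. Let $F_\Gamma=\{\tau=x+iy\in\mathbb{H}: -1/2\le x<1/2,\ x^2+y^2\ge1\}$ be the standard fundamental domain of $SL_2(\mathbb{Z})$, $S=\begin{pmatrix}0&-1\\1&0\end{pmatrix}$, $T=\begin{pmatrix}1&1\\0&1\end{pmatrix}$, acting by Möbius transformations (so $ST^k(\tau)=-1/(\tau+k)$). For a prime $p$, the fundamental domain of $\Gamma_0(p)$ is taken to be $F_p=F_\Gamma\cup\bigcup_{k=0}^{p-1}ST^k(F_\Gamma)$. *)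

(* Defs.v *)
From Stdlib Require Import Reals List Arith.
From Stdlib Require Import ClassicalEpsilon.
Open Scope R_scope.

Definition Cplx := (R * R)%type.
Definition Cre (z : Cplx) : R := fst z.
Definition Cim (z : Cplx) : R := snd z.
Definition C0 : Cplx := (0, 0).
Definition C1 : Cplx := (1, 0).
Definition Ci : Cplx := (0, 1).
Definition RtoC (r : R) : Cplx := (r, 0).
Definition Cadd (z w : Cplx) : Cplx := (fst z + fst w, snd z + snd w).
Definition Copp (z : Cplx) : Cplx := (- fst z, - snd z).
Definition Csub (z w : Cplx) : Cplx := Cadd z (Copp w).
Definition Cmul (z w : Cplx) : Cplx :=
  (fst z * fst w - snd z * snd w, fst z * snd w + snd z * fst w).
Definition Cinv (z : Cplx) : Cplx :=
  (fst z / (fst z ^ 2 + snd z ^ 2), - snd z / (fst z ^ 2 + snd z ^ 2)).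
Fixpoint Cpow (z : Cplx) (n : nat) : Cplx :=
  match n with O => C1 | S m => Cmul z (Cpow z m) end.

Definition in_H (tau : Cplx) : Prop := snd tau > 0.

(* q = exp(2 pi i tau) *)
Definition qexp (tau : Cplx) : Cplx :=
  (exp (- 2 * PI * snd tau) * cos (2 * PI * fst tau),
   exp (- 2 * PI * snd tau) * sin (2 * PI * fst tau)).

Definition sigma1 (n : nat) : nat :=
  fold_right Nat.add 0%nat
    (map (fun d => if Nat.eqb (n mod d) 0 then d else 0%nat) (seq 1 n)).

Definition Csum_to (f : nat -> Cplx) (l : Cplx) : Prop :=
  Un_cv (fun n => sum_f_R0 (fun k => fst (f k)) n) (fst l) /\
  Un_cv (fun n => sum_f_R0 (fun k => snd (f k)) n) (snd l).
Definition Csum (f : nat -> Cplx) : Cplx := epsilon (inhabits C0) (Csum_to f).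

Definition E2 (tau : Cplx) : Cplx :=
  Csub C1 (Cmul (RtoC 24)
    (Csum (fun k => Cmul (RtoC (INR (sigma1 (S k)))) (Cpow (qexp tau) (S k))))).

Definition EtN (N : nat) (tau : Cplx) : Cplx :=
  Cmul (RtoC (/ (INR N - 1)))
    (Csub (Cmul (RtoC (INR N)) (E2 (Cmul (RtoC (INR N)) tau))) (E2 tau)).

Definition F_Gamma (tau : Cplx) : Prop :=
  in_H tau /\ -1/2 <= fst tau < 1/2 /\ fst tau ^ 2 + snd tau ^ 2 >= 1.

Definition STk (k : nat) (tau : Cplx) : Cplx := Copp (Cinv (Cadd tau (RtoC (INR k)))).

Definition F_p (p : nat) (tau : Cplx) : Prop :=
  F_Gamma tau \/ exists k : nat, (k < p)%nat /\ exists w, F_Gamma w /\ tau = STk k w.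

Definition rho : Cplx := (-1/2, sqrt 3 / 2).

Definition zero_set (N : nat) (tau : Cplx) : Prop :=
  match N with
  | 2%nat => tau = STk 1 Ci
  | 3%nat => tau = STk 2 rho
  | 5%nat => tau = STk 2 Ci \/ tau = STk 3 Ci
  | 7%nat => tau = STk 3 rho \/ tau = STk 5 rho
  | _ => False
  end.

(* Main.v *)
Require Import Defs.
From Stdlib Require Import Reals List Arith.
From Stdlib Require Import ZArith Lra Lia.
From Coquelicot Require Import Coquelicot.
Import ListNotations.
Open Scope R_scope.

(** Write [g(z) = N E2(N z) - E2(z)], that is [(N - 1)] times the form [EtN N].

    Quasi-modularity: [pi^2 / sin^2 (pi z) = sum_n 1/(z + n)^2] and the matching expansion of the
    cotangent follow from the duplication formulas, iterated, and dominated convergence.  Hence [E2] is a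
    double series over [m, n]; once a telescoping term is subtracted it converges absolutely, and exchanging
    the summations gives [E2(-1/z) = z^2 E2(z) + kappa z].  At [i] and [rho] this determines [E2], and
    differentiating it determines [E2'(rho)]; so [g] vanishes at [-1/(i - j)] for [N = 1 + j^2], and vanishes
    doubly at [-1/(rho - j)] for [N = 1 + j + j^2].

    Location of the zeros: the law also gives [g(-1/t) = - (t^2 / N) g(t / N)], so the zeros on
    [ST^k F_Gamma] come from the zeros of [g] at [(w + k) / N] with [w] in [F_Gamma].  There [q = exp(2 pi i z)]
    lies in an explicit disc [|q| <= r < 1] containing all the known zeros, [k] of them with multiplicity.
    After multiplication by a suitable integer polynomial, the [q]-series [sum c_n q^n] satisfies
    [|c_k| > sum_(n > k) |c_n| C(n, k) r^(n - k)].  A further zero is then impossible: the divided difference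
    at these [k + 1] points would vanish, although its leading term [c_k] dominates the others. *)

(** * Series of complex numbers *)

(** The classical count of zeros is the valence formula: the orders, divided by those of the
    stabilisers, add up to [(N + 1) / 6]. Contour integration is replaced here by a quantitative
    statement on power series in [q]. Multiplicities have to enter: the points coming from [rho] are
    elliptic of order three and absorb the totals [2/3] and [4/3] only as double zeros, whereas
    those coming from [i] are simple. Hence [k = 1, 2, 2, 4] for [N = 2, 3, 5, 7].

    The radius [r] exceeds [exp (- PI sqrt 3 / N)], the modulus of [q] at the lowest points
    [(w + k) / N], those with [w] at a corner of [F_Gamma]. The integer polynomial is a truncation
    of [D / c], where [D] approximates, up to a scale factor, the polynomial whose roots are the
    known zeros; the product then starts like [D], and its coefficients vanish from index [k + 1] up
    to the order of truncation. Nothing depends on the quality of the approximation except the final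
    inequality, which is checked in integers.

    For [N = 5] and [N = 7] only one zero is computed; the coefficients are real, so the complex
    conjugate in the [q]-disc is the other. *)

Notation Cseries := (@is_series C_AbsRing C_NormedModule).
Definition Csum_n (a : nat -> C) (n : nat) : C :=
  sum_n (G:=NormedModule.AbelianMonoid C_AbsRing C_NormedModule) a n.

Definition Clim (u : nat -> C) (l : C) : Prop :=
  forall eps, 0 < eps -> exists N, forall n, (N <= n)%nat -> Cmod (u n - l) < eps.

Lemma Clim_filterlim (u : nat -> C) (l : C) :
  Clim u l <-> filterlim u eventually (@locally C_NormedModule l).
Proof.
  split.
  - intros H. apply filterlim_locally_ball_norm. intros eps.
    destruct (H eps (cond_pos eps)) as [N HN]. exists N. exact HN.
  - intros H eps he.
    pose proof (proj1 (filterlim_locally_ball_norm u l) H (mkposreal eps he)) as [N HN].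
    exists N. exact HN.
Qed.

Lemma Clim_unique (u : nat -> C) (l l' : C) : Clim u l -> Clim u l' -> l = l'.
Proof.
  intros H H'. apply Clim_filterlim in H, H'.
  exact (filterlim_locally_unique (F:=eventually) (V:=C_NormedModule) u l l' H H').
Qed.

Lemma Clim_ext (u v : nat -> C) (l : C) : (forall n, u n = v n) -> Clim u l -> Clim v l.
Proof. intros E H eps he. destruct (H eps he) as [N HN]. exists N. intros n hn. rewrite <- E. auto. Qed.

Lemma Clim_const (l : C) : Clim (fun _ => l) l.
Proof. intros eps he. exists 0%nat. intros _ _. replace (l - l)%C with (RtoC 0) by ring. rewrite Cmod_0. exact he. Qed.

Lemma Clim_plus (u v : nat -> C) (l m : C) :
  Clim u l -> Clim v m -> Clim (fun n => u n + v n)%C (l + m)%C.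
Proof.
  intros H K eps he. destruct (H (eps/2)) as [N HN]. lra. destruct (K (eps/2)) as [M HM]. lra.
  exists (N + M)%nat. intros n hn.
  replace (u n + v n - (l + m))%C with ((u n - l) + (v n - m))%C by ring.
  eapply Rle_lt_trans. apply Cmod_triangle.
  specialize (HN n ltac:(lia)). specialize (HM n ltac:(lia)). lra.
Qed.

Lemma Clim_scal (c : C) (u : nat -> C) (l : C) : Clim u l -> Clim (fun n => c * u n)%C (c * l)%C.
Proof.
  intros H eps he. assert (hc := Cmod_ge_0 c).
  destruct (H (eps / (Cmod c + 1))) as [N HN]. apply Rdiv_lt_0_compat; lra.
  exists N. intros n hn. specialize (HN n hn).
  replace (c * u n - c * l)%C with (c * (u n - l))%C by ring. rewrite Cmod_mult.
  assert (0 <= Cmod (u n - l)) by apply Cmod_ge_0.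
  apply Rle_lt_trans with ((Cmod c + 1) * Cmod (u n - l)). nra.
  apply (Rmult_lt_compat_l (Cmod c + 1)) in HN; [|lra].
  replace ((Cmod c + 1) * (eps / (Cmod c + 1))) with eps in HN by (field; lra). exact HN.
Qed.

Lemma Clim_shift (u : nat -> C) (l : C) : Clim u l -> Clim (fun n => u (S n)) l.
Proof. intros H eps he. destruct (H eps he) as [N HN]. exists N. intros n hn. apply HN. lia. Qed.


Lemma Cseries_Clim (a : nat -> C) (l : C) : Cseries a l <-> Clim (Csum_n a) l.
Proof. symmetry. apply Clim_filterlim. Qed.

Lemma Cseries_unique (a : nat -> C) (l l' : C) : Cseries a l -> Cseries a l' -> l = l'.
Proof. intros H H'. apply Cseries_Clim in H, H'. exact (Clim_unique _ _ _ H H'). Qed.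

Lemma Cseries_ext (a b : nat -> C) (l : C) : (forall n, a n = b n) -> Cseries a l -> Cseries b l.
Proof. exact (is_series_ext (V:=C_NormedModule) a b l). Qed.

Lemma Cseries_plus (a b : nat -> C) (l m : C) :
  Cseries a l -> Cseries b m -> Cseries (fun n => a n + b n)%C (l + m)%C.
Proof. exact (is_series_plus (V:=C_NormedModule) a b l m). Qed.

Lemma Cseries_scal (c : C) (a : nat -> C) (l : C) :
  Cseries a l -> Cseries (fun n => c * a n)%C (c * l)%C.
Proof. exact (is_series_scal (V:=C_NormedModule) c a l). Qed.

Lemma Cseries_minus (a b : nat -> C) (l m : C) :
  Cseries a l -> Cseries b m -> Cseries (fun n => a n - b n)%C (l - m)%C.
Proof. exact (is_series_minus (V:=C_NormedModule) a b l m). Qed.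

Lemma Cseries_tail (a : nat -> C) (l : C) : Cseries a l -> Cseries (fun n => a (S n)) (l - a 0%nat)%C.
Proof.
  intros H. apply (is_series_incr_1 (V:=C_NormedModule)).
  match goal with |- is_series _ ?x => replace x with l; [exact H|] end.
  change (l = (l - a 0%nat + a 0%nat)%C). ring.
Qed.

Lemma Cseries_cons (a : nat -> C) (l : C) : Cseries (fun n => a (S n)) l -> Cseries a (a 0%nat + l)%C.
Proof.
  intros H. apply (is_series_decr_1 (V:=C_NormedModule)).
  match goal with |- is_series _ ?x => replace x with l; [exact H|] end.
  change (l = (a 0%nat + l + - a 0%nat)%C). ring.
Qed.

Lemma Csum_n_Sn (a : nat -> C) (n : nat) : Csum_n a (S n) = (Csum_n a n + a (S n))%C.
Proof. exact (sum_Sn (G:=NormedModule.AbelianMonoid C_AbsRing C_NormedModule) a n). Qed.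

Lemma Csum_n_0 (a : nat -> C) : Csum_n a 0 = a 0%nat.
Proof. exact (sum_O (G:=NormedModule.AbelianMonoid C_AbsRing C_NormedModule) a). Qed.



Lemma Csum_n_le (a : nat -> C) (b : nat -> R) (n : nat) :
  (forall k, (k <= n)%nat -> Cmod (a k) <= b k) -> Cmod (Csum_n a n) <= sum_n b n.
Proof.
  induction n; intros H. rewrite Csum_n_0, sum_O. apply H. lia.
  rewrite Csum_n_Sn, sum_Sn. eapply Rle_trans. apply Cmod_triangle.
  apply Rplus_le_compat. apply IHn. intros k hk. apply H. lia. apply H. lia.
Qed.

Lemma sum_n_le_is_series (b : nat -> R) (B : R) (n : nat) :
  (forall k, 0 <= b k) -> is_series b B -> sum_n b n <= B.
Proof.
  intros hb H. apply is_series_Reals in H. rewrite sum_n_Reals.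
  apply sum_incr. exact H. exact hb.
Qed.

Lemma Cseries_dominated (a : nat -> C) (b : nat -> R) (B : R) :
  (forall n, Cmod (a n) <= b n) -> is_series b B -> exists l : C, Cseries a l /\ Cmod l <= B.
Proof.
  intros H HB.
  destruct (ex_series_le (V:=C_CompleteNormedModule) a b H (ex_intro _ B HB)) as [l hl].
  exists l. split. exact hl.
  assert (hb : forall k, 0 <= b k) by (intros k; eapply Rle_trans; [apply Cmod_ge_0|apply H]).
  apply Rnot_lt_le. intros hlt.
  pose proof (proj1 (Cseries_Clim a l) hl (Cmod l - B) ltac:(lra)) as [N HN].
  specialize (HN N (Nat.le_refl N)).
  assert (h1 : Cmod (Csum_n a N) <= B).
  { eapply Rle_trans. apply (Csum_n_le a b). intros; apply H. now apply sum_n_le_is_series. }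
  assert (h2 : Cmod l <= Cmod (Csum_n a N) + Cmod (Csum_n a N - l)).
  { replace l with (Csum_n a N + - (Csum_n a N - l))%C at 1 by ring.
    eapply Rle_trans. apply Cmod_triangle. rewrite Cmod_opp. lra. }
  lra.
Qed.

Lemma Cseries_norm_le (a : nat -> C) (l : C) (b : nat -> R) (B : R) :
  Cseries a l -> (forall n, Cmod (a n) <= b n) -> is_series b B -> Cmod l <= B.
Proof.
  intros Ha H HB. destruct (Cseries_dominated a b B H HB) as [l' [h1 h2]].
  now rewrite (Cseries_unique _ _ _ Ha h1).
Qed.

Lemma Csum_n_Clim (f : nat -> nat -> C) (g : nat -> C) (K : nat) :
  (forall k, Clim (fun n => f n k) (g k)) -> Clim (fun n => Csum_n (f n) K) (Csum_n g K).
Proof.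
  intros H. induction K.
  - rewrite Csum_n_0. apply Clim_ext with (fun n => f n 0%nat). intros n; now rewrite Csum_n_0. apply H.
  - rewrite Csum_n_Sn. apply Clim_ext with (fun n => Csum_n (f n) K + f n (S K))%C.
    intros n; now rewrite Csum_n_Sn. now apply Clim_plus.
Qed.

Lemma is_series_tail_small (b : nat -> R) :
  ex_series b -> forall eps, 0 < eps ->
  exists K B, is_series (fun k => b (S K + k)%nat) B /\ B < eps.
Proof.
  intros [B HB] eps he.
  pose proof (proj1 (is_series_Reals b B) HB eps he) as [K HK].
  exists K, (B - sum_n b K). split.
  - apply (is_series_incr_n b (S K)). lia.
    match goal with |- is_series _ ?x => replace x with B; [exact HB|] end.
    assert (E : forall x y : R, x = x - y + y) by (intros; ring). exact (E B (sum_n b K)).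
  - specialize (HK K (Nat.le_refl K)). rewrite sum_n_Reals. unfold R_dist, Rdist in HK.
    apply Rabs_def2 in HK. lra.
Qed.

Lemma Cseries_split (a : nat -> C) (l : C) (K : nat) :
  Cseries a l -> Cseries (fun k => a (S K + k)%nat) (l - Csum_n a K)%C.
Proof.
  intros H. apply (is_series_incr_n (V:=C_NormedModule) a (S K)). lia.
  match goal with |- is_series _ ?x => replace x with l; [exact H|] end.
  change (l = (l - Csum_n a K + Csum_n a K)%C). ring.
Qed.

(** Both tails beyond a common [K] are below [eps / 3] by domination, and the finite head converges
    termwise. The domination is asked only from [n0] on, because the estimates for the doubling
    formulas hold only for large [n]. *)
Lemma tannery (f : nat -> nat -> C) (g : nat -> C) (b : nat -> R) (s : nat -> C) (n0 : nat) :
  ex_series b ->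
  (forall n k, (n0 <= n)%nat -> Cmod (f n k) <= b k) ->
  (forall k, Clim (fun n => f n k) (g k)) ->
  (forall n, Cseries (f n) (s n)) ->
  exists l : C, Cseries g l /\ Clim s l.
Proof.
  intros hb hdom hlim hs.
  assert (hg : forall k, Cmod (g k) <= b k).
  { intros k. apply Rnot_lt_le. intros hlt.
    destruct (hlim k (Cmod (g k) - b k)) as [N HN]. lra.
    specialize (HN (N + n0)%nat ltac:(lia)). specialize (hdom (N + n0)%nat k ltac:(lia)).
    assert (Cmod (g k) <= Cmod (f (N + n0)%nat k) + Cmod (f (N+n0)%nat k - g k)).
    { replace (g k) with (f (N+n0)%nat k + - (f (N+n0)%nat k - g k))%C at 1 by ring.
      eapply Rle_trans. apply Cmod_triangle. rewrite Cmod_opp. lra. }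
    lra. }
  destruct hb as [B HB].
  destruct (Cseries_dominated g b B hg HB) as [l [hl _]].
  exists l. split. exact hl.
  intros eps he.
  destruct (is_series_tail_small b (ex_intro _ B HB) (eps/3)) as [K [T [hT hT']]]. lra.
  destruct (Csum_n_Clim f g K hlim (eps/3)) as [N HN]. lra.
  exists (N + n0)%nat. intros n hn. specialize (HN n ltac:(lia)).
  assert (h1 : Cmod (s n - Csum_n (f n) K) <= T).
  { apply (Cseries_norm_le _ _ (fun k => b (S K + k)%nat) T (Cseries_split _ _ K (hs n))).
    intros k. apply hdom. lia. exact hT. }
  assert (h2 : Cmod (l - Csum_n g K) <= T).
  { apply (Cseries_norm_le _ _ (fun k => b (S K + k)%nat) T (Cseries_split _ _ K hl)).
    intros k. apply hg. exact hT. }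
  replace (s n - l)%C with ((s n - Csum_n (f n) K) + ((Csum_n (f n) K - Csum_n g K) + - (l - Csum_n g K)))%C by ring.
  eapply Rle_lt_trans. apply Cmod_triangle.
  eapply Rle_lt_trans. apply Rplus_le_compat_l. apply Cmod_triangle. rewrite Cmod_opp. lra.
Qed.

Lemma Cseries_Csum_n (f : nat -> nat -> C) (r : nat -> C) (M : nat) :
  (forall m, Cseries (f m) (r m)) -> Cseries (fun n => Csum_n (fun m => f m n) M) (Csum_n r M).
Proof.
  intros H. induction M.
  - rewrite Csum_n_0. apply (Cseries_ext (f 0%nat)).
    intros n; now rewrite Csum_n_0. apply H.
  - rewrite Csum_n_Sn. eapply Cseries_ext; [|exact (Cseries_plus _ _ _ _ IHM (H (S M)))].
    intros n. cbv beta. now rewrite Csum_n_Sn.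
Qed.

(** Summing over [m <= M] under the sum over [n] gives a sequence in [M] dominated by [b]; letting
    [M] grow is an instance of [tannery]. *)
Lemma fubini (f : nat -> nat -> C) (r c : nat -> C) (b : nat -> R) :
  (forall m, Cseries (f m) (r m)) ->
  (forall n, Cseries (fun m => f m n) (c n)) ->
  (forall n M, sum_n (fun m => Cmod (f m n)) M <= b n) ->
  ex_series b ->
  exists l : C, Cseries c l /\ Cseries r l.
Proof.
  intros hr hc hdom hb.
  destruct (tannery (fun M n => Csum_n (fun m => f m n) M) c b (Csum_n r) 0) as [l [h1 h2]].
  - exact hb.
  - intros M n _. eapply Rle_trans; [|apply (hdom n M)]. apply Csum_n_le. intros; lra.
  - intros n. apply Cseries_Clim. apply hc.
  - intros M. now apply Cseries_Csum_n.
  - exists l. split. exact h1. now apply Cseries_Clim.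
Qed.

Lemma fubini_prod (f : nat -> nat -> C) (r c : nat -> C) (x y : nat -> R) :
  (forall m, Cseries (f m) (r m)) ->
  (forall n, Cseries (fun m => f m n) (c n)) ->
  (forall m n, Cmod (f m n) <= x m * y n) ->
  (forall m, 0 <= x m) -> (forall n, 0 <= y n) ->
  ex_series x -> ex_series y ->
  exists l : C, Cseries c l /\ Cseries r l.
Proof.
  intros hr hc hxy hx hy [X HX] [Y HY].
  apply (fubini f r c (fun n => X * y n)); trivial.
  - intros n M. apply Rle_trans with (sum_n (fun m => x m * y n) M).
    + apply sum_n_m_le. intros; apply hxy.
    + eapply Rle_trans. apply Req_le. exact (sum_n_mult_r (K:=R_Ring) (y n) x M). apply Rmult_le_compat_r. apply hy.
      now apply sum_n_le_is_series.
  - exists (X * Y). exact (is_series_scal_l (V:=R_NormedModule) X y Y HY).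
Qed.

(** * The exponential [exp (2 pi i z)] *)

(* [qexp] retyped on Coquelicot's [C], which is convertible to [Cplx] together with its operations. *)
Definition qe (z : C) : C := qexp z.

Lemma C_ext (z w : C) : fst z = fst w -> snd z = snd w -> z = w.
Proof. destruct z, w; simpl; intros; subst; reflexivity. Qed.

Lemma qe_plus (z w : C) : qe (z + w)%C = (qe z * qe w)%C.
Proof.
  apply C_ext; unfold qe, qexp; simpl fst; simpl snd;
  rewrite !Rmult_plus_distr_l, exp_plus, ?cos_plus, ?sin_plus; simpl; ring.
Qed.

Lemma Cmod_qe (z : C) : Cmod (qe z) = exp (- 2 * PI * snd z).
Proof.
  unfold Cmod, qe, qexp; simpl fst; simpl snd.
  replace (_ + _) with (exp (-2 * PI * snd z) ^ 2 * (Rsqr (sin (2 * PI * fst z)) + Rsqr (cos (2 * PI * fst z))))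
    by (unfold Rsqr; ring).
  rewrite sin2_cos2, Rmult_1_r. apply sqrt_pow2. left. apply exp_pos.
Qed.

Lemma qe_neq0 (z : C) : qe z <> 0.
Proof. apply Cmod_gt_0. rewrite Cmod_qe. apply exp_pos. Qed.

Lemma qe_0 : qe (RtoC 0) = 1.
Proof. apply C_ext; unfold qe, qexp; simpl; rewrite !Rmult_0_r, exp_0, ?cos_0, ?sin_0; ring. Qed.

Lemma qe_1 : qe (RtoC 1) = 1.
Proof.
  apply C_ext; unfold qe, qexp; simpl; rewrite !Rmult_0_r, !Rmult_1_r, exp_0, ?cos_2PI, ?sin_2PI; ring.
Qed.

Lemma qe_nat (n : nat) : qe (RtoC (INR n)) = 1.
Proof.
  induction n. apply qe_0.
  rewrite S_INR, RtoC_plus, qe_plus, IHn, qe_1. ring.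
Qed.

Lemma qe_opp (z : C) : qe (- z)%C = (/ qe z)%C.
Proof.
  assert (H : (qe (- z) * qe z)%C = 1).
  { rewrite <- qe_plus. replace (- z + z)%C with (RtoC 0) by ring. apply qe_0. }
  pose proof (qe_neq0 z).
  replace (qe (-z)) with (qe (-z) * qe z * / qe z)%C by (now field). rewrite H. ring.
Qed.

Lemma qe_Z (k : Z) : qe (RtoC (IZR k)) = 1.
Proof.
  destruct (Z_le_gt_dec 0 k) as [h|h].
  - rewrite <- (Z2Nat.id k h), <- INR_IZR_INZ. apply qe_nat.
  - replace (RtoC (IZR k)) with (- RtoC (INR (Z.to_nat (- k))))%C.
    rewrite qe_opp, qe_nat. field.
    rewrite INR_IZR_INZ, Z2Nat.id by lia. rewrite opp_IZR, RtoC_opp. ring.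
Qed.

Lemma qe_pow (z : C) (n : nat) : qe (RtoC (INR n) * z)%C = (qe z ^ n)%C.
Proof.
  induction n. simpl. replace (0 * z)%C with (RtoC 0) by ring. apply qe_0.
  rewrite S_INR, RtoC_plus. replace ((INR n + 1) * z)%C with (z + INR n * z)%C by ring.
  rewrite qe_plus, IHn. reflexivity.
Qed.

(** * Elementary estimates for the exponential and the sine *)

Lemma Rabs_sin_le (y : R) : Rabs (sin y) <= Rabs y.
Proof.
  destruct (MVT_gen sin 0 y cos) as [c [_ hc]].
  - intros x _. auto_derive. trivial. ring.
  - intros x _. apply continuity_sin.
  - rewrite sin_0, !Rminus_0_r in hc. rewrite hc, Rabs_mult.
    assert (Rabs (cos c) <= 1) by (apply Rabs_le; apply COS_bound).
    pose proof (Rabs_pos y). nra.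
Qed.

Lemma one_minus_cos_le (y : R) : 0 <= 1 - cos y <= y ^ 2 / 2.
Proof.
  split. pose proof (COS_bound y); lra.
  replace y with (2 * (y / 2)) at 1 by field. rewrite cos_2a_sin.
  pose proof (Rabs_sin_le (y/2)) as h. apply Rsqr_le_abs_1 in h. unfold Rsqr in h. nra.
Qed.

Lemma sin_minus_id_le (y : R) : Rabs y <= 1 -> Rabs (sin y - y) <= y ^ 2.
Proof.
  intros hy.
  destruct (MVT_gen (fun t => sin t - t) 0 y (fun t => cos t - 1)) as [c [hc1 hc]].
  - intros x _. auto_derive. trivial. ring.
  - intros x _. apply continuity_pt_minus. apply continuity_sin. apply continuity_pt_id.
  - cbv beta in hc. rewrite sin_0, !Rminus_0_r in hc. rewrite hc, Rabs_mult.
    assert (hcy : Rabs c <= Rabs y).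
    { unfold Rmin, Rmax in hc1. destruct (Rle_dec 0 y); unfold Rabs; repeat destruct Rcase_abs; lra. }
    pose proof (one_minus_cos_le c).
    assert (hcc : c ^ 2 <= Rabs y).
    { apply Rsqr_le_abs_1 in hcy. unfold Rsqr in hcy.
      pose proof (Rabs_pos y). rewrite <- (pow2_abs c). pose proof (pow2_abs y). 
      pose proof (pow2_abs c). nra. }
    rewrite (Rabs_left1 (cos c - 1)) by lra. rewrite <- (pow2_abs y).
    pose proof (Rabs_pos y). nra.
Qed.

Lemma exp_minus_affine_le (x : R) : Rabs x <= 1 / 2 -> 0 <= exp x - 1 - x <= 2 * x ^ 2.
Proof.
  intros hx. apply Rabs_le_between in hx.
  pose proof (exp_ineq1_le x). pose proof (exp_ineq1_le (- x)).
  split. lra.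
  assert (hm : exp x * exp (- x) = 1) by (rewrite <- exp_plus, Rplus_opp_r; apply exp_0).
  pose proof (exp_pos x).
  assert (exp x * (1 - x) <= 1) by nra.
  (* The right side equals [1 + x^2 (1 - 2 x)], which is at least [1] for [x <= 1/2]. *)
  assert (h : exp x * (1 - x) <= (1 + x + 2 * x ^ 2) * (1 - x)) by nra.
  apply Rmult_le_reg_r in h; lra.
Qed.

Lemma Cmod_le_abs (z : C) : Cmod z <= Rabs (fst z) + Rabs (snd z).
Proof.
  unfold Cmod. apply Rsqr_incr_0_var.
  - rewrite Rsqr_sqrt by (pose proof (pow2_ge_0 (fst z)); pose proof (pow2_ge_0 (snd z)); lra).
    rewrite <- (pow2_abs (fst z)), <- (pow2_abs (snd z)).
    pose proof (Rabs_pos (fst z)). pose proof (Rabs_pos (snd z)). unfold Rsqr. nra.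
  - pose proof (Rabs_pos (fst z)). pose proof (Rabs_pos (snd z)). lra.
Qed.

Lemma Cmod_sqr (z : C) : Cmod z ^ 2 = fst z ^ 2 + snd z ^ 2.
Proof. apply Cmod2_alt. Qed.

Lemma Rabs_fst_le (z : C) : Rabs (fst z) <= Cmod z.
Proof. apply re_le_Cmod. Qed.

Lemma Rabs_snd_le (z : C) : Rabs (snd z) <= Cmod z.
Proof. eapply Rle_trans; [|apply Rmax_Cmod]. apply Rmax_r. Qed.

(** As [PI <= 4], the radius [1/20] keeps the exponent [x] and the angle [y] within [1/2]. The
    estimates add up to [4 x^2 + 5 y^2], at most [320 Cmod w ^ 2]; the constant is generous. *)
Lemma qe_first_order (w : C) :
  Cmod w <= 1 / 20 -> Cmod (qe w - 1 - 2 * PI * Ci * w)%C <= 1000 * Cmod w ^ 2.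
Proof.
  intros hw. pose proof PI_4 as hpi. pose proof PI_RGT_0 as hpi0.
  rewrite Cmod_sqr.
  pose proof (Rabs_fst_le w) as h1. pose proof (Rabs_snd_le w) as h2.
  assert (hx : Rabs (- 2 * PI * snd w) <= 1/2).
  { apply Rabs_le. assert (Rabs (snd w) <= 1/20) by lra. apply Rabs_le_between in H.
    split; nra. }
  assert (hy : Rabs (2 * PI * fst w) <= 1/2).
  { apply Rabs_le. assert (Rabs (fst w) <= 1/20) by lra. apply Rabs_le_between in H.
    split; nra. }
  eapply Rle_trans. apply Cmod_le_abs.
  unfold qe, qexp. simpl fst. simpl snd.
  set (x := - 2 * PI * snd w) in *. set (y := 2 * PI * fst w) in *.
  pose proof (exp_minus_affine_le x hx) as he.
  pose proof (one_minus_cos_le y) as hcos.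
  pose proof (sin_minus_id_le y ltac:(lra)) as hsin.
  pose proof (Rabs_sin_le y) as hsin'.
  pose proof (exp_pos x) as hep.
  apply Rabs_le_between in hx.
  assert (he2 : exp x <= 2) by nra.
  match goal with |- Rabs ?A + Rabs ?B <= _ =>
    replace A with ((exp x - 1 - x) - exp x * (1 - cos y)) by (unfold x; ring);
    replace B with (exp x * (sin y - y) + (exp x - 1) * y) by (unfold y; ring) end.
  assert (hA : Rabs (exp x - 1 - x - exp x * (1 - cos y)) <= 2 * x ^ 2 + y ^ 2).
  { apply Rabs_le. split; nra. }
  assert (hB : Rabs (exp x * (sin y - y) + (exp x - 1) * y) <= 2 * y ^ 2 + (2 * x ^ 2 + 2 * y ^ 2)).
  { eapply Rle_trans. apply Rabs_triang. rewrite !Rabs_mult, (Rabs_right (exp x)) by lra.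
    apply Rplus_le_compat. pose proof (Rabs_pos (sin y - y)). nra.
    assert (Rabs (exp x - 1) <= 2 * Rabs x).
    { apply Rabs_le. unfold Rabs; destruct Rcase_abs; split; nra. }
    pose proof (Rabs_pos x). pose proof (Rabs_pos y).
    rewrite <- (pow2_abs x), <- (pow2_abs y). 
    pose proof (Rabs_pos (exp x - 1)). 
    apply Rle_trans with (2 * Rabs x * Rabs y). nra. 
    pose proof (pow2_ge_0 (Rabs x - Rabs y)). nra. }
  assert (hx2 : x ^ 2 <= 64 * snd w ^ 2).
  { unfold x. replace ((-2 * PI * snd w)^2) with (4 * PI^2 * snd w ^2) by ring.
    apply Rmult_le_compat_r. apply pow2_ge_0. nra. }
  assert (hy2 : y ^ 2 <= 64 * fst w ^ 2).
  { unfold y. replace ((2 * PI * fst w)^2) with (4 * PI^2 * fst w ^2) by ring.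
    apply Rmult_le_compat_r. apply pow2_ge_0. nra. }
  pose proof (pow2_ge_0 (fst w)). pose proof (pow2_ge_0 (snd w)). lra.
Qed.

Lemma sin_ge_id_cos (u : R) : 0 <= u <= PI / 2 -> u * cos u <= sin u.
Proof.
  intros hu. pose proof PI_RGT_0.
  destruct (MVT_gen sin 0 u cos) as [c [hc1 hc]].
  - intros x _. auto_derive. trivial. ring.
  - intros x _. apply continuity_sin.
  - rewrite sin_0, !Rminus_0_r in hc. rewrite Rmin_left, Rmax_right in hc1 by lra.
    assert (cos u <= cos c) by (apply cos_decr_1; lra). nra.
Qed.

(** By the half-angle formula [sin t >= t cos^2 (t/2) = t (1 + cos t) / 2], and [cos t >= -0.71] on
    this range; [0.145] exceeds [1/7]. *)
Lemma sin_ge_linear (t : R) : 0 <= t <= 3 * (PI / 4) -> t / 7 <= sin t.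
Proof.
  intros ht. pose proof PI_RGT_0.
  assert (h1 : sin t = 2 * sin (t/2) * cos (t/2)).
  { rewrite <- sin_2a. f_equal. field. }
  assert (h2 : cos t = 2 * cos (t/2) * cos (t/2) - 1).
  { rewrite <- cos_2a_cos. f_equal. field. }
  assert (h3 : cos (3 * (PI / 4)) <= cos t) by (apply cos_decr_1; lra).
  rewrite cos_3PI4 in h3.
  assert (h5 : sqrt 2 > 1.41).
  { apply Rlt_gt. rewrite <- (sqrt_pow2 1.41) by lra. apply sqrt_lt_1; lra. }
  assert (h6 : 1 / sqrt 2 < 0.71).
  { apply Rmult_lt_reg_r with (sqrt 2). lra. field_simplify; lra. }
  pose proof (sin_ge_id_cos (t/2) ltac:(lra)) as h4.
  assert (0 <= cos (t/2)) by (apply cos_ge_0; lra).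
  assert (t / 2 * cos (t/2) * cos (t/2) <= sin (t/2) * cos (t/2)) by (apply Rmult_le_compat_r; lra).
  replace (-1 / sqrt 2) with (- (1 / sqrt 2)) in h3 by (field; lra).
  assert (h7 : 0.145 <= cos (t/2) * cos (t/2)) by lra. nra.
Qed.

(** In this strip [qe w - 1] vanishes only at [w = 0], and simply. With [w = a + b i] and
    [E = exp (- 2 PI b)], its squared modulus is [(E - 1)^2 + 4 E sin (PI a)^2]: the first term
    controls [b], the second one [a]. *)
Lemma qe_minus_1_ge :
  exists kappa, 0 < kappa /\ forall w : C,
    Rabs (fst w) <= 3 / 4 -> Rabs (snd w) <= 1 -> kappa * Cmod w <= Cmod (qe w - 1)%C.
Proof.
  pose proof PI_RGT_0 as hpi. pose proof PI2_3_2 as hpi3. pose proof PI_4 as hpi4.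
  set (e0 := exp (- 2 * PI)). assert (he0 : 0 < e0) by apply exp_pos.
  assert (he01 : e0 < 1). { unfold e0. rewrite <- exp_0. apply exp_increasing. lra. }
  exists (e0 / 2). split. lra.
  intros w h1 h2. apply Rabs_le_between in h2.
  set (a := fst w) in *. set (b := snd w) in *.
  set (E := exp (-2 * PI * b)).
  assert (hE : e0 <= E). { unfold E, e0. destruct (Req_dec b 1) as [->|hb]. rewrite Rmult_1_r; lra.
    left. apply exp_increasing. nra. }
  assert (hE1 : (e0 * (2 * PI * b)) ^ 2 <= (E - 1) ^ 2).
  { pose proof (exp_ineq1_le (-2 * PI * b)) as k1. fold E in k1.
    pose proof (exp_ineq1_le (2 * PI * b)) as k2.
    assert (k3 : E * exp (2 * PI * b) = 1).
    { unfold E. rewrite <- exp_plus. replace (_ + _) with 0 by ring. apply exp_0. }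
    
    destruct (Rle_dec 0 b).
    - assert (0 <= 2 * PI * b) by nra. set (X := 2 * PI * b) in *.
      assert (E * (1 + X) <= E * exp X) by (apply Rmult_le_compat_l; lra).
      assert (e0 * X <= E * X) by (apply Rmult_le_compat_r; lra).
      assert (0 <= e0 * X) by (apply Rmult_le_pos; lra).
      assert (e0 * X <= 1 - E) by lra. nra.
    - assert (0 <= - (2 * PI * b)) by nra.
      replace (-2 * PI * b) with (- (2 * PI * b)) in k1 by ring. set (X := 2 * PI * b) in *.
      assert (e0 * - X <= 1 * - X) by (apply Rmult_le_compat_r; lra).
      assert (0 <= e0 * - X) by (apply Rmult_le_pos; lra).
      assert (e0 * - X <= E - 1) by lra. nra. }
  assert (hs : (PI * a / 7) ^ 2 <= sin (PI * a) ^ 2).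
  { assert (hh : Rabs (PI * a) / 7 <= sin (Rabs (PI * a))).
    { apply sin_ge_linear. split. apply Rabs_pos. rewrite Rabs_mult, (Rabs_right PI) by lra. nra. }
    assert (sin (Rabs (PI * a)) ^ 2 = sin (PI * a) ^ 2).
    { unfold Rabs. destruct Rcase_abs; trivial. rewrite sin_neg. ring. }
    rewrite <- H. pose proof (Rabs_pos (PI * a)).
    replace ((PI * a / 7)^2) with ((Rabs (PI * a) / 7)^2).
    apply pow_incr. lra.
    unfold Rdiv. rewrite !Rpow_mult_distr, pow2_abs. rewrite Rpow_mult_distr. ring. }
  apply Rsqr_incr_0_var; [|apply Cmod_ge_0].
  replace (Rsqr (e0 / 2 * Cmod w)) with (e0 ^2 / 4 * Cmod w ^ 2) by (unfold Rsqr; field).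
  replace (Rsqr (Cmod (qe w - 1))) with (Cmod (qe w - 1) ^ 2) by (unfold Rsqr; ring).
  rewrite !Cmod_sqr. fold a b. unfold qe, qexp. simpl fst. simpl snd. fold a b E.
  replace ((E * cos (2 * PI * a) + - (1)) ^ 2 + (E * sin (2 * PI * a) + - 0) ^ 2)
    with ((E - 1) ^ 2 + 4 * E * sin (PI * a) ^ 2).
  2: { replace (2 * PI * a) with (2 * (PI * a)) by ring. rewrite sin_2a, cos_2a.
    pose proof (sin2_cos2 (PI * a)) as hh. unfold Rsqr in hh.
    set (s := sin (PI * a)) in *. set (c := cos (PI * a)) in *.
    assert (hc : c ^ 2 = 1 - s ^ 2) by (simpl; lra).
    replace ((E * (c * c - s * s) + - (1)) ^ 2 + (E * (2 * s * c) + - 0) ^ 2)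
      with (E ^ 2 * (c ^ 2 + s ^ 2) ^ 2 - 2 * E * (c ^ 2 - s ^ 2) + 1) by ring.
    rewrite hc. ring. }
  assert (q1 : e0 ^ 2 * b ^ 2 <= (E - 1) ^ 2).
  { eapply Rle_trans; [|exact hE1].
    replace ((e0 * (2 * PI * b)) ^ 2) with ((e0 ^ 2 * b ^ 2) * (4 * PI ^ 2)) by ring.
    assert (0 <= e0 ^ 2 * b ^ 2) by (apply Rmult_le_pos; apply pow2_ge_0).
    assert (1 <= 4 * PI ^ 2) by nra. set (X := e0 ^ 2 * b ^ 2) in *. nra. }
  assert (q2 : e0 ^ 2 / 4 * a ^ 2 <= 4 * E * sin (PI * a) ^ 2).
  { replace ((PI * a / 7) ^ 2) with (PI ^ 2 / 49 * a ^ 2) in hs by field.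
    assert (a ^ 2 * (9 / 49) <= sin (PI * a) ^ 2).
    { eapply Rle_trans; [|exact hs]. pose proof (pow2_ge_0 a). assert (9 <= PI ^ 2) by nra.
      set (A := a ^ 2) in *. nra. }
    pose proof (pow2_ge_0 a).
    apply Rle_trans with (4 * E * (a ^ 2 * (9/49))).
    2: { apply Rmult_le_compat_l; lra. }
    assert (e0 ^ 2 / 4 <= 4 * E * (9/49)) by nra.
    set (A := a ^ 2) in *. nra. }
  pose proof (pow2_ge_0 b). assert (0 <= e0 ^ 2 * b ^ 2) by (apply Rmult_le_pos; [apply pow2_ge_0|lra]). lra.
Qed.

Lemma Cmod_sub_sym (z w : C) : Cmod (z - w)%C = Cmod (w - z)%C.
Proof. rewrite <- Cmod_opp. f_equal. ring. Qed.

Lemma Cmod_ge_sub (z w : C) : Cmod z - Cmod w <= Cmod (z + w)%C.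
Proof.
  assert (Cmod z <= Cmod (z + w) + Cmod (- w)%C).
  { replace z with ((z + w) + - w)%C at 1 by ring. apply Cmod_triangle. }
  rewrite Cmod_opp in H. lra.
Qed.

(** * Limits of products and inverses, finite sums *)

Lemma Clim_0_mult (u v : nat -> C) :
  Clim u 0 -> Clim v 0 -> Clim (fun n => u n * v n)%C 0.
Proof.
  intros H K eps he.
  destruct (H eps he) as [N HN]. destruct (K 1) as [M HM]. lra.
  exists (N + M)%nat. intros n hn.
  specialize (HN n ltac:(lia)). specialize (HM n ltac:(lia)).
  replace (u n - 0)%C with (u n) in HN by ring. replace (v n - 0)%C with (v n) in HM by ring.
  replace (u n * v n - 0)%C with (u n * v n)%C by ring. rewrite Cmod_mult.
  pose proof (Cmod_ge_0 (u n)). pose proof (Cmod_ge_0 (v n)). nra.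
Qed.

Lemma Clim_mult (u v : nat -> C) (l m : C) :
  Clim u l -> Clim v m -> Clim (fun n => u n * v n)%C (l * m)%C.
Proof.
  intros H K.
  assert (H0 : Clim (fun n => u n + - l)%C 0).
  { replace (RtoC 0) with (l + - l)%C by ring. apply Clim_plus. exact H. apply Clim_const. }
  assert (K0 : Clim (fun n => v n + - m)%C 0).
  { replace (RtoC 0) with (m + - m)%C by ring. apply Clim_plus. exact K. apply Clim_const. }
  pose proof (Clim_plus _ _ _ _ (Clim_0_mult _ _ H0 K0)
    (Clim_plus _ _ _ _ (Clim_scal l _ _ K) (Clim_plus _ _ _ _ (Clim_scal m _ _ H) (Clim_const (- (l * m))%C)))) as R.
  replace (0 + (l * m + (m * l + - (l * m))))%C with (l * m)%C in R by ring.
  eapply Clim_ext; [|exact R]. intros n. cbv beta. ring.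
Qed.

Lemma Clim_inv (u : nat -> C) (l : C) : l <> 0 -> Clim u l -> Clim (fun n => / u n)%C (/ l)%C.
Proof.
  intros hl H eps he. assert (hc : 0 < Cmod l) by now apply Cmod_gt_0.
  destruct (H (Rmin (Cmod l / 2) (eps * (Cmod l * Cmod l) / 2))) as [N HN].
  { apply Rmin_glb_lt. lra. apply Rdiv_lt_0_compat; [|lra]. apply Rmult_lt_0_compat; nra. }
  exists N. intros n hn. specialize (HN n hn).
  pose proof (Rmin_l (Cmod l / 2) (eps * (Cmod l * Cmod l) / 2)).
  pose proof (Rmin_r (Cmod l / 2) (eps * (Cmod l * Cmod l) / 2)).
  assert (hu : Cmod l / 2 <= Cmod (u n)).
  { replace (u n) with (l + (u n - l))%C by ring. eapply Rle_trans; [|apply Cmod_ge_sub]. lra. }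
  assert (hun : u n <> 0) by (apply Cmod_gt_0; lra).
  replace (/ u n - / l)%C with (- ((u n - l) * / (u n * l)))%C by (field; auto).
  rewrite Cmod_opp, Cmod_mult, Cmod_inv, Cmod_mult by (now apply Cmult_neq_0).
  assert (hp : Cmod l * Cmod l / 2 <= Cmod (u n) * Cmod l) by nra.
  assert (hp0 : 0 < Cmod l * Cmod l / 2) by nra.
  apply Rmult_lt_reg_r with (Cmod (u n) * Cmod l). lra.
  rewrite Rmult_assoc, Rinv_l by lra. rewrite Rmult_1_r.
  apply Rlt_le_trans with (eps * (Cmod l * Cmod l) / 2). lra. 
  replace (eps * (Cmod l * Cmod l) / 2) with (eps * (Cmod l * Cmod l / 2)) by field.
  apply Rmult_le_compat_l; lra.
Qed.

Lemma Clim_0_le (u : nat -> C) (c : R) :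
  (exists N, forall n, (N <= n)%nat -> Cmod (u n) <= c / (INR n + 1)) -> Clim u 0.
Proof.
  intros [N HN] eps he.
  destruct (nfloor_ex (Rabs c / eps)) as [K hK].
  { apply Rmult_le_pos. apply Rabs_pos. left. now apply Rinv_0_lt_compat. }
  exists (N + S K)%nat. intros n hn. specialize (HN n ltac:(lia)).
  replace (u n - 0)%C with (u n) by ring.
  assert (h : INR K + 1 <= INR n) by (rewrite <- S_INR; apply le_INR; lia).
  pose proof (pos_INR n). pose proof (pos_INR K).
  eapply Rle_lt_trans. exact HN.
  apply Rmult_lt_reg_r with (INR n + 1). lra.
  replace (c / (INR n + 1) * (INR n + 1)) with c by (field; lra).
  eapply Rle_lt_trans. apply Rle_abs.
  assert (hh : Rabs c / eps < INR n + 1) by lra.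
  apply (Rmult_lt_compat_l eps) in hh; [|lra]. 
  replace (eps * (Rabs c / eps)) with (Rabs c) in hh by (field; lra). exact hh.
Qed.

(** The upper index is excluded, unlike in [Csum_n]; empty sums and splittings of ranges then need
    no special case. *)
Fixpoint csum (f : nat -> C) (n : nat) : C :=
  match n with O => 0 | S m => csum f m + f m end.

Lemma Csum_n_csum (f : nat -> C) (n : nat) : Csum_n f n = csum f (S n).
Proof. induction n. rewrite Csum_n_0. simpl. ring. rewrite Csum_n_Sn, IHn. reflexivity. Qed.

Lemma csum_ext (f g : nat -> C) (n : nat) :
  (forall k, (k < n)%nat -> f k = g k) -> csum f n = csum g n.
Proof. induction n; intros H; simpl; trivial. rewrite IHn, H; auto. Qed.

Lemma csum_plus (f g : nat -> C) (n : nat) : csum (fun k => f k + g k)%C n = (csum f n + csum g n)%C.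
Proof. induction n; simpl. ring. rewrite IHn. ring. Qed.

Lemma csum_scal (c : C) (f : nat -> C) (n : nat) : csum (fun k => c * f k)%C n = (c * csum f n)%C.
Proof. induction n; simpl. ring. rewrite IHn. ring. Qed.

Lemma csum_add (f : nat -> C) (a b : nat) :
  csum f (a + b) = (csum f a + csum (fun k => f (a + k)%nat) b)%C.
Proof.
  induction b. rewrite Nat.add_0_r. simpl. ring.
  rewrite Nat.add_succ_r. simpl. rewrite IHb. ring.
Qed.

Lemma csum_S_l (f : nat -> C) (n : nat) : csum f (S n) = (f 0%nat + csum (fun k => f (S k)) n)%C.
Proof. induction n. simpl. ring. change (csum f (S (S n))) with (csum f (S n) + f (S n))%C. rewrite IHn. simpl. ring. Qed.

Lemma csum_rev (n : nat) : forall (f : nat -> C), csum f n = csum (fun k => f (n - 1 - k)%nat) n.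
Proof.
  induction n; intros f. reflexivity.
  rewrite csum_S_l. change (csum (fun k => f (S n - 1 - k)%nat) (S n))
    with (csum (fun k => f (S n - 1 - k)%nat) n + f (S n - 1 - n)%nat)%C.
  replace (S n - 1 - n)%nat with 0%nat by lia. rewrite IHn.
  rewrite Cplus_comm. f_equal. apply csum_ext. intros k hk. f_equal. lia.
Qed.

Lemma Cseries_finite (f : nat -> C) (L : nat) :
  (forall k, (L <= k)%nat -> f k = 0) -> Cseries f (csum f L).
Proof.
  intros H. apply Cseries_Clim. intros eps he. exists L. intros n hn.
  rewrite Csum_n_csum. replace (S n) with (L + (S n - L))%nat by lia. rewrite csum_add.
  assert (E : forall b, csum (fun k => f (L + k)%nat) b = 0).
  { induction b; simpl; trivial. rewrite IHb, H by lia. ring. }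
  rewrite E. replace (csum f L + 0 - csum f L)%C with (RtoC 0) by ring. now rewrite Cmod_0.
Qed.

(** Pairing [k] with [-1 - k] suits the doubling, pairing [k + 1] with [-(k + 1)] suits lattice
    sums. The partial sums differ by the central term [h z] and by one boundary term, which tends to
    zero. *)
Lemma Clim_shifted_pairs (h : C -> C) (z l : C) :
  Cseries (fun k => h (z + INR k) + h (z - 1 - INR k))%C l ->
  Clim (fun k => h (z + INR (S k)))%C 0 ->
  Cseries (fun k => h (z + INR (S k)) + h (z - INR (S k)))%C (l - h z)%C.
Proof.
  intros H H0. apply Cseries_Clim. apply Cseries_Clim in H.
  replace (l - h z)%C with (l + (- h z + 0))%C by ring.
  eapply Clim_ext; [|apply (Clim_plus _ _ _ _ H (Clim_plus _ _ _ _ (Clim_const (- h z)%C) H0))].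
  intros n. cbv beta. rewrite !Csum_n_csum. rewrite !csum_plus.
  rewrite (csum_S_l (fun k => h (z + INR k)%C)).
  replace (csum (fun k => h (z - 1 - INR k)%C) (S n)) with (csum (fun k => h (z - INR (S k))%C) (S n)).
  2: { apply csum_ext. intros k _. f_equal. rewrite S_INR, RtoC_plus. ring. }
  simpl (INR 0). replace (z + 0)%C with z by ring.
  change (csum (fun k => h (z + INR (S k))%C) (S n)) with (csum (fun k => h (z + INR (S k))%C) n + h (z + INR (S n)))%C.
  ring.
Qed.


Lemma INR_pow2_ge (n : nat) : INR n + 1 <= INR (2 ^ n).
Proof. rewrite <- S_INR. apply le_INR. pose proof (Nat.pow_gt_lin_r 2 n ltac:(lia)). lia. Qed.

Lemma RtoC_neq0 (x : R) : x <> 0 -> RtoC x <> 0.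
Proof. intros h K. injection K. exact h. Qed.

(** * Partial fractions *)

Section Doubling.
Variables (phi : C -> C) (w : C).
Hypothesis phi_period : forall u : C, phi (u + 1)%C = phi u.
Hypothesis phi_double : forall u : C, qe u <> 1 -> phi u = (w * (phi (u / 2) + phi (u / 2 + 1 / 2)))%C.

Lemma phi_double_sub (u : C) : qe u <> 1 -> phi u = (w * (phi (u / 2) + phi (u / 2 - 1 / 2)))%C.
Proof.
  intros hu. rewrite phi_double by exact hu. do 2 f_equal.
  rewrite <- (phi_period (u / 2 - 1 / 2)%C). f_equal. field.
Qed.

(** After [n + 1] doublings the arguments are [(z + j) / 2^(n+1)]. The period allows [j] to run
    through [-2^n, ..., 2^n - 1], and [j = k] is paired with [j = -1 - k]. *)
Definition dterm (z : C) (n k : nat) : C :=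
  (phi ((z + INR k) / (2 * INR (2 ^ n))) + phi ((z - 1 - INR k) / (2 * INR (2 ^ n))))%C.

Lemma qe_div_neq1 (u : C) (L : nat) : (0 < L)%nat -> qe u <> 1 -> qe (u / INR L)%C <> 1.
Proof.
  intros hL hu K. apply hu. replace u with (INR L * (u / INR L))%C.
  rewrite qe_pow, K. clear. induction L; simpl; trivial. rewrite IHL. ring.
  field. apply RtoC_neq0. apply not_0_INR. lia.
Qed.

Lemma qe_add_nat (u : C) (k : nat) : qe (u + INR k)%C = qe u.
Proof. rewrite qe_plus, qe_nat. ring. Qed.

Lemma qe_sub_nat (u : C) (k : nat) : qe (u - INR k)%C = qe u.
Proof. unfold Cminus. rewrite qe_plus, qe_opp, qe_nat. field. Qed.

(** Each argument is doubled towards the opposite side, with [- 1/2] for nonnegative [j] and [+ 1/2]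
    for negative [j], so that the range of [j] stays symmetric. *)
Lemma doubling (z : C) (n : nat) :
  qe z <> 1 -> phi z = (w ^ (S n) * csum (dterm z n) (2 ^ n))%C.
Proof.
  intros hz. induction n.
  - unfold dterm. simpl csum. simpl INR. rewrite phi_double_sub by exact hz. 
    replace ((z + 0) / (2 * 1))%C with (z / 2)%C by field.
    replace ((z - 1 - 0) / (2 * 1))%C with (z / 2 - 1 / 2)%C by field. simpl. ring.
  - rewrite IHn. change (w ^ S (S n))%C with (w * w ^ (S n))%C.
    rewrite (Cmult_comm w), <- Cmult_assoc. f_equal.
    set (L := (2 ^ n)%nat).
    assert (hL : (0 < L)%nat) by (unfold L; pose proof (Nat.pow_nonzero 2 n); lia).
    replace (2 ^ S n)%nat with (L + L)%nat by (unfold L; simpl; lia).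
    (* With [L = 2^n], the pair [k] produces the new pairs [k] and [2 L - 1 - k]; the upper half of
       the range is therefore read backwards. *)
    rewrite csum_add. rewrite (csum_rev L (fun k => dterm z (S n) (L + k)%nat)). rewrite <- csum_plus, <- csum_scal.
    apply csum_ext. intros k hk. unfold dterm. fold L.
    replace (2 ^ S n)%nat with (2 * L)%nat by (unfold L; simpl; lia).
    assert (hl0 : RtoC (INR L) <> 0) by (apply RtoC_neq0, not_0_INR; lia).
    replace (L + (L - 1 - k))%nat with (2 * L - S k)%nat by lia.
    assert (e1 : RtoC (INR (2 * L - S k)) = (2 * INR L - (INR k + 1))%C).
    { rewrite minus_INR, mult_INR, (S_INR k) by lia. now rewrite RtoC_minus, RtoC_mult, RtoC_plus. }
    assert (e2 : RtoC (INR (2 * L)) = (2 * INR L)%C) by (rewrite mult_INR; apply RtoC_mult).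
    rewrite e1, e2.
    rewrite phi_double_sub. rewrite (phi_double ((z - 1 - INR k) / (2 * INR L))%C).
    + replace ((z + INR k) / (2 * INR L) / 2)%C with ((z + INR k) / (2 * (2 * INR L)))%C by (field; exact hl0).
      replace ((z + INR k) / (2 * (2 * INR L)) - 1 / 2)%C
        with ((z - 1 - (2 * INR L - (INR k + 1))) / (2 * (2 * INR L)))%C by (field; exact hl0).
      replace ((z - 1 - INR k) / (2 * INR L) / 2)%C with ((z - 1 - INR k) / (2 * (2 * INR L)))%C by (field; exact hl0).
      replace ((z - 1 - INR k) / (2 * (2 * INR L)) + 1 / 2)%C
        with ((z + (2 * INR L - (INR k + 1))) / (2 * (2 * INR L)))%C by (field; exact hl0).
      ring.
    + rewrite <- e2.
      apply qe_div_neq1. lia. replace (z - 1 - INR k)%C with (z - INR (S k))%C by (rewrite S_INR, RtoC_plus; ring).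
      now rewrite qe_sub_nat.
    + rewrite <- e2.
      apply qe_div_neq1. lia. now rewrite qe_add_nat.
Qed.

(** The [n]-th sum equals [phi z] for every [n]. Padded by zero beyond [k < 2^n], these sums satisfy
    the hypotheses of [tannery], whose limit is then both [phi z] and the sum of the termwise
    limits. *)
Lemma doubling_series (z : C) (g : nat -> C) (b : nat -> R) (n0 : nat) :
  qe z <> 1 -> ex_series b ->
  (forall n k, (n0 <= n)%nat -> (k < 2 ^ n)%nat -> Cmod (w ^ (S n) * dterm z n k)%C <= b k) ->
  (forall k, 0 <= b k) ->
  (forall k, Clim (fun n => w ^ (S n) * dterm z n k)%C (g k)) ->
  Cseries g (phi z).
Proof.
  intros hz hb hdom hb0 hlim.
  set (f := fun n k => if (k <? 2 ^ n)%nat then (w ^ (S n) * dterm z n k)%C else RtoC 0).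
  destruct (tannery f g b (fun _ => phi z) n0) as [l [h1 h2]].
  - exact hb.
  - intros n k hn. unfold f. destruct (Nat.ltb_spec k (2 ^ n)). now apply hdom. rewrite Cmod_0. apply hb0.
  - intros k eps he. destruct (hlim k eps he) as [N HN]. exists (N + k)%nat. intros n hn.
    unfold f. destruct (Nat.ltb_spec k (2 ^ n)). apply HN. lia.
    pose proof (Nat.pow_gt_lin_r 2 n). lia.
  - intros n. rewrite (doubling z n hz). rewrite <- csum_scal.
    rewrite (csum_ext _ (f n)). apply Cseries_finite.
    + intros k hk. unfold f. destruct (Nat.ltb_spec k (2 ^ n)); [lia|reflexivity].
    + intros k hk. unfold f. destruct (Nat.ltb_spec k (2 ^ n)); [reflexivity|lia].
  - rewrite (Clim_unique _ _ _ (Clim_const (phi z)) h2). exact h1.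
Qed.
End Doubling.

Lemma pos_lower_bound (f : nat -> R) (K : nat) :
  (forall k, 0 < f k) -> exists c, 0 < c /\ forall k, (k <= K)%nat -> c <= f k.
Proof.
  intros H. induction K as [|K [c [hc h]]].
  - exists (f 0%nat). split. apply H. intros k hk. replace k with 0%nat by lia. lra.
  - exists (Rmin c (f (S K))). split. now apply Rmin_glb_lt.
    intros k hk. destruct (Nat.eq_dec k (S K)) as [->|]. apply Rmin_r.
    eapply Rle_trans. apply Rmin_l. apply h. lia.
Qed.

Lemma Cmod_nat (n : nat) : Cmod (INR n) = INR n.
Proof. rewrite Cmod_R. apply Rabs_right, Rle_ge, pos_INR. Qed.

(** Beyond [2 Cmod z + 1] the triangle inequality gives the factor [1/2]; the finitely many
    remaining indices have a positive minimum. *)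
Lemma add_nat_lower_bound (z : C) :
  (forall k, (z + INR k)%C <> 0) ->
  exists c, 0 < c /\ forall k, c * (INR k + 1) <= Cmod (z + INR k)%C.
Proof.
  intros H.
  destruct (nfloor_ex (2 * Cmod z + 1)) as [K hK]. pose proof (Cmod_ge_0 z); lra.
  destruct (pos_lower_bound (fun k => Cmod (z + INR k)%C / (INR k + 1)) K) as [c [hc h]].
  { intros k. apply Rdiv_lt_0_compat. now apply Cmod_gt_0. pose proof (pos_INR k); lra. }
  exists (Rmin c (1/2)). split. apply Rmin_glb_lt; lra.
  intros k. pose proof (pos_INR k) as hk0. destruct (le_lt_dec k K) as [hk|hk].
  - specialize (h k hk). apply Rle_trans with (c * (INR k + 1)).
    apply Rmult_le_compat_r. lra. apply Rmin_l.
    apply (Rmult_le_compat_r (INR k + 1)) in h; [|lra].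
    replace (Cmod (z + INR k)%C / (INR k + 1) * (INR k + 1)) with (Cmod (z + INR k)%C) in h by (field; lra). exact h.
  - apply Rle_trans with (1/2 * (INR k + 1)). apply Rmult_le_compat_r. lra. apply Rmin_r.
    rewrite Cplus_comm. pose proof (Cmod_ge_sub (INR k) z). rewrite Cmod_nat in H0.
    assert (INR K + 1 <= INR k) by (rewrite <- S_INR; apply le_INR; lia). lra.
Qed.

Lemma is_series_inv_square : ex_series (fun k => / ((INR k + 1) * (INR k + 1))).
Proof.
  apply (ex_series_le (V:=R_CompleteNormedModule) _ (fun k => 2 * (/ (INR k + 1) - / (INR (S k) + 1)))).
  - intros k. rewrite S_INR. pose proof (pos_INR k).
    change (Rabs (/ ((INR k + 1) * (INR k + 1))) <= 2 * (/ (INR k + 1) - / (INR k + 1 + 1))).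
    rewrite Rabs_right. 2: { apply Rle_ge. left. apply Rinv_0_lt_compat. nra. }
    replace (2 * (/ (INR k + 1) - / (INR k + 1 + 1))) with (/ ((INR k + 1) * (INR k + 1 + 1) / 2)) by (field; lra).
    apply Rinv_le_contravar; nra.
  - exists 2. apply is_series_Reals. intros eps he.
    destruct (nfloor_ex (2 / eps)) as [N hN]. apply Rmult_le_pos. lra. left; now apply Rinv_0_lt_compat.
    exists N. intros n hn.
    assert (E : sum_f_R0 (fun k => 2 * (/ (INR k + 1) - / (INR (S k) + 1))) n = 2 - 2 / (INR n + 2)).
    { clear. induction n. simpl. field. 
      rewrite tech5, IHn. rewrite !S_INR. pose proof (pos_INR n). field. lra. }
    rewrite E. unfold Rdist. replace (2 - 2 / (INR n + 2) - 2) with (- (2 / (INR n + 2))) by ring.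
    rewrite Rabs_Ropp. pose proof (pos_INR n). rewrite Rabs_right.
    2: { apply Rle_ge, Rmult_le_pos. lra. left. apply Rinv_0_lt_compat. lra. }
    apply le_INR in hn. apply Rmult_lt_reg_r with (INR n + 2). lra.
    replace (2 / (INR n + 2) * (INR n + 2)) with 2 by (field; lra).
    assert (2 / eps < INR n + 2) by lra. apply (Rmult_lt_compat_l eps) in H0; trivial.
    replace (eps * (2 / eps)) with 2 in H0 by (field; lra). lra.
Qed.

Lemma ex_series_Rscal (c : R) (b : nat -> R) : ex_series b -> ex_series (fun k => c * b k).
Proof. intros [l hl]. exists (c * l). exact (is_series_scal_l (V:=R_NormedModule) c b l hl). Qed.

(** * Squared cosecant and cotangent *)

Lemma qe_half : qe (1 / 2)%C = -1.
Proof.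
  replace (1 / 2)%C with (RtoC (1/2)) by (now rewrite RtoC_div).
  apply C_ext; unfold qe, qexp; simpl; rewrite Rmult_0_r, exp_0;
  replace (2 * PI * (1/2)) with PI by field; rewrite ?cos_PI, ?sin_PI; ring.
Qed.

Lemma qe_add_half (u : C) : qe (u + 1 / 2)%C = (- qe u)%C.
Proof. rewrite qe_plus, qe_half. ring. Qed.

Lemma qe_half_sqr (u : C) : qe u = (qe (u / 2) * qe (u / 2))%C.
Proof. rewrite <- qe_plus. f_equal. field. Qed.

Lemma qe_add_1 (u : C) : qe (u + 1)%C = qe u.
Proof. rewrite qe_plus, qe_1. ring. Qed.

Lemma Csub_neq0 (z w : C) : z <> w -> (z - w)%C <> 0.
Proof. intros h K. apply h. replace z with (z - w + w)%C by ring. rewrite K. ring. Qed.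

(** [csc2 z] is [PI^2 / sin^2 (PI z)], and [icot z] below is [cot (PI z) / i], both written in
    [qe z] so that they connect directly with [q]-series. *)
Definition csc2 (z : C) : C := (- (4 * PI * PI) * (qe z / ((1 - qe z) * (1 - qe z))))%C.
Definition icot (z : C) : C := ((qe z + 1) / (qe z - 1))%C.

Lemma qe_half_neq (u : C) : qe u <> 1 -> (1 - qe (u/2))%C <> 0 /\ (1 + qe (u/2))%C <> 0.
Proof.
  intros hu. rewrite qe_half_sqr in hu. set (s := qe (u/2)%C) in *. split.
  - intros K. apply hu. replace s with (1 - (1 - s))%C by ring. rewrite K. ring.
  - intros K. apply hu. replace s with ((1 + s) - 1)%C by ring. rewrite K. ring.
Qed.

Lemma csc2_double (u : C) : qe u <> 1 -> csc2 u = (/ 4 * (csc2 (u / 2) + csc2 (u / 2 + 1 / 2)))%C.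
Proof.
  intros hu. destruct (qe_half_neq u hu) as [h1 h2]. unfold csc2. rewrite qe_add_half, (qe_half_sqr u).
  set (s := qe (u/2)%C) in *. field. repeat split; trivial.
  - replace (1 - - s)%C with (1 + s)%C by ring. exact h2.
  - replace (1 - s * s)%C with ((1 - s) * (1 + s))%C by ring. now apply Cmult_neq_0.
Qed.

Lemma icot_double (u : C) : qe u <> 1 -> icot u = (/ 2 * (icot (u / 2) + icot (u / 2 + 1 / 2)))%C.
Proof.
  intros hu. destruct (qe_half_neq u hu) as [h1 h2]. unfold icot. rewrite qe_add_half, (qe_half_sqr u).
  set (s := qe (u/2)%C) in *.
  assert (h3 : (s - 1)%C <> 0) by (intros K; apply h1; replace (1 - s)%C with (- (s - 1))%C by ring; rewrite K; ring).
  assert (h4 : (- s - 1)%C <> 0) by (intros K; apply h2; replace (1 + s)%C with (- (- s - 1))%C by ring; rewrite K; ring).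
  field. repeat split; trivial.
  replace (s * s - 1)%C with (- (s - 1) * (- s - 1))%C by ring.
  apply Cmult_neq_0; trivial. intros K; apply h3. replace (s - 1)%C with (- - (s - 1))%C by ring. rewrite K. ring.
Qed.

Section Scaling.
Variable u : C.
Let t (n : nat) : C := (u / (2 * INR (2 ^ n)))%C.

Lemma two_pow_pos (n : nat) : 0 < 2 * INR (2 ^ n).
Proof. pose proof (INR_pow2_ge n). pose proof (pos_INR n). lra. Qed.

Lemma scaled_eq (n : nat) : (2 * INR (2 ^ n) * t n)%C = u.
Proof.
  unfold t. pose proof (two_pow_pos n). field. apply RtoC_neq0. lra.
Qed.

Lemma Cmod_two_pow (n : nat) : Cmod (2 * INR (2 ^ n))%C = 2 * INR (2 ^ n).
Proof.
  rewrite <- RtoC_mult, Cmod_R. apply Rabs_right. pose proof (two_pow_pos n). lra.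
Qed.

Lemma Cmod_scaled (n : nat) : 2 * INR (2 ^ n) * Cmod (t n) = Cmod u.
Proof. rewrite <- (f_equal Cmod (scaled_eq n)), Cmod_mult, Cmod_two_pow. reflexivity. Qed.

Lemma Cmod_scaled_small (n : nat) : Cmod (t n) <= Cmod u / (INR n + 1).
Proof.
  pose proof (INR_pow2_ge n). pose proof (pos_INR n). pose proof (Cmod_ge_0 (t n)).
  apply Rmult_le_reg_r with (INR n + 1). lra.
  replace (Cmod u / (INR n + 1) * (INR n + 1)) with (Cmod u) by (field; lra).
  rewrite <- (Cmod_scaled n). nra.
Qed.

Lemma scaled_Clim0 : Clim t 0.
Proof. apply Clim_0_le with (Cmod u). exists 0%nat. intros n _. apply Cmod_scaled_small. Qed.

Lemma scaled_eventually_small (eps : R) : 0 < eps -> exists N, forall n, (N <= n)%nat -> Cmod (t n) <= eps.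
Proof.
  intros he. destruct (scaled_Clim0 eps he) as [N HN]. exists N. intros n hn. left.
  specialize (HN n hn). now replace (t n - 0)%C with (t n) in HN by ring.
Qed.

Lemma qe_scaled_Clim : Clim (fun n => 2 * INR (2 ^ n) * (qe (t n) - 1))%C (2 * PI * Ci * u)%C.
Proof.
  assert (H : Clim (fun n => 2 * INR (2 ^ n) * (qe (t n) - 1 - 2 * PI * Ci * t n))%C 0).
  { apply Clim_0_le with (1000 * (Cmod u * Cmod u)).
    destruct (scaled_eventually_small (1/20)) as [N HN]. lra.
    exists N. intros n hn. specialize (HN n hn). apply qe_first_order in HN.
    rewrite Cmod_mult, Cmod_two_pow.
    pose proof (two_pow_pos n).
    apply Rle_trans with (2 * INR (2 ^ n) * (1000 * Cmod (t n) ^ 2)). 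
    apply Rmult_le_compat_l. lra. exact HN.
    replace (2 * INR (2 ^ n) * (1000 * Cmod (t n) ^ 2)) with (1000 * (2 * INR (2 ^ n) * Cmod (t n)) * Cmod (t n)) by ring.
    rewrite Cmod_scaled. replace (1000 * (Cmod u * Cmod u) / (INR n + 1)) with (1000 * Cmod u * (Cmod u / (INR n + 1))).
    apply Rmult_le_compat_l. pose proof (Cmod_ge_0 u); lra. apply Cmod_scaled_small.
    field. pose proof (pos_INR n); lra. }
  replace (2 * PI * Ci * u)%C with (0 + 2 * PI * Ci * u)%C by ring.
  eapply Clim_ext; [|apply (Clim_plus _ _ _ _ H (Clim_const (2 * PI * Ci * u)%C))].
  intros n. cbv beta. rewrite <- (f_equal (Cmult (2 * PI * Ci)) (scaled_eq n)). ring.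
Qed.

Lemma qe_scaled_Clim1 : Clim (fun n => qe (t n)) 1.
Proof.
  assert (H : Clim (fun n => (qe (t n) - 1 - 2 * PI * Ci * t n))%C 0).
  { apply Clim_0_le with (1000 * Cmod u).
    destruct (scaled_eventually_small (1/20)) as [N HN]. lra.
    exists N. intros n hn. specialize (HN n hn). pose proof (qe_first_order _ HN).
    eapply Rle_trans. exact H. pose proof (Cmod_scaled_small n). pose proof (Cmod_ge_0 (t n)).
    apply Rle_trans with (1000 * Cmod (t n)). nra.
    unfold Rdiv. rewrite Rmult_assoc. apply Rmult_le_compat_l. lra. exact H0. }
  replace (RtoC 1) with (0 + (2 * PI * Ci * 0 + 1))%C by ring.
  eapply Clim_ext; [|apply (Clim_plus _ _ _ _ H (Clim_plus _ _ _ _ (Clim_scal (2 * PI * Ci)%C _ _ scaled_Clim0) (Clim_const 1)))].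
  intros n. cbv beta. ring.
Qed.

Lemma two_pi_i_neq0 : (2 * PI * Ci)%C <> 0.
Proof.
  apply Cmult_neq_0. rewrite <- RtoC_mult. apply RtoC_neq0. pose proof PI_RGT_0. nra.
  intros K. apply (f_equal snd) in K. simpl in K. lra.
Qed.

Lemma inv_pow_eq (a : C) (n : nat) : (a <> 0)%C -> (/ a ^ n)%C = ((/ a) ^ n)%C.
Proof. intros ha. induction n; simpl. field. rewrite <- IHn. field. split; trivial. now apply Cpow_nz. Qed.

Lemma Cpow_two_INR (n : nat) : (2 ^ S n)%C = (2 * INR (2 ^ n))%C.
Proof.
  induction n. simpl. ring. change (2 ^ S (S n))%C with (2 * 2 ^ S n)%C. rewrite IHn.
  change (2 ^ S n)%nat with (2 * 2 ^ n)%nat. rewrite mult_INR, RtoC_mult. reflexivity.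
Qed.

Lemma half_pow (n : nat) : ((/ 2) ^ S n)%C = (/ (2 * INR (2 ^ n)))%C.
Proof. rewrite <- Cpow_two_INR. symmetry. apply inv_pow_eq. apply RtoC_neq0. lra. Qed.

Lemma quarter_pow (n : nat) : ((/ 4) ^ S n)%C = (/ (2 * INR (2 ^ n)) * / (2 * INR (2 ^ n)))%C.
Proof.
  rewrite <- half_pow. rewrite <- Cpow_mult_l. f_equal. field.
Qed.

Hypothesis hu : u <> 0.

Lemma icot_scaled_Clim : Clim (fun n => (/ 2) ^ S n * icot (t n))%C (2 / (2 * PI * Ci * u))%C.
Proof.
  pose proof two_pi_i_neq0.
  assert (h0 : (2 * PI * Ci * u)%C <> 0) by now apply Cmult_neq_0.
  replace (2 / (2 * PI * Ci * u))%C with ((1 + 1) * / (2 * PI * Ci * u))%C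
    by (unfold Cdiv; f_equal; rewrite <- RtoC_plus; f_equal; ring).
  eapply Clim_ext; [|apply Clim_mult; [apply Clim_plus; [exact qe_scaled_Clim1|exact (Clim_const 1)]|exact (Clim_inv _ _ h0 qe_scaled_Clim)]].
  intros n. cbv beta. rewrite half_pow. unfold icot. unfold Cdiv.
  pose proof (two_pow_pos n). assert (RtoC (INR (2 ^ n)) <> 0) by (apply RtoC_neq0; lra).
  (* For small [n] the argument may be an integer. Both sides are then zero, because the inverse of
     zero is zero. *)
  destruct (Ceq_dec (qe (t n) - 1)%C 0) as [E|E].
  - rewrite E. replace (2 * INR (2 ^ n) * 0)%C with (RtoC 0) by ring.
    assert (E0 : (/ 0)%C = 0) by (apply C_ext; simpl; unfold Rdiv; ring). rewrite E0. ring.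
  - field. now split.
Qed.

Lemma csc2_scaled_Clim : Clim (fun n => (/ 4) ^ S n * csc2 (t n))%C (/ (u * u))%C.
Proof.
  pose proof two_pi_i_neq0.
  assert (h0 : (2 * PI * Ci * u)%C <> 0) by now apply Cmult_neq_0.
  assert (hpi : RtoC PI <> 0) by (apply RtoC_neq0; pose proof PI_RGT_0; lra).
  assert (hi : (Ci * Ci)%C = (-1)%C) by (apply C_ext; simpl; ring).
  assert (hci : Ci <> 0) by (intros K; apply (f_equal snd) in K; simpl in K; lra).
  replace (/ (u * u))%C with (- (4 * PI * PI) * (1 * (/ (2 * PI * Ci * u) * / (2 * PI * Ci * u))))%C.
  2: { replace (/ (2 * PI * Ci * u) * / (2 * PI * Ci * u))%C with (/ (4 * PI * PI * (Ci * Ci) * (u * u)))%C.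
       rewrite hi. field. split; trivial.
       field. repeat split; trivial. }
  eapply Clim_ext; [|apply (Clim_scal (- (4 * PI * PI))%C _ _ (Clim_mult _ _ _ _ qe_scaled_Clim1
     (Clim_mult _ _ _ _ (Clim_inv _ _ h0 qe_scaled_Clim) (Clim_inv _ _ h0 qe_scaled_Clim))))].
  intros n. cbv beta. rewrite quarter_pow. unfold csc2. unfold Cdiv.
  pose proof (two_pow_pos n). assert (RtoC (INR (2 ^ n)) <> 0) by (apply RtoC_neq0; lra).
  replace (1 - qe (t n))%C with (- (qe (t n) - 1))%C by ring.
  destruct (Ceq_dec (qe (t n) - 1)%C 0) as [E|E].
  - rewrite E. replace (2 * INR (2 ^ n) * 0)%C with (RtoC 0) by ring.
    replace (- 0 * - 0)%C with (RtoC 0) by ring.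
    assert (E0 : (/ 0)%C = 0) by (apply C_ext; simpl; unfold Rdiv; ring). rewrite E0. ring.
  - field. now split.
Qed.
End Scaling.

Lemma qe_neq1_add_nat (z : C) : qe z <> 1 -> forall k, (z + INR k)%C <> 0.
Proof. intros hz k K. apply hz. rewrite <- (qe_add_nat z k), K. apply qe_0. Qed.

Lemma qe_neq1_sub_nat (z : C) : qe z <> 1 -> forall k, (z - 1 - INR k)%C <> 0.
Proof.
  intros hz k K. apply hz. rewrite <- (qe_sub_nat z (S k)).
  replace (z - INR (S k))%C with (z - 1 - INR k)%C by (rewrite S_INR, RtoC_plus; ring). rewrite K. apply qe_0.
Qed.

Lemma exp_mono (x y : R) : x <= y -> exp x <= exp y.
Proof. intros [h| ->]; [left; now apply exp_increasing|lra]. Qed.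

(* For [k < 2 ^ n] both arguments occurring in the [n]-th doubling lie in the strip where [qe_minus_1_ge] applies. *)
Lemma doubling_bounds (z : C) : qe z <> 1 -> exists c n0, 0 < c /\
  (forall k, c * (INR k + 1) <= Cmod (z + INR k)%C /\ c * (INR k + 1) <= Cmod (z - 1 - INR k)%C) /\
  forall n k, (n0 <= n)%nat -> (k < 2 ^ n)%nat -> forall u, u = (z + INR k)%C \/ u = (z - 1 - INR k)%C ->
    let t := (u / (2 * INR (2 ^ n)))%C in
    c * Cmod u <= 2 * INR (2 ^ n) * Cmod (qe t - 1)%C /\ Cmod (qe t) <= exp (2 * PI).
Proof.
  intros hz. destruct qe_minus_1_ge as [kappa [hk0 hk]].
  destruct (add_nat_lower_bound z (qe_neq1_add_nat z hz)) as [c1 [hc1 h1]].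
  destruct (add_nat_lower_bound (1 - z)%C) as [c2 [hc2 h2]].
  { intros k K. apply (qe_neq1_sub_nat z hz k). replace (z - 1 - INR k)%C with (- (1 - z + INR k))%C by ring.
    rewrite K. ring. }
  destruct (nfloor_ex (2 * (Cmod z + 1))) as [n0 hn0]. pose proof (Cmod_ge_0 z); lra.
  exists (Rmin (Rmin c1 c2) kappa), (S n0).
  pose proof (Rmin_l (Rmin c1 c2) kappa). pose proof (Rmin_r (Rmin c1 c2) kappa).
  pose proof (Rmin_l c1 c2). pose proof (Rmin_r c1 c2).
  split; [|split].
  - repeat apply Rmin_glb_lt; trivial.
  - intros k. pose proof (pos_INR k). split.
    + eapply Rle_trans; [|apply h1]. apply Rmult_le_compat_r; lra.
    + replace (z - 1 - INR k)%C with (- (1 - z + INR k))%C by ring. rewrite Cmod_opp.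
      eapply Rle_trans; [|apply h2]. apply Rmult_le_compat_r; lra.
  - intros n k hn hkn u hu t.
    pose proof (two_pow_pos n) as hL. set (L := INR (2 ^ n)) in *.
    assert (hzL : 2 * (Cmod z + 1) <= L).
    { pose proof (INR_pow2_ge n). fold L in H3. apply le_INR in hn. rewrite S_INR in hn. lra. }
    assert (hkL : 0 <= INR k <= L - 1).
    { split. apply pos_INR. apply le_INR in hkn. rewrite S_INR in hkn. fold L in hkn. lra. }
    assert (ht : forall (x : R), fst t = fst u / (2 * L) /\ snd t = snd u / (2 * L)).
    { intros _. assert (E : u = (RtoC (2 * L) * t)%C).
      { unfold t. rewrite RtoC_mult. field. apply RtoC_neq0; lra. }
      rewrite E. simpl. split; field; lra. }
    destruct (ht 0) as [ht1 ht2]. clear ht.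
    pose proof (Rabs_fst_le z) as hf. pose proof (Rabs_snd_le z) as hs.
    apply Rabs_le_between in hf. apply Rabs_le_between in hs.
    assert (h3 : Rabs (fst t) <= 3 / 4 /\ Rabs (snd t) <= 1).
    { rewrite ht1, ht2. assert (- (3/4 * (2 * L)) <= fst u <= 3/4 * (2 * L) /\ - (2 * L) <= snd u <= 2 * L).
      { destruct hu as [->| ->]; simpl; lra. }
      split; apply Rabs_le; split; apply Rmult_le_reg_r with (2 * L); try lra;
      unfold Rdiv; rewrite Rmult_assoc, Rinv_l; lra. }
    split.
    + pose proof (hk t (proj1 h3) (proj2 h3)).
      rewrite <- (Cmod_scaled u n). fold t. fold L.
      apply Rle_trans with (kappa * (2 * L * Cmod t)).
      apply Rmult_le_compat_r. apply Rmult_le_pos. lra. apply Cmod_ge_0. lra. nra.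
    + rewrite Cmod_qe. destruct h3 as [_ h3]. apply Rabs_le_between in h3.
      pose proof PI_RGT_0. apply exp_mono. nra.
Qed.

Theorem csc2_series (z : C) :
  qe z <> 1 ->
  Cseries (fun k => / ((z + INR k) * (z + INR k)) + / ((z - 1 - INR k) * (z - 1 - INR k)))%C (csc2 z).
Proof.
  intros hz. destruct (doubling_bounds z hz) as [c [n0 [hc [hlow hdom]]]].
  (* Each term has numerator at most [4 PI^2 exp (2 PI)], and [2^(n+1) (qe t - 1)], which occurs
     squared in the denominator, is at least [c * c * (k + 1)] in modulus; the factor 2 accounts for
     the pair. *)
  set (K := 2 * (4 * PI * PI * exp (2 * PI) / (c * c * (c * c)))).
  assert (hK : 0 < 4 * PI * PI * exp (2 * PI)).
  { pose proof PI_RGT_0. apply Rmult_lt_0_compat; [nra|apply exp_pos]. }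
  apply (doubling_series csc2 (/ 4)%C) with (b := fun k => K * / ((INR k + 1) * (INR k + 1))) (n0 := n0).
  - intros u. unfold csc2. now rewrite qe_add_1.
  - exact csc2_double.
  - exact hz.
  - apply ex_series_Rscal, is_series_inv_square.
  - intros n k hn hk. unfold dterm. rewrite Cmult_plus_distr_l. rewrite quarter_pow.
    assert (B : forall u, u = (z + INR k)%C \/ u = (z - 1 - INR k)%C ->
      Cmod (/ (2 * INR (2 ^ n)) * / (2 * INR (2 ^ n)) * csc2 (u / (2 * INR (2 ^ n))))%C
      <= K / 2 * / ((INR k + 1) * (INR k + 1))).
    { intros u hu. destruct (hdom n k hn hk u hu) as [h1 h2].
      assert (h3 : c * (INR k + 1) <= Cmod u) by (destruct (hlow k); destruct hu as [-> | ->]; trivial).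
      set (t := (u / (2 * INR (2 ^ n)))%C) in *. pose proof (two_pow_pos n) as hL.
      pose proof (pos_INR k) as hk0.
      assert (h4 : c * (c * (INR k + 1)) <= 2 * INR (2 ^ n) * Cmod (qe t - 1)%C).
      { eapply Rle_trans; [|exact h1]. apply Rmult_le_compat_l; lra. }
      assert (hp : 0 < c * (c * (INR k + 1))) by (repeat apply Rmult_lt_0_compat; lra).
      assert (hq : 0 < Cmod (qe t - 1)%C) by (apply Rmult_lt_reg_l with (2 * INR (2 ^ n)); lra).
      assert (hn1 : (1 - qe t)%C <> 0) by (apply Cmod_gt_0; now rewrite Cmod_sub_sym).
      assert (hn2 : (2 * INR (2 ^ n))%C <> 0) by (rewrite <- RtoC_mult; apply RtoC_neq0; lra).
      unfold csc2. rewrite !Cmod_mult, Cmod_div, Cmod_opp, !Cmod_mult, !Cmod_inv, !Cmod_R, Cmod_two_pow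
        by (trivial; now apply Cmult_neq_0).
      rewrite (Cmod_sub_sym 1 (qe t)).
      rewrite (Rabs_right 4), (Rabs_right PI) by (pose proof PI_RGT_0; lra).
      set (X := 2 * INR (2 ^ n)) in *. set (Y := Cmod (qe t - 1)%C) in *.
      replace (/ X * / X * (4 * PI * PI * (Cmod (qe t) / (Y * Y)))) with (4 * PI * PI * Cmod (qe t) / ((X * Y) * (X * Y))) by (field; lra).
      replace (K / 2 * / ((INR k + 1) * (INR k + 1))) with
        (4 * PI * PI * exp (2 * PI) / ((c * (c * (INR k + 1))) * (c * (c * (INR k + 1))))) by (unfold K; field; lra).
      apply Rmult_le_compat.
      - pose proof PI_RGT_0. apply Rmult_le_pos; [nra|apply Cmod_ge_0].
      - left. apply Rinv_0_lt_compat. apply Rmult_lt_0_compat; lra.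
      - pose proof PI_RGT_0. apply Rmult_le_compat_l; trivial. nra.
      - apply Rinv_le_contravar. now apply Rmult_lt_0_compat. apply Rmult_le_compat; lra. }
    eapply Rle_trans. apply Cmod_triangle.
    pose proof (B _ (or_introl eq_refl)). pose proof (B _ (or_intror eq_refl)). lra.
  - intros k. apply Rmult_le_pos. unfold K. apply Rmult_le_pos. lra. apply Rmult_le_pos. lra.
    left. apply Rinv_0_lt_compat. repeat apply Rmult_lt_0_compat; lra.
    left. apply Rinv_0_lt_compat. pose proof (pos_INR k). nra.
  - intros k. unfold dterm. eapply Clim_ext; [|apply Clim_plus; apply csc2_scaled_Clim].
    intros n. cbv beta. ring. now apply qe_neq1_add_nat. now apply qe_neq1_sub_nat.
Qed.

Lemma qe_minus_1_le (t : C) : Cmod t <= 1 / 20 -> Cmod (qe t - 1)%C <= 80 * Cmod t.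
Proof.
  intros ht. pose proof (qe_first_order t ht).
  replace (qe t - 1)%C with ((qe t - 1 - 2 * PI * Ci * t) + 2 * PI * Ci * t)%C by ring.
  eapply Rle_trans. apply Cmod_triangle. rewrite !Cmod_mult, Cmod_Ci, !Cmod_R, !Rabs_right by (pose proof PI_RGT_0; lra).
  pose proof PI_4. pose proof (Cmod_ge_0 t). nra.
Qed.

(** A single cotangent decays only like [1/k]; the pair must be kept together. With [q1 = qe t1] and
    [q2 = qe t2], [icot t1 + icot t2 = 2 (q1 q2 - 1) / ((q1 - 1)(q2 - 1))], where
    [q1 q2 = qe (t1 + t2)] and [t1 + t2 = (2 z - 1) / 2^(n+1)] does not depend on [k]. So the
    numerator is small, and the pair is of order [1/k^2]. *)
Theorem icot_series (z : C) :
  qe z <> 1 ->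
  Cseries (fun k => / (z + INR k) + / (z - 1 - INR k))%C (PI * Ci * icot z)%C.
Proof.
  intros hz. destruct (doubling_bounds z hz) as [c [n0 [hc [hlow hdom]]]].
  destruct (scaled_eventually_small (2 * z - 1) (1/20)) as [n1 hn1]. lra.
  set (W := Cmod (2 * z - 1)%C).
  set (K := 160 * W / (c * c * (c * c))).
  assert (hW : 0 <= W) by apply Cmod_ge_0.
  assert (hc2 : 0 < c * c) by nra.
  assert (H : Cseries (fun k => 2 / (2 * PI * Ci * (z + INR k)) + 2 / (2 * PI * Ci * (z - 1 - INR k)))%C (icot z)).
  - apply (doubling_series icot (/ 2)%C) with (b := fun k => K * / ((INR k + 1) * (INR k + 1))) (n0 := (n0 + n1)%nat).
    + intros u. unfold icot. now rewrite qe_add_1.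
    + exact icot_double.
    + exact hz.
    + apply ex_series_Rscal, is_series_inv_square.
    + intros n k hn hk. unfold dterm. rewrite half_pow.
      destruct (hdom n k ltac:(lia) hk _ (or_introl eq_refl)) as [h1 _].
      destruct (hdom n k ltac:(lia) hk _ (or_intror eq_refl)) as [h2 _].
      destruct (hlow k) as [h3 h4]. specialize (hn1 n ltac:(lia)).
      pose proof (qe_minus_1_le _ hn1) as h5.
      pose proof (Cmod_scaled (2 * z - 1) n) as h6. cbv zeta beta in h5, h6. fold W in h6.
      set (t1 := ((z + INR k) / (2 * INR (2 ^ n)))%C) in *.
      set (t2 := ((z - 1 - INR k) / (2 * INR (2 ^ n)))%C) in *.
      pose proof (two_pow_pos n) as hL. pose proof (pos_INR k) as hk0.
      assert (hn2 : (2 * INR (2 ^ n))%C <> 0) by (rewrite <- RtoC_mult; apply RtoC_neq0; lra).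
      assert (hn3 : RtoC (INR (2 ^ n)) <> 0) by (apply RtoC_neq0; lra).
      replace ((2 * z - 1) / (2 * INR (2 ^ n)))%C with (t1 + t2)%C in * by (unfold t1, t2; field; trivial).
      rewrite qe_plus in h5.
      assert (hp : 0 < c * (c * (INR k + 1))) by (repeat apply Rmult_lt_0_compat; lra).
      assert (g1 : c * (c * (INR k + 1)) <= 2 * INR (2 ^ n) * Cmod (qe t1 - 1)%C).
      { eapply Rle_trans; [|exact h1]. apply Rmult_le_compat_l; lra. }
      assert (g2 : c * (c * (INR k + 1)) <= 2 * INR (2 ^ n) * Cmod (qe t2 - 1)%C).
      { eapply Rle_trans; [|exact h2]. apply Rmult_le_compat_l; lra. }
      assert (q1 : 0 < Cmod (qe t1 - 1)%C) by (apply Rmult_lt_reg_l with (2 * INR (2 ^ n)); lra).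
      assert (q2 : 0 < Cmod (qe t2 - 1)%C) by (apply Rmult_lt_reg_l with (2 * INR (2 ^ n)); lra).
      apply Cmod_gt_0 in q1 as r1. apply Cmod_gt_0 in q2 as r2.
      replace (/ (2 * INR (2 ^ n)) * (icot t1 + icot t2))%C
        with (2 * (qe t1 * qe t2 - 1) / (2 * INR (2 ^ n) * ((qe t1 - 1) * (qe t2 - 1))))%C
        by (unfold icot; field; auto).
      rewrite Cmod_div, !(Cmod_mult (2 * INR (2 ^ n))), Cmod_two_pow, !Cmod_mult, Cmod_R, Rabs_right
        by (try lra; repeat apply Cmult_neq_0; trivial; apply RtoC_neq0; lra).
      set (X := 2 * INR (2 ^ n)) in *. set (Y1 := Cmod (qe t1 - 1)%C) in *. set (Y2 := Cmod (qe t2 - 1)%C) in *.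
      replace (2 * Cmod (qe t1 * qe t2 - 1)%C / (X * (Y1 * Y2)))
        with (2 * (X * Cmod (qe t1 * qe t2 - 1)%C) / ((X * Y1) * (X * Y2))) by (field; lra).
      replace (K * / ((INR k + 1) * (INR k + 1))) with
        (160 * W / ((c * (c * (INR k + 1))) * (c * (c * (INR k + 1))))) by (unfold K; field; lra).
      apply Rmult_le_compat.
      * apply Rmult_le_pos; [lra|]. apply Rmult_le_pos; [lra|apply Cmod_ge_0].
      * left. apply Rinv_0_lt_compat. apply Rmult_lt_0_compat; lra.
      * apply (Rmult_le_compat_l X) in h5; lra.
      * apply Rinv_le_contravar. now apply Rmult_lt_0_compat. apply Rmult_le_compat; lra.
    + intros k. apply Rmult_le_pos. unfold K. apply Rmult_le_pos. lra. left. apply Rinv_0_lt_compat. now apply Rmult_lt_0_compat.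
      left. apply Rinv_0_lt_compat. pose proof (pos_INR k). nra.
    + intros k. unfold dterm. eapply Clim_ext; [|apply Clim_plus; apply icot_scaled_Clim].
      intros n. cbv beta. ring. now apply qe_neq1_add_nat. now apply qe_neq1_sub_nat.
  - apply (Cseries_scal (PI * Ci)%C) in H.
    eapply Cseries_ext; [|exact H].
    intros k. cbv beta.
    pose proof (qe_neq1_add_nat z hz k). pose proof (qe_neq1_sub_nat z hz k).
    assert (hci : Ci <> 0) by (intros Q; apply (f_equal snd) in Q; simpl in Q; lra).
    assert (hpi : RtoC PI <> 0) by (apply RtoC_neq0; pose proof PI_RGT_0; lra).
    assert (E : forall x : C, x <> 0 -> (PI * Ci * (2 / (2 * PI * Ci * x)))%C = (/ x)%C).
    { intros x hx. field. auto. }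
    rewrite Cmult_plus_distr_l, !E; trivial.
Qed.

Lemma qe_neq1 (z : C) : snd z <> 0 -> qe z <> 1.
Proof.
  intros hz K. apply (f_equal Cmod) in K. rewrite Cmod_qe, Cmod_1, <- exp_0 in K.
  apply exp_inv in K. pose proof PI_RGT_0. apply hz. nra.
Qed.

Lemma inv_add_nat_Clim (z : C) : Clim (fun k => / (z + INR k))%C 0.
Proof.
  apply Clim_0_le with 2.
  destruct (nfloor_ex (2 * Cmod z + 1)) as [K hK]. pose proof (Cmod_ge_0 z); lra.
  exists (S K). intros k hk. apply le_INR in hk. rewrite S_INR in hk.
  pose proof (Cmod_ge_sub (INR k) z) as h. rewrite Cmod_nat in h. rewrite Cplus_comm.
  assert (h0 : (INR k + 1) / 2 <= Cmod (INR k + z)%C) by lra.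
  pose proof (pos_INR k).
  rewrite Cmod_inv by (apply Cmod_gt_0; lra).
  replace (2 / (INR k + 1)) with (/ ((INR k + 1) / 2)) by (field; lra).
  apply Rinv_le_contravar; lra.
Qed.

Lemma inv_sub_nat_Clim (z : C) : Clim (fun k => / (z - INR k))%C 0.
Proof.
  replace (RtoC 0) with (-1 * 0)%C by ring.
  eapply Clim_ext; [|exact (Clim_scal (-1)%C _ _ (inv_add_nat_Clim (- z)%C))].
  intros k. cbv beta. replace (z - INR k)%C with (- (- z + INR k))%C by ring.
  destruct (Ceq_dec (- z + INR k)%C 0) as [E|E].
  - rewrite E. replace (-0)%C with (RtoC 0) by ring.
    apply C_ext; simpl; unfold Rdiv; ring.
  - field. repeat split; trivial.
Qed.

Lemma csc2_shifted_series (z : C) : qe z <> 1 ->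
  Cseries (fun k => / ((z + INR (S k)) * (z + INR (S k))) + / ((z - INR (S k)) * (z - INR (S k))))%C
    (csc2 z - / (z * z))%C.
Proof.
  intros hz. apply (Clim_shifted_pairs (fun u => / (u * u))%C). now apply csc2_series.
  pose proof (inv_add_nat_Clim z) as H. apply Clim_shift in H.
  eapply Clim_ext; [|exact (Clim_0_mult _ _ H H)].
  intros k. cbv beta. pose proof (qe_neq1_add_nat z hz (S k)). field. trivial.
Qed.

Lemma icot_shifted_series (z : C) : qe z <> 1 ->
  Cseries (fun k => / (z + INR (S k)) + / (z - INR (S k)))%C (PI * Ci * icot z - / z)%C.
Proof.
  intros hz. apply (Clim_shifted_pairs (fun u => / u)%C). now apply icot_series.
  apply (Clim_shift _ _ (inv_add_nat_Clim z)).
Qed.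

Lemma Cseries_telescoping (T : nat -> C) : Clim T 0 -> Cseries (fun n => T (S n) - T n)%C (- T 0%nat)%C.
Proof.
  intros H. apply Cseries_Clim. replace (- T 0%nat)%C with (0 + - T 0%nat)%C by ring.
  eapply Clim_ext; [|exact (Clim_plus _ _ _ _ (Clim_shift _ _ H) (Clim_const (- T 0%nat)%C))].
  intros n. cbv beta. rewrite Csum_n_csum. symmetry. induction n. simpl. ring.
  change (csum (fun n => T (S n) - T n)%C (S (S n))) with (csum (fun n => T (S n) - T n)%C (S n) + (T (S (S n)) - T (S n)))%C.
  rewrite IHn. ring.
Qed.

(** * Quasi-modularity of [E2] *)

Section EisensteinSwap.
Variable tau : C.
Hypothesis htau : 0 < snd tau.

Definition halfshift (n : nat) : C := (INR n + 1 / 2)%C.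
(** With [y = (m + 1) tau + j], one has [1/(y^2 - 1/4) = 1/(y - 1/2) - 1/(y + 1/2)]; summed over
    [-n <= j <= n] this telescopes to [tele m n]. *)
Definition tele (m n : nat) : C :=
  (/ (INR (S m) * tau - halfshift n) - / (INR (S m) * tau + halfshift n))%C.
(* [1/y^2 - 1/(y^2 - 1/4)] summed over [y = m tau + n, m tau - n]; subtracting the telescoping term makes the double series absolutely convergent. *)
Definition swap_term (m n : nat) : C :=
  match n with
  | O => / ((INR (S m) * tau) * (INR (S m) * tau)) - tele m 0
  | S k => / ((INR (S m) * tau + INR n) * (INR (S m) * tau + INR n))
           + / ((INR (S m) * tau - INR n) * (INR (S m) * tau - INR n)) - (tele m n - tele m k)
  end%C.

Lemma mtau_Im (m : nat) : 0 < snd (INR (S m) * tau)%C.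
Proof.
  change (0 < INR (S m) * snd tau + 0 * fst tau). rewrite Rmult_0_l, Rplus_0_r.
  apply Rmult_lt_0_compat; trivial. apply lt_0_INR. lia.
Qed.

Lemma mtau_add_real_neq0 (m : nat) (t : R) : (INR (S m) * tau + t)%C <> 0.
Proof.
  intros K. apply (f_equal snd) in K. pose proof (mtau_Im m).
  change (snd (INR (S m) * tau)%C + 0 = 0) in K. lra.
Qed.

Lemma mtau_sub_real_neq0 (m : nat) (t : R) : (INR (S m) * tau - t)%C <> 0.
Proof. unfold Cminus. rewrite <- RtoC_opp. apply mtau_add_real_neq0. Qed.

Lemma halfshift_RtoC (n : nat) : halfshift n = RtoC (INR n + 1 / 2).
Proof. unfold halfshift. now rewrite RtoC_plus, RtoC_div by lra. Qed.

Lemma quad_form_lower : exists c, 0 < c /\ forall (m : nat) (t : R),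
  c * (INR (S m) ^ 2 + t ^ 2) <= Cmod (INR (S m) * tau + t)%C ^ 2.
Proof.
  set (x := fst tau). set (y := snd tau). set (s := 1 + x ^ 2 + y ^ 2).
  assert (hs : 0 < s) by (unfold s; pose proof (pow2_ge_0 x); pose proof (pow2_ge_0 y); lra).
  assert (hy : 0 < y ^ 2) by (apply pow_lt; exact htau).
  (* Determinant over trace of the quadratic form [(M x + t)^2 + (M y)^2] in [M] and [t], which is a
     lower bound for its least eigenvalue. *)
  exists (y ^ 2 / s). split. now apply Rdiv_lt_0_compat.
  intros m t. rewrite Cmod_sqr. set (M := INR (S m)).
  change (fst (M * tau + t)%C) with (M * x - 0 * y + t). change (snd (M * tau + t)%C) with (M * y + 0 * x + 0).
  set (c := y ^ 2 / s).
  assert (hc : c * s = y ^ 2) by (unfold c; field; lra).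
  assert (hD : 0 < 1 - c).
  { apply Rmult_lt_reg_r with s; trivial. rewrite Rmult_minus_distr_r, hc. unfold s. pose proof (pow2_ge_0 x). lra. }
  apply Rmult_le_reg_l with (1 - c); trivial.
  assert (E : (1 - c) * ((M * x - 0 * y + t) ^ 2 + (M * y + 0 * x + 0) ^ 2) - (1 - c) * (c * (M ^ 2 + t ^ 2))
     = ((1 - c) * t + x * M) ^ 2 + c ^ 2 * M ^ 2 + (y ^ 2 - c * s) * M ^ 2).
  { unfold s. ring. }
  rewrite hc in E. pose proof (pow2_ge_0 ((1 - c) * t + x * M)).
  assert (0 <= c ^ 2 * M ^ 2) by (apply Rmult_le_pos; apply pow2_ge_0). lra.
Qed.

(** The difference [1/u^2 - 1/(u^2 - 1/4)] is [-1/4] over [u^2 (u - 1/2)(u + 1/2)]. By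
    [quad_form_lower] and the inequality between arithmetic and geometric means, [u^2] and
    [(u - 1/2)(u + 1/2)] are both at least [c/8 (m + 1)(n + 1)] in modulus, whence a bound of
    product form. *)
Lemma swap_term_bound : exists K, 0 <= K /\ forall m n,
  Cmod (swap_term m n) <= / ((INR m + 1) * (INR m + 1)) * (K * / ((INR n + 1) * (INR n + 1))).
Proof.
  destruct quad_form_lower as [c [hc H]].
  assert (hcc : 0 < c * c) by nra.
  exists (32 / (c * c)). split. apply Rmult_le_pos. lra. left; now apply Rinv_0_lt_compat.
  assert (L : forall (m n : nat) (t : R), Rabs (Rabs t - INR n) <= 1 / 2 ->
     c / 8 * ((INR m + 1) * (INR n + 1)) <= Cmod (INR (S m) * tau + t)%C ^ 2).
  { intros m n t ht. eapply Rle_trans; [|apply H]. rewrite S_INR. pose proof (pos_INR m).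
    unfold Rdiv. rewrite Rmult_assoc. apply Rmult_le_compat_l. lra.
    rewrite <- (pow2_abs t). set (T := Rabs t) in *. assert (0 <= T) by apply Rabs_pos. set (M := INR m) in *.
    apply Rabs_le_between in ht.
    destruct n as [|n]. simpl INR. nra. rewrite S_INR in *. pose proof (pos_INR n). set (N := INR n) in *.
    assert ((N + 1) / 2 <= T) by lra.
    assert (((N + 1) / 2) ^ 2 <= T ^ 2) by (apply pow_incr; lra).
    pose proof (pow2_ge_0 (M + 1 - (N + 1) / 2)). nra. }
  assert (B : forall (m n : nat) (t : R), Rabs t = INR n ->
     Cmod (/ ((INR (S m) * tau + t) * (INR (S m) * tau + t))
       - / ((INR (S m) * tau + (t - 1 / 2)%R) * (INR (S m) * tau + (t + 1 / 2)%R)))%C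
     <= / ((INR m + 1) * (INR m + 1)) * (4 * 4 / (c * c) * / ((INR n + 1) * (INR n + 1)))).
  { intros m n t ht.
    pose proof (mtau_add_real_neq0 m t) as n1. pose proof (mtau_add_real_neq0 m (t - 1/2)) as n2.
    pose proof (mtau_add_real_neq0 m (t + 1/2)) as n3.
    pose proof (L m n t) as l1. pose proof (L m n (t - 1/2)) as l2. pose proof (L m n (t + 1/2)) as l3.
    rewrite ht in l1. replace (INR n - INR n) with 0 in l1 by ring. rewrite Rabs_R0 in l1. specialize (l1 ltac:(lra)).
    assert (g : forall d, Rabs d = 1 / 2 -> Rabs (Rabs (t + d) - INR n) <= 1 / 2).
    { intros d hd. rewrite <- ht, <- hd. eapply Rle_trans. apply Rabs_triang_inv2. right. f_equal. ring. }
    specialize (l2 (g (- (1/2)) ltac:(rewrite Rabs_Ropp; apply Rabs_right; lra))).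
    specialize (l3 (g (1/2) ltac:(apply Rabs_right; lra))).
    set (u := (INR (S m) * tau + t)%C) in *.
    assert (e2 : (INR (S m) * tau + (t - 1 / 2)%R)%C = (u - 1/2)%C) by (unfold u; rewrite RtoC_minus, RtoC_div by lra; ring).
    assert (e3 : (INR (S m) * tau + (t + 1 / 2)%R)%C = (u + 1/2)%C) by (unfold u; rewrite RtoC_plus, RtoC_div by lra; ring).
    rewrite e2 in *. rewrite e3 in *.
    set (v := (u - 1/2)%C) in *. set (w := (u + 1/2)%C) in *.
    replace (/ (u * u) - / (v * w))%C with (- (1/4) * / ((u * u) * (v * w)))%C.
    2: { replace (-(1/4))%C with (v * w - u * u)%C. field. auto. unfold v, w. field. }
    rewrite Cmod_mult, Cmod_opp, Cmod_inv by (repeat apply Cmult_neq_0; trivial).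
    rewrite Cmod_div, !Cmod_R, !Cmod_mult, !Rabs_right by (try lra; apply RtoC_neq0; lra).
    apply Cmod_gt_0 in n1, n2, n3.
    set (U := Cmod u) in *. set (V := Cmod v) in *. set (W := Cmod w) in *.
    pose proof (pos_INR m). pose proof (pos_INR n).
    set (Z := c / 8 * ((INR m + 1) * (INR n + 1))) in *.
    assert (hZ : 0 < Z) by (unfold Z; repeat apply Rmult_lt_0_compat; lra).
    assert (hVW : Z <= V * W).
    { apply Rsqr_incr_0_var; [|nra]. unfold Rsqr. replace (V * W * (V * W)) with (V ^ 2 * W ^ 2) by ring.
      apply Rmult_le_compat; lra. }
    replace (/ ((INR m + 1) * (INR m + 1)) * (4 * 4 / (c * c) * / ((INR n + 1) * (INR n + 1))))
      with (1 / 4 * / (Z * Z)) by (unfold Z; field; lra).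
    apply Rmult_le_compat_l. lra. apply Rinv_le_contravar. nra.
    apply Rmult_le_compat; lra. }
  intros m n.
  assert (P : 0 <= / ((INR m + 1) * (INR m + 1)) * (4 * 4 / (c * c) * / ((INR n + 1) * (INR n + 1)))).
  { pose proof (pos_INR m). pose proof (pos_INR n).
    apply Rmult_le_pos; [left; apply Rinv_0_lt_compat; nra|].
    apply Rmult_le_pos; [|left; apply Rinv_0_lt_compat; nra].
    apply Rmult_le_pos; [lra|left; now apply Rinv_0_lt_compat]. }
  replace (/ ((INR m + 1) * (INR m + 1)) * (32 / (c * c) * / ((INR n + 1) * (INR n + 1))))
    with (2 * (/ ((INR m + 1) * (INR m + 1)) * (4 * 4 / (c * c) * / ((INR n + 1) * (INR n + 1)))))
    by (pose proof (pos_INR m); pose proof (pos_INR n); field; lra).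
  destruct n as [|k]; unfold swap_term, tele; rewrite !halfshift_RtoC.
  - pose proof (B m 0%nat 0 Rabs_R0) as b0.
    pose proof (mtau_add_real_neq0 m (0 - 1/2)) as n2. pose proof (mtau_add_real_neq0 m (0 + 1/2)) as n3.
    replace (/ (INR (S m) * tau - (INR 0 + 1 / 2)%R) - / (INR (S m) * tau + (INR 0 + 1 / 2)%R))%C
      with (/ ((INR (S m) * tau + (0 - 1 / 2)%R) * (INR (S m) * tau + (0 + 1 / 2)%R)))%C.
    + replace (INR (S m) * tau + 0)%C with (INR (S m) * tau)%C in b0 by ring. lra.
    + simpl (INR 0). rewrite RtoC_minus, RtoC_plus, RtoC_div in * by lra.
      set (x := (INR (S m) * tau)%C) in *.
      replace (x + (0 - 1 / 2))%C with (x - (0 + 1/2))%C in * by ring.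
      set (a := (x - (0 + 1/2))%C) in *. set (b := (x + (0 + 1/2))%C) in *.
      transitivity ((b - a) * / (a * b))%C. replace (b - a)%C with (RtoC 1) by (unfold a, b; field). ring.
      field; auto.
  - set (n := S k) in *.
    pose proof (B m n (INR n) (Rabs_right _ (Rle_ge _ _ (pos_INR n)))) as b1.
    assert (b2 := B m n (- INR n)). rewrite Rabs_Ropp in b2. specialize (b2 (Rabs_right _ (Rle_ge _ _ (pos_INR n)))).
    assert (hk : INR k = INR n - 1) by (unfold n; rewrite S_INR; ring). rewrite hk.
    pose proof (mtau_add_real_neq0 m (INR n - 1/2)) as n1. pose proof (mtau_add_real_neq0 m (INR n + 1/2)) as n2.
    pose proof (mtau_add_real_neq0 m (- INR n - 1/2)) as n3. pose proof (mtau_add_real_neq0 m (- INR n + 1/2)) as n4.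
    pose proof (mtau_add_real_neq0 m (INR n)) as n5. pose proof (mtau_add_real_neq0 m (- INR n)) as n6.
    match type of b1 with Cmod ?A <= _ => set (X := A) in * end.
    match type of b2 with Cmod ?A <= _ => set (Y := A) in * end.
    match goal with |- Cmod ?A <= _ => replace A with (X + Y)%C end.
    + eapply Rle_trans. apply Cmod_triangle. lra.
    + unfold X, Y. rewrite ?RtoC_minus, ?RtoC_plus, ?RtoC_minus, ?RtoC_opp, ?RtoC_div in * by lra.
      set (x := (INR (S m) * tau)%C) in *. set (N := RtoC (INR n)) in *.
      replace (x + - N)%C with (x - N)%C in * by ring.
      replace (x + (- N - 1 / 2))%C with (x - (N + 1/2))%C in * by ring.
      replace (x + (- N + 1 / 2))%C with (x - (N - 1/2))%C in * by ring.
      replace (N - 1 + 1 / 2)%C with (N - 1/2)%C in * by field.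
      set (a := (x + (N - 1/2))%C) in *. set (b := (x + (N + 1/2))%C) in *.
      set (d := (x - (N - 1/2))%C) in *. set (f := (x - (N + 1/2))%C) in *.
      replace (/ (a * b))%C with (/ a - / b)%C.
      2: { transitivity ((b - a) * / (a * b))%C. field; auto. replace (b - a)%C with (RtoC 1) by (unfold a, b; field). ring. }
      replace (/ (f * d))%C with (/ f - / d)%C.
      2: { transitivity ((d - f) * / (f * d))%C. field; auto. replace (d - f)%C with (RtoC 1) by (unfold d, f; field). ring. }
      ring.
Qed.

Lemma tele_Clim (m : nat) : Clim (tele m) 0.
Proof.
  set (x := (INR (S m) * tau)%C).
  replace (RtoC 0) with (0 + -1 * 0)%C by ring.
  eapply Clim_ext; [|exact (Clim_plus _ _ _ _ (inv_sub_nat_Clim (x - 1/2)%C) (Clim_scal (-1)%C _ _ (inv_add_nat_Clim (x + 1/2)%C)))].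
  intros n. cbv beta. unfold tele, halfshift. fold x.
  replace (x - 1/2 - INR n)%C with (x - (INR n + 1/2))%C by ring.
  replace (x + 1/2 + INR n)%C with (x + (INR n + 1/2))%C by ring. ring.
Qed.

(** Rows do not feel the subtraction: [tele m n] tends to zero in [n], so its differences sum to
    [- tele m 0], which the term in column zero compensates. *)
Lemma swap_row (m : nat) : Cseries (swap_term m) (csc2 (INR (S m) * tau)%C).
Proof.
  pose proof (mtau_Im m) as hm. set (x := (INR (S m) * tau)%C) in *.
  assert (hx : qe x <> 1) by (apply qe_neq1; lra).
  pose proof (Cseries_minus _ _ _ _ (csc2_shifted_series x hx) (Cseries_telescoping _ (tele_Clim m))) as H.
  replace (csc2 x) with ((swap_term m 0%nat) + (csc2 x - / (x * x) - - tele m 0))%C by (unfold swap_term; fold x; ring).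
  apply Cseries_cons. exact H.
Qed.

Definition halfpoint (n : nat) : C := (halfshift n / tau)%C.
(** Sum of [tele m n] over [m]: dividing by [tau] turns it into a cotangent expansion at
    [(n + 1/2) / tau]. *)
Definition tele_sum (n : nat) : C := (- / tau * (PI * Ci * icot (halfpoint n) - / halfpoint n))%C.

Lemma tau_neq0 : tau <> 0.
Proof. intros K. rewrite K in htau. simpl in htau. lra. Qed.

Lemma real_div_tau_Im (t : R) : snd (t / tau)%C = - t * (snd tau / (fst tau ^ 2 + snd tau ^ 2)).
Proof.
  pose proof (pow_lt (snd tau) 2 htau). pose proof (pow2_ge_0 (fst tau)).
  simpl. field. simpl in *. lra.
Qed.

Lemma real_div_tau_Im_neg (t : R) : 0 < t -> snd (t / tau)%C < 0.
Proof.
  intros ht. rewrite real_div_tau_Im.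
  assert (0 < snd tau / (fst tau ^ 2 + snd tau ^ 2)).
  { apply Rdiv_lt_0_compat; trivial. pose proof (pow_lt (snd tau) 2 htau). pose proof (pow2_ge_0 (fst tau)). lra. }
  nra.
Qed.

Lemma real_div_tau_qe (t : R) : 0 < t -> qe (t / tau)%C <> 1.
Proof. intros ht. apply qe_neq1. pose proof (real_div_tau_Im_neg t ht). lra. Qed.

Lemma div_tau_add (m : nat) (t : R) :
  (t / tau + INR (S m))%C = (/ tau * (INR (S m) * tau + t))%C.
Proof. field. apply tau_neq0. Qed.

Lemma div_tau_sub (m : nat) (t : R) :
  (t / tau - INR (S m))%C = (- / tau * (INR (S m) * tau - t))%C.
Proof. field. apply tau_neq0. Qed.

Lemma tele_series (n : nat) : Cseries (fun m => tele m n) (tele_sum n).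
Proof.
  unfold tele_sum, halfpoint, tele. rewrite halfshift_RtoC. set (t := INR n + 1/2).
  assert (ht : 0 < t) by (unfold t; pose proof (pos_INR n); lra).
  eapply Cseries_ext; [|exact (Cseries_scal (- / tau)%C _ _ (icot_shifted_series _ (real_div_tau_qe t ht)))].
  intros m. cbv beta. rewrite div_tau_add, div_tau_sub.
  pose proof tau_neq0. pose proof (mtau_add_real_neq0 m t). pose proof (mtau_sub_real_neq0 m t).
  field. auto.
Qed.

Variable zeta2 : C.
Hypothesis hzeta2 : Cseries (fun m => / (INR (S m) * INR (S m)))%C zeta2.

Definition swap_col (n : nat) : C :=
  match n with
  | O => / (tau * tau) * zeta2 - tele_sum 0
  | S k => / (tau * tau) * csc2 (INR n / tau) - / (INR n * INR n) - (tele_sum n - tele_sum k)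
  end%C.

Lemma INR_S_neq0 (m : nat) : RtoC (INR (S m)) <> 0.
Proof. apply RtoC_neq0, not_0_INR. lia. Qed.

Lemma swap_column (n : nat) : Cseries (fun m => swap_term m n) (swap_col n).
Proof.
  pose proof tau_neq0 as ht. destruct n as [|k].
  - apply Cseries_minus; [|apply tele_series].
    eapply Cseries_ext; [|exact (Cseries_scal (/ (tau * tau))%C _ _ hzeta2)].
    intros m. cbv beta. pose proof (INR_S_neq0 m). field. auto.
  - unfold swap_term, swap_col. set (n := S k).
    apply Cseries_minus; [|apply Cseries_minus; apply tele_series].
    assert (hn : 0 < INR n) by (apply lt_0_INR; unfold n; lia).
    pose proof (Cseries_scal (/ (tau * tau))%C _ _ (csc2_shifted_series _ (real_div_tau_qe (INR n) hn))) as H.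
    replace (/ (tau * tau) * csc2 (INR n / tau) - / (INR n * INR n))%C
      with (/ (tau * tau) * (csc2 (INR n / tau) - / (INR n / tau * (INR n / tau))))%C.
    2: { field. split; trivial. apply RtoC_neq0. lra. }
    eapply Cseries_ext; [|exact H].
    intros m. cbv beta. rewrite div_tau_add, div_tau_sub.
    pose proof (mtau_add_real_neq0 m (INR n)). pose proof (mtau_sub_real_neq0 m (INR n)).
    field. auto.
Qed.

Lemma swap_col_sum (n : nat) : csum swap_col (S n) =
  (/ (tau * tau) * (zeta2 + csum (fun k => csc2 (INR (S k) / tau)) n)
   - csum (fun k => / (INR (S k) * INR (S k))) n - tele_sum n)%C.
Proof.
  induction n. cbn [csum]. unfold swap_col. ring.
  change (csum swap_col (S (S n))) with (csum swap_col (S n) + swap_col (S n))%C. rewrite IHn.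
  cbn [csum]. unfold swap_col. ring.
Qed.

(** The points [(n + 1/2) / tau] go down in the lower half plane, so [qe] tends to infinity there
    and [icot = 1 + 2 / (qe - 1)] tends to [1]. *)
Lemma icot_halfpoint_Clim : Clim (fun n => icot (halfpoint n)) 1.
Proof.
  apply Clim_ext with (fun n => 1 + 2 * / (qe (halfpoint n) - 1))%C.
  { intros n. unfold icot. unfold halfpoint. rewrite halfshift_RtoC.
    assert (ht : 0 < INR n + 1/2) by (pose proof (pos_INR n); lra).
    pose proof (Csub_neq0 _ _ (real_div_tau_qe _ ht)).
    set (q := qe _) in *. replace (q + 1)%C with (q - 1 + 2)%C. field; trivial.
    replace (RtoC 2) with (1 + 1)%C by (rewrite <- RtoC_plus; f_equal; ring). ring. }
  assert (H : Clim (fun n => / (qe (halfpoint n) - 1))%C 0).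
  2: { pose proof (Clim_plus _ _ _ _ (Clim_const 1) (Clim_scal 2 _ _ H)) as K.
       replace (1 + 2 * 0)%C with (RtoC 1) in K by ring. exact K. }
  set (d := snd tau / (fst tau ^ 2 + snd tau ^ 2)).
  assert (hd : 0 < d).
  { apply Rdiv_lt_0_compat; trivial. pose proof (pow_lt (snd tau) 2 htau). pose proof (pow2_ge_0 (fst tau)). lra. }
  apply Clim_0_le with (/ d). exists 0%nat. intros n _.
  unfold halfpoint. rewrite halfshift_RtoC.
  assert (ht : 0 < INR n + 1/2) by (pose proof (pos_INR n); lra).
  rewrite Cmod_inv by (apply Csub_neq0, real_div_tau_qe, ht).
  replace (/ d / (INR n + 1)) with (/ (d * (INR n + 1))) by (field; pose proof (pos_INR n); lra).
  pose proof (pos_INR n).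
  apply Rinv_le_contravar. apply Rmult_lt_0_compat; lra.
  set (q := qe _).
  (* The factor [6] is a lower bound for [2 PI]. *)
  assert (hq : 1 + 6 * d * (INR n + 1/2) <= Cmod q).
  { unfold q. rewrite Cmod_qe, real_div_tau_Im. fold d. 
    eapply Rle_trans; [|apply exp_ineq1_le]. pose proof PI2_3_2.
    assert (0 <= d * (INR n + 1/2)) by (apply Rmult_le_pos; lra). nra. }
  unfold Cminus. pose proof (Cmod_ge_sub q (- (1))%C). rewrite Cmod_opp, Cmod_1 in H0. nra.
Qed.

Lemma tele_sum_Clim : Clim tele_sum (- (PI * Ci / tau))%C.
Proof.
  pose proof tau_neq0 as ht0.
  replace (- (PI * Ci / tau))%C with (- / tau * (PI * Ci * 1 + -1 * (tau * 0)))%C by (field; trivial).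
  apply Clim_scal.
  assert (H : Clim (fun n => / halfpoint n)%C (tau * 0)%C).
  { eapply Clim_ext; [|exact (Clim_scal tau _ _ (inv_add_nat_Clim (1/2)%C))].
    intros n. cbv beta. unfold halfpoint, halfshift. rewrite Cplus_comm.
    assert (INR n + 1/2 <> 0)%C.
    { pose proof (halfshift_RtoC n) as E. unfold halfshift in E. rewrite E. apply RtoC_neq0. pose proof (pos_INR n). lra. }
    field. split; trivial. intros K; apply H. replace (INR n + 1/2)%C with ((INR n * 2 + 1) / 2)%C by field. rewrite K. field. }
  eapply Clim_ext; [|exact (Clim_plus _ _ _ _ (Clim_scal (PI * Ci)%C _ _ icot_halfpoint_Clim) (Clim_scal (-1)%C _ _ H))].
  intros n. cbv beta. ring.
Qed.

(** Absolute convergence makes the sums by rows and by columns agree. The telescoping part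
    disappears by rows but leaves the limit of [tele_sum] by columns; this limit is the defect
    [PI * Ci / tau] of modularity. *)
Theorem eisenstein_swap (s s' : C) :
  Cseries (fun m => csc2 (INR (S m) * tau)) s ->
  Cseries (fun n => csc2 (INR (S n) / tau)) s' ->
  (zeta2 + s = / (tau * tau) * (zeta2 + s') + PI * Ci / tau)%C.
Proof.
  intros hs hs'.
  destruct swap_term_bound as [K [hK0 hK]].
  destruct (fubini_prod swap_term (fun m => csc2 (INR (S m) * tau)%C) swap_col
    (fun m => / ((INR m + 1) * (INR m + 1))) (fun n => K * / ((INR n + 1) * (INR n + 1)))) as [l [h1 h2]].
  - apply swap_row.
  - apply swap_column.
  - exact hK.
  - intros m. left. apply Rinv_0_lt_compat. pose proof (pos_INR m). nra.
  - intros n. apply Rmult_le_pos; trivial. left. apply Rinv_0_lt_compat. pose proof (pos_INR n). nra.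
  - apply is_series_inv_square.
  - apply ex_series_Rscal, is_series_inv_square.
  - rewrite (Cseries_unique _ _ _ hs h2). clear h2 hs s.
    apply Cseries_Clim in h1, hs', hzeta2. apply Clim_shift in h1.
    assert (E : l = (/ (tau * tau) * (zeta2 + s') + -1 * zeta2 + -1 * (- (PI * Ci / tau)))%C).
    { apply (Clim_unique _ _ _ h1).
      eapply Clim_ext; [|exact (Clim_plus _ _ _ _ (Clim_plus _ _ _ _ (Clim_scal (/ (tau * tau))%C _ _ (Clim_plus _ _ _ _ (Clim_const zeta2) hs'))
         (Clim_scal (-1)%C _ _ hzeta2)) (Clim_scal (-1)%C _ _ (Clim_shift _ _ tele_sum_Clim)))].
      intros n. cbv beta. rewrite !Csum_n_csum, swap_col_sum. ring. }
    rewrite E. ring.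
Qed.
End EisensteinSwap.

(** * Lambert series and the value of zeta at 2 *)

Lemma nat_mul_pow_bounded (t : R) : 0 <= t < 1 -> exists B, 0 <= B /\ forall n, INR n * t ^ n <= B.
Proof.
  intros [h0 h1]. destruct (Req_dec t 0) as [->|ht].
  - exists 0. split. lra. intros [|n]; simpl pow; [simpl; lra|rewrite Rmult_0_l; lra].
  - set (d := / t - 1).
    assert (hd : 0 < d). { unfold d. assert (1 < / t). { rewrite <- Rinv_1. apply Rinv_lt_contravar; lra. } lra. }
    exists (/ d). split. left; now apply Rinv_0_lt_compat.
    intros n. pose proof (poly n d hd) as H.
    replace (1 + d) with (/ t) in H by (unfold d; ring).
    rewrite pow_inv in H. assert (hp : 0 < t ^ n) by (apply pow_lt; lra).
    apply Rmult_le_reg_r with d; trivial. rewrite Rinv_l by lra.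
    apply (Rmult_le_compat_l (t ^ n)) in H; [|lra]. rewrite Rinv_r in H by lra. nra.
Qed.

(** Writing [t^n] as [sqrt t ^ n * sqrt t ^ n], one half absorbs a factor [n] and the other half
    serves the induction on [k]. *)
Lemma ex_series_poly_geom (k : nat) : forall (t : R), 0 <= t < 1 -> ex_series (fun n => INR n ^ k * t ^ n).
Proof.
  induction k; intros t ht.
  - apply (ex_series_ext (fun n => t ^ n)). intros n; simpl; ring.
    exists (/ (1 - t)). apply is_series_geom. rewrite Rabs_right; lra.
  - assert (hs : 0 <= sqrt t < 1).
    { split. apply sqrt_pos. rewrite <- sqrt_1. apply sqrt_lt_1; lra. }
    destruct (nat_mul_pow_bounded (sqrt t) hs) as [B [hB H]].
    apply (ex_series_le (V:=R_CompleteNormedModule) _ (fun n => B * (INR n ^ k * sqrt t ^ n))).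
    + intros n. change (Rabs (INR n ^ S k * t ^ n) <= B * (INR n ^ k * sqrt t ^ n)).
      pose proof (pos_INR n). pose proof (pow_le _ k H0). assert (0 <= sqrt t ^ n) by (apply pow_le; lra).
      assert (E : INR n ^ S k * t ^ n = (INR n * sqrt t ^ n) * (INR n ^ k * sqrt t ^ n)).
      { rewrite <- (sqrt_sqrt t) at 1 by lra. rewrite Rpow_mult_distr. simpl. ring. }
      rewrite E, Rabs_right. apply Rmult_le_compat_r. now apply Rmult_le_pos. apply H.
      apply Rle_ge. repeat apply Rmult_le_pos; trivial.
    + apply ex_series_Rscal, IHk, hs.
Qed.

Lemma ex_series_shift (b : nat -> R) : ex_series b -> ex_series (fun n => b (S n)).
Proof. intros H. now apply (ex_series_incr_1 b). Qed.

Lemma Cmod_lt_1_sub_neq0 (x : C) : Cmod x < 1 -> (1 - x)%C <> 0.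
Proof.
  intros h K. assert (E : x = 1) by (replace x with (1 - (1 - x))%C by ring; rewrite K; ring).
  rewrite E, Cmod_1 in h. lra.
Qed.

(** Here and in the two series that follow, convergence comes from domination and the value from an
    equation relating the series to its own tail. *)
Lemma Cseries_geom (x : C) : Cmod x < 1 -> Cseries (fun i => x ^ S i)%C (x / (1 - x))%C.
Proof.
  intros hx. pose proof (Cmod_ge_0 x) as h0.
  destruct (ex_series_poly_geom 0 (Cmod x)) as [B HB]. lra.
  edestruct (Cseries_dominated (fun i => x ^ i)%C) with (2 := HB) as [l [hl _]].
  { intros n. rewrite Cmod_pow. simpl. lra. }
  pose proof (Cseries_tail _ _ hl) as ht.
  assert (E : (l - x ^ 0)%C = (x * l)%C) by (apply (Cseries_unique _ _ _ ht); exact (Cseries_scal x _ _ hl)).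
  simpl in E. pose proof (Cmod_lt_1_sub_neq0 x hx).
  assert (El : l = (/ (1 - x))%C).
  { replace l with ((l - x * l) * / (1 - x))%C by (field; trivial). rewrite <- E. ring. }
  replace (x / (1 - x))%C with (x * l)%C by (rewrite El; reflexivity).
  exact (Cseries_scal x _ _ hl).
Qed.

Lemma Cseries_geom_deriv (x : C) : Cmod x < 1 ->
  Cseries (fun i => INR (S i) * x ^ S i)%C (x / ((1 - x) * (1 - x)))%C.
Proof.
  intros hx. pose proof (Cmod_ge_0 x) as h0.
  destruct (ex_series_shift _ (ex_series_poly_geom 1 (Cmod x) ltac:(lra))) as [B HB].
  edestruct (Cseries_dominated (fun i => INR (S i) * x ^ S i)%C) with (2 := HB) as [l [hl _]].
  { intros n. rewrite Cmod_mult, Cmod_nat, Cmod_pow. rewrite pow_1. lra. }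
  pose proof (Cseries_tail _ _ hl) as ht.
  pose proof (Cseries_plus _ _ _ _ (Cseries_scal x _ _ hl) (Cseries_scal x _ _ (Cseries_geom x hx))) as hp.
  assert (E : (l - INR 1 * x ^ 1)%C = (x * l + x * (x / (1 - x)))%C).
  { apply (Cseries_unique _ _ _ ht). eapply Cseries_ext; [|exact hp]. intros n. cbv beta.
    rewrite (S_INR (S n)), RtoC_plus. change (x ^ S (S n))%C with (x * x ^ S n)%C. ring. }
  simpl in E. pose proof (Cmod_lt_1_sub_neq0 x hx).
  replace (x / ((1 - x) * (1 - x)))%C with l; trivial.
  assert (E2 : ((1 - x) * l)%C = (x / (1 - x))%C).
  { transitivity ((l - 1 * (x * 1)) - x * l + x)%C. ring. rewrite E. field; trivial. }
  replace l with ((1 - x) * l * / (1 - x))%C by (field; trivial). rewrite E2. field. trivial.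
Qed.

Lemma Cmod_pow_lt_1 (q : C) (d : nat) : Cmod q < 1 -> Cmod (q ^ S d)%C < 1.
Proof.
  intros h. rewrite Cmod_pow. pose proof (Cmod_ge_0 q).
  apply pow_lt_1_compat. lra. lia.
Qed.

Lemma Cseries_multiples (q : C) (d : nat) : Cmod q < 1 ->
  Cseries (fun j => if (S j mod S d =? 0)%nat then q ^ S j else RtoC 0)%C (q ^ S d / (1 - q ^ S d))%C.
Proof.
  intros hq. pose proof (Cmod_ge_0 q) as h0.
  set (g := fun j => (if (S j mod S d =? 0)%nat then q ^ S j else RtoC 0)%C).
  destruct (ex_series_shift _ (ex_series_poly_geom 0 (Cmod q) ltac:(lra))) as [B HB].
  edestruct (Cseries_dominated g) with (2 := HB) as [l [hl _]].
  { intros n. unfold g. rewrite pow_O, Rmult_1_l. destruct (_ =? _)%nat.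
    rewrite Cmod_pow; lra. rewrite Cmod_0. apply pow_le; lra. }
  pose proof (Cseries_split g l d hl) as ht.
  assert (Ed : Csum_n g d = (q ^ S d)%C).
  { rewrite Csum_n_csum. change (csum g (S d)) with (csum g d + g d)%C.
    assert (Z : forall k, (k <= d)%nat -> csum g k = 0).
    { induction k; intros hk. reflexivity. simpl csum. rewrite IHk by lia. unfold g.
      rewrite Nat.mod_small by lia. simpl. ring. }
    rewrite Z by lia. unfold g. rewrite Nat.Div0.mod_same. simpl Nat.eqb. cbv iota. ring. }
  assert (E : (l - q ^ S d)%C = (q ^ S d * l)%C).
  { rewrite <- Ed at 1. apply (Cseries_unique _ _ _ ht).
    eapply Cseries_ext; [|exact (Cseries_scal (q ^ S d)%C _ _ hl)].
    intros k. cbv beta. unfold g. replace (S (S d + k)) with (S k + 1 * S d)%nat by lia.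
    rewrite Nat.Div0.mod_add. destruct (_ =? _)%nat; [|ring].
    rewrite Nat.mul_1_l, Cpow_add_r. ring. }
  pose proof (Cmod_lt_1_sub_neq0 _ (Cmod_pow_lt_1 q d hq)).
  replace (q ^ S d / (1 - q ^ S d))%C with l. exact hl.
  replace l with ((l - q ^ S d * l) * / (1 - q ^ S d))%C by (field; trivial). rewrite <- E. field. trivial.
Qed.

Lemma sigma1_csum (n : nat) :
  RtoC (INR (sigma1 n)) = csum (fun i => if (n mod S i =? 0)%nat then RtoC (INR (S i)) else RtoC 0) n.
Proof.
  unfold sigma1. set (F := fun d => if (n mod d =? 0)%nat then d else 0%nat).
  assert (G : forall l : list nat, forall a, fold_right Nat.add a l = (fold_right Nat.add 0 l + a)%nat).
  { induction l; intros b; simpl; trivial. rewrite IHl. lia. }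
  assert (H : forall m, RtoC (INR (fold_right Nat.add 0%nat (map F (seq 1 m)))) = csum (fun i => RtoC (INR (F (S i)))) m).
  { induction m. reflexivity. rewrite seq_S, map_app, fold_right_app, G, plus_INR, RtoC_plus, IHm.
    cbn [csum]. simpl fold_right. now rewrite Nat.add_0_r. }
  rewrite H. apply csum_ext. intros k _. unfold F. now destruct (_ =? _)%nat.
Qed.

(** Both series equal [sum_i i q^i / (1 - q^i)]: one by collecting the multiples of [i], the other
    by expanding [sum_i sum_m i q^(i m)]. Product bounds come from [s = sqrt (Cmod q)]: the modulus
    [s^j s^j] of [q^j] is at most [s^i s^j] when [i <= j], and [s^(2 i j) <= s^i s^j] for positive
    [i] and [j]. *)
Theorem lambert (q : C) : Cmod q < 1 -> exists L,
  Cseries (fun j => INR (sigma1 (S j)) * q ^ S j)%C L /\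
  Cseries (fun m => q ^ S m / ((1 - q ^ S m) * (1 - q ^ S m)))%C L.
Proof.
  intros hq. pose proof (Cmod_ge_0 q) as h0. set (s := sqrt (Cmod q)).
  assert (hs : 0 <= s < 1).
  { split. apply sqrt_pos. unfold s. rewrite <- sqrt_1. apply sqrt_lt_1; lra. }
  assert (hss : s * s = Cmod q) by (apply sqrt_sqrt; lra).
  pose proof (ex_series_shift _ (ex_series_poly_geom 1 s hs)) as S1.
  pose proof (ex_series_shift _ (ex_series_poly_geom 0 s hs)) as S0.
  assert (pw : forall n m, (n <= m)%nat -> s ^ m <= s ^ n).
  { intros n m hnm. replace m with (n + (m - n))%nat by lia. rewrite pow_add.
    assert (0 <= s ^ n) by (apply pow_le; lra).
    assert (s ^ (m - n) <= 1) by (rewrite <- (pow1 (m - n)); apply pow_incr; lra). nra. }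
  assert (qs : forall n, Cmod (q ^ n)%C = s ^ n * s ^ n).
  { intros n. rewrite Cmod_pow, <- hss. apply Rpow_mult_distr. }
  assert (P1 : forall n, 0 <= INR n ^ 1 * s ^ n).
  { intros n. apply Rmult_le_pos. rewrite pow_1; apply pos_INR. apply pow_le; lra. }
  assert (P0 : forall n, 0 <= INR n ^ 0 * s ^ n).
  { intros n. apply Rmult_le_pos. simpl; lra. apply pow_le; lra. }
  destruct (fubini_prod
    (fun i j => if (S j mod S i =? 0)%nat then INR (S i) * q ^ S j else RtoC 0)%C
    (fun i => INR (S i) * (q ^ S i / (1 - q ^ S i)))%C
    (fun j => INR (sigma1 (S j)) * q ^ S j)%C
    (fun i => INR (S i) ^ 1 * s ^ S i) (fun j => INR (S j) ^ 0 * s ^ S j)) as [L [h1 h2]].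
  - intros i. eapply Cseries_ext; [|exact (Cseries_scal (INR (S i)) _ _ (Cseries_multiples q i hq))].
    intros j. cbv beta. destruct (_ =? _)%nat; [reflexivity|ring].
  - intros j. rewrite sigma1_csum. 
    replace (csum (fun i => if (S j mod S i =? 0)%nat then RtoC (INR (S i)) else RtoC 0) (S j) * q ^ S j)%C
      with (csum (fun i => if (S j mod S i =? 0)%nat then INR (S i) * q ^ S j else RtoC 0)%C (S j)).
    apply Cseries_finite. intros i hi. rewrite Nat.mod_small by lia. reflexivity.
    rewrite Cmult_comm, <- csum_scal. apply csum_ext. intros i _. cbv beta. destruct (_ =? _)%nat; ring.
  - intros i j. destruct (Nat.eqb_spec (S j mod S i) 0) as [e|e].
    + rewrite Cmod_mult, Cmod_nat, qs.
      assert (hij : (S i <= S j)%nat).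
      { apply Nat.Div0.div_exact in e. destruct (S j / S i)%nat; lia. }
      pose proof (pw _ _ hij). rewrite pow_1, pow_O, Rmult_1_l.
      pose proof (pos_INR (S i)). assert (0 <= s ^ S j) by (apply pow_le; lra).
      rewrite <- Rmult_assoc. apply Rmult_le_compat_r; trivial. now apply Rmult_le_compat_l.
    + rewrite Cmod_0. apply Rmult_le_pos. apply P1. apply P0.
  - intros; apply P1.
  - intros; apply P0.
  - exact S1.
  - exact S0.
  - exists L. split. exact h1.
    destruct (fubini_prod
      (fun i j => INR (S i) * (q ^ S i) ^ S j)%C
      (fun i => INR (S i) * (q ^ S i / (1 - q ^ S i)))%C
      (fun m => q ^ S m / ((1 - q ^ S m) * (1 - q ^ S m)))%C
      (fun i => INR (S i) ^ 1 * s ^ S i) (fun j => INR (S j) ^ 0 * s ^ S j)) as [L' [k1 k2]].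
    + intros i. apply Cseries_scal, Cseries_geom. now apply Cmod_pow_lt_1.
    + intros m. eapply Cseries_ext; [|apply (Cseries_geom_deriv (q ^ S m)%C (Cmod_pow_lt_1 q m hq))].
      intros i. cbv beta. f_equal. rewrite <- !Cpow_mult_r. f_equal. lia.
    + intros i j. rewrite Cmod_mult, Cmod_nat, <- Cpow_mult_r, qs, pow_1, pow_O, Rmult_1_l, Rmult_assoc.
      apply Rmult_le_compat_l. apply pos_INR.
      apply Rmult_le_compat; try (apply pow_le; lra); apply pw; nia.
    + intros; apply P1.
    + intros; apply P0.
    + exact S1.
    + exact S0.
    + now rewrite (Cseries_unique _ _ _ h2 k2).
Qed.

(** At [z = 1/2] the expansion of [csc2] reads [PI^2 = 8 sum 1/(2k+1)^2]. The even denominators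
    contribute a quarter of the whole sum [l], so [l = PI^2 / 8 + l / 4]. *)
Lemma zeta2_eq : Cseries (fun m => / (INR (S m) * INR (S m)))%C (PI * PI / 6)%C.
Proof.
  set (g := fun m => (/ (INR (S m) * INR (S m)))%C).
  destruct is_series_inv_square as [B HB].
  edestruct (Cseries_dominated g) with (2 := HB) as [l [hl _]].
  { intros n. unfold g. rewrite Cmod_inv by (apply Cmult_neq_0; apply INR_S_neq0).
    rewrite Cmod_mult, Cmod_nat, S_INR. lra. }
  replace (PI * PI / 6)%C with l. exact hl.
  assert (hq : qe (1 / 2)%C <> 1) by (rewrite qe_half; intros K; injection K; lra).
  pose proof (csc2_series _ hq) as H. unfold csc2 in H. rewrite qe_half in H.
  apply (Cseries_scal (/ 8)%C) in H. apply Cseries_Clim in H.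
  pose proof (proj1 (Cseries_Clim _ _) hl) as hl'.
  assert (E : l = (/ 8 * (- (4 * PI * PI) * (-1 / ((1 - -1) * (1 - -1)))) + / 4 * l)%C).
  (* The partial sums of [2 n + 2] terms split into [n + 1] odd and [n + 1] even denominators. *)
  { apply (Clim_unique (fun n => Csum_n g (S (n + n)))).
    - intros eps he. destruct (hl' eps he) as [N HN]. exists N. intros n hn. apply HN. lia.
    - eapply Clim_ext; [|exact (Clim_plus _ _ _ _ H (Clim_scal (/ 4)%C _ _ hl'))].
      intros n. cbv beta. rewrite !Csum_n_csum.
      replace (S (S (n + n))) with (S n + S n)%nat by lia. generalize (S n). clear. intros n.
      rewrite csum_scal. rewrite <- !csum_scal.
      induction n. simpl. ring. replace (S n + S n)%nat with (S (S (n + n))) by lia.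
      cbn [csum]. rewrite <- IHn. unfold g.
      replace (INR (S (S (n + n)))) with (2 * INR (S n)) by (rewrite !S_INR, plus_INR; ring).
      replace (INR (S (n + n))) with (2 * INR n + 1) by (rewrite !S_INR, plus_INR; ring).
      rewrite !RtoC_plus, !RtoC_mult. pose proof (INR_S_neq0 n) as n0.
      assert (n1 : (2 * INR n + 1)%C <> 0).
      { rewrite <- RtoC_mult, <- RtoC_plus. apply RtoC_neq0. pose proof (pos_INR n). lra. }
      replace (1 / 2 + INR n)%C with ((2 * INR n + 1) / 2)%C by field.
      replace (1 / 2 - 1 - INR n)%C with (- ((2 * INR n + 1) / 2))%C by field.
      set (a := (2 * INR n + 1)%C) in *. field. auto. }
  apply (f_equal (fun x => 4 / 3 * (x - / 4 * l))%C) in E.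
  transitivity (4 / 3 * (l - / 4 * l))%C. field. rewrite E. field.
Qed.

(** * The transformation law of [eis2] *)

Lemma Csum_to_Cseries (f : nat -> C) (l : C) : Csum_to f l <-> Cseries f l.
Proof.
  assert (A : forall n, fst (Csum_n f n) = sum_f_R0 (fun k => fst (f k)) n /\
                        snd (Csum_n f n) = sum_f_R0 (fun k => snd (f k)) n).
  { induction n. now rewrite Csum_n_0. rewrite Csum_n_Sn. destruct IHn as [h1 h2].
    cbn [sum_f_R0]. rewrite <- h1, <- h2. split; reflexivity. }
  rewrite Cseries_Clim. split.
  - intros [h1 h2] eps he.
    destruct (h1 (eps / 2)) as [N1 H1]. lra. destruct (h2 (eps / 2)) as [N2 H2]. lra.
    exists (N1 + N2)%nat. intros n hn. specialize (H1 n ltac:(lia)). specialize (H2 n ltac:(lia)).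
    eapply Rle_lt_trans. apply Cmod_le_abs. unfold Rdist in *.
    destruct (A n) as [a1 a2]. rewrite <- a1 in H1. rewrite <- a2 in H2. 
    change (Rabs (fst (Csum_n f n) - fst l) + Rabs (snd (Csum_n f n) - snd l) < eps). lra.
  - intros H. split; intros eps he; destruct (H eps he) as [N HN]; exists N; intros n hn; specialize (HN n hn);
      destruct (A n) as [a1 a2]; unfold Rdist.
    + rewrite <- a1. eapply Rle_lt_trans; [|exact HN]. apply (Rabs_fst_le (Csum_n f n - l)%C).
    + rewrite <- a2. eapply Rle_lt_trans; [|exact HN]. apply (Rabs_snd_le (Csum_n f n - l)%C).
Qed.

(** [Csum] selects some limit by choice; once a limit exists, uniqueness identifies the selected
    one. *)
Lemma Csum_unique (f : nat -> C) (l : C) : Cseries f l -> Csum f = l.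
Proof.
  intros H. apply Csum_to_Cseries in H.
  assert (K : Csum_to f (Csum f)).
  { unfold Csum. apply ClassicalEpsilon.epsilon_spec. now exists l. }
  apply Csum_to_Cseries in H, K. exact (Cseries_unique _ _ _ K H).
Qed.

Definition eis2 (z : C) : C := E2 z.

Lemma Defs_Cpow (z : C) (n : nat) : Defs.Cpow z n = (z ^ n)%C.
Proof. induction n. reflexivity. change (Defs.Cpow z (S n)) with (z * Defs.Cpow z n)%C. now rewrite IHn. Qed.

Lemma qe_lt_1 (tau : C) : 0 < snd tau -> Cmod (qe tau) < 1.
Proof.
  intros h. rewrite Cmod_qe, <- exp_0. apply exp_increasing. pose proof PI_RGT_0. nra.
Qed.

Lemma eis2_series (tau : C) : 0 < snd tau -> exists L,
  Cseries (fun j => INR (sigma1 (S j)) * qe tau ^ S j)%C L /\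
  Cseries (fun m => csc2 (INR (S m) * tau))%C (- (4 * PI * PI) * L)%C /\
  eis2 tau = (1 - 24 * L)%C.
Proof.
  intros h. destruct (lambert (qe tau) (qe_lt_1 tau h)) as [L [h1 h2]].
  exists L. split; [exact h1|split].
  - eapply Cseries_ext; [|exact (Cseries_scal (- (4 * PI * PI))%C _ _ h2)].
    intros m. cbv beta. unfold csc2. now rewrite qe_pow.
  - unfold eis2, E2.
    rewrite (Csum_unique _ L). reflexivity.
    eapply Cseries_ext; [|exact h1]. intros n. cbv beta. rewrite <- Defs_Cpow. reflexivity.
Qed.

Lemma csc2_opp (z : C) : qe z <> 1 -> csc2 (- z)%C = csc2 z.
Proof.
  intros hz. unfold csc2. rewrite qe_opp. pose proof (qe_neq0 z).
  assert ((1 - qe z)%C <> 0) by (apply Csub_neq0; auto).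
  assert ((qe z - 1)%C <> 0) by now apply Csub_neq0.
  field. auto.
Qed.

Lemma neg_inv_Im (tau : C) : 0 < snd tau -> 0 < snd (- / tau)%C.
Proof.
  intros h. pose proof (real_div_tau_Im_neg tau h 1 ltac:(lra)) as H.
  replace (1 / tau)%C with (/ tau)%C in H by (unfold Cdiv; ring).
  change (0 < - snd (/ tau)%C). lra.
Qed.

(** The usual constant [12 / (2 PI i)]. *)
Definition kappa : C := (- (6 * Ci / PI))%C.

Theorem eis2_S (tau : C) : 0 < snd tau ->
  eis2 (- / tau)%C = (tau * tau * eis2 tau + kappa * tau)%C.
Proof.
  intros h. destruct (eis2_series tau h) as [L [_ [h1 h2]]].
  destruct (eis2_series _ (neg_inv_Im tau h)) as [L' [_ [h1' h2']]].
  assert (hs : Cseries (fun n => csc2 (INR (S n) / tau))%C (- (4 * PI * PI) * L')%C).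
  { eapply Cseries_ext; [|exact h1']. intros n. cbv beta.
    replace (INR (S n) * - / tau)%C with (- (INR (S n) / tau))%C by (unfold Cdiv; ring).
    apply csc2_opp, real_div_tau_qe; trivial. apply lt_0_INR; lia. }
  pose proof (eisenstein_swap tau h _ zeta2_eq _ _ h1 hs) as E.
  rewrite h2, h2'. unfold kappa.
  pose proof (tau_neq0 tau h) as ht.
  assert (hpi : RtoC PI <> 0) by (apply RtoC_neq0; pose proof PI_RGT_0; lra).
  (* [eis2] is [6 / PI^2] times [zeta2 + s], with [s = - 4 PI^2 L]; the left side of
     [eisenstein_swap] is made to appear with this factor. *)
  transitivity (6 * tau * tau / (PI * PI) * (/ (tau * tau) * (PI * PI / 6 + - (4 * PI * PI) * L') + PI * Ci / tau) - 6 * tau * Ci / PI)%C.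
  field. auto. rewrite <- E. field. auto.
Qed.

Lemma eis2_add_1 (tau : C) : eis2 (tau + 1)%C = eis2 tau.
Proof.
  unfold eis2, E2.
  change (qexp (tau + 1)%C) with (qe (tau + 1)%C). change (qexp tau) with (qe tau). now rewrite qe_add_1.
Qed.

(** * Complex derivatives and divided differences *)

(* Differentiability with a quadratic remainder; all functions at hand are analytic. *)
Definition Qderiv (f : C -> C) (x l : C) : Prop :=
  exists K d, 0 <= K /\ 0 < d /\
    forall h : C, Cmod h < d -> Cmod (f (x + h) - f x - h * l)%C <= K * (Cmod h * Cmod h).

Lemma Qderiv_unique (f : C -> C) (x l l' : C) : Qderiv f x l -> Qderiv f x l' -> l = l'.
Proof.
  intros [K [d [hK [hd H]]]] [K' [d' [hK' [hd' H']]]].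
  destruct (Ceq_dec l l') as [|n]; trivial. exfalso.
  pose proof (Csub_neq0 _ _ n) as hn. apply Cmod_gt_0 in hn. set (D := Cmod (l - l')%C) in *.
  set (e := Rmin (Rmin d d') (D / (K + K' + 1)) / 2).
  assert (he0 : 0 < Rmin (Rmin d d') (D / (K + K' + 1))).
  { repeat apply Rmin_glb_lt; trivial. apply Rdiv_lt_0_compat; lra. }
  pose proof (Rmin_l (Rmin d d') (D / (K + K' + 1))). pose proof (Rmin_r (Rmin d d') (D / (K + K' + 1))).
  pose proof (Rmin_l d d'). pose proof (Rmin_r d d').
  assert (he : 0 < e) by (unfold e; lra).
  assert (hm : Cmod e = e) by (rewrite Cmod_R; apply Rabs_right; lra).
  specialize (H e ltac:(rewrite hm; unfold e; lra)). specialize (H' e ltac:(rewrite hm; unfold e; lra)).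
  rewrite hm in *.
  assert (hh : Cmod (e * (l - l'))%C <= (K + K') * (e * e)).
  { replace (e * (l - l'))%C with ((f (x + e) - f x - e * l') + - (f (x + e) - f x - e * l))%C by ring.
    eapply Rle_trans. apply Cmod_triangle. rewrite Cmod_opp. lra. }
  rewrite Cmod_mult, hm in hh. fold D in hh.
  assert (D <= (K + K') * e) by (apply Rmult_le_reg_l with e; lra).
  assert (e * (K + K' + 1) <= D / 2).
  { apply Rle_trans with (D / (K + K' + 1) / 2 * (K + K' + 1)). apply Rmult_le_compat_r; unfold e; lra.
    right. field. lra. }
  lra.
Qed.

Lemma Qderiv_ext_loc (f g : C -> C) (x l d : C) : 0 < Cmod d ->
  (forall h, Cmod h < Cmod d -> f (x + h)%C = g (x + h)%C) -> Qderiv f x l -> Qderiv g x l.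
Proof.
  intros hd E [K [d' [hK [hd' H]]]]. exists K, (Rmin d' (Cmod d)). split; [|split]; trivial.
  now apply Rmin_glb_lt.
  intros h hh. pose proof (Rmin_l d' (Cmod d)). pose proof (Rmin_r d' (Cmod d)).
  rewrite <- E by lra. replace (g x) with (f x). apply H. lra.
  specialize (E 0). rewrite Cmod_0 in E. replace (x + 0)%C with x in E by ring. apply E. lra.
Qed.

Lemma Qderiv_ext (f g : C -> C) (x l : C) : (forall z, f z = g z) -> Qderiv f x l -> Qderiv g x l.
Proof. intros E. apply (Qderiv_ext_loc _ _ _ _ 1). rewrite Cmod_1; lra. intros; apply E. Qed.

Lemma Qderiv_lipschitz (f : C -> C) (x l : C) : Qderiv f x l -> exists B d, 0 < B /\ 0 < d /\
  forall h, Cmod h < d -> Cmod (f (x + h) - f x)%C <= B * Cmod h.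
Proof.
  intros [K [d [hK [hd H]]]]. exists (Cmod l + K + 1), (Rmin d 1).
  pose proof (Cmod_ge_0 l). split; [lra|split]. apply Rmin_glb_lt; lra.
  intros h hh. pose proof (Rmin_l d 1). pose proof (Rmin_r d 1).
  specialize (H h ltac:(lra)). pose proof (Cmod_ge_0 h).
  replace (f (x + h) - f x)%C with ((f (x + h) - f x - h * l) + h * l)%C by ring.
  eapply Rle_trans. apply Cmod_triangle. rewrite Cmod_mult.
  assert (K * (Cmod h * Cmod h) <= K * Cmod h) by (apply Rmult_le_compat_l; nra). nra.
Qed.

Lemma Qderiv_const (c x : C) : Qderiv (fun _ => c) x 0.
Proof.
  exists 0, 1. split; [lra|split; [lra|]]. intros h _.
  replace (c - c - h * 0)%C with (RtoC 0) by ring. rewrite Cmod_0. lra.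
Qed.

Lemma Qderiv_id (x : C) : Qderiv (fun z => z) x 1.
Proof.
  exists 0, 1. split; [lra|split; [lra|]]. intros h _.
  replace (x + h - x - h * 1)%C with (RtoC 0) by ring. rewrite Cmod_0. lra.
Qed.

Lemma Qderiv_plus (f g : C -> C) (x l m : C) :
  Qderiv f x l -> Qderiv g x m -> Qderiv (fun z => f z + g z)%C x (l + m)%C.
Proof.
  intros [K [d [hK [hd H]]]] [K' [d' [hK' [hd' H']]]]. exists (K + K'), (Rmin d d').
  split; [lra|split]. now apply Rmin_glb_lt.
  intros h hh. pose proof (Rmin_l d d'). pose proof (Rmin_r d d').
  specialize (H h ltac:(lra)). specialize (H' h ltac:(lra)).
  replace (f (x + h) + g (x + h) - (f x + g x) - h * (l + m))%C
    with ((f (x + h) - f x - h * l) + (g (x + h) - g x - h * m))%C by ring.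
  eapply Rle_trans. apply Cmod_triangle. lra.
Qed.

Lemma Qderiv_mult (f g : C -> C) (x l m : C) :
  Qderiv f x l -> Qderiv g x m -> Qderiv (fun z => f z * g z)%C x (l * g x + f x * m)%C.
Proof.
  intros Hf Hg. destruct (Qderiv_lipschitz _ _ _ Hf) as [B [e [hB [he L]]]].
  destruct (Qderiv_lipschitz _ _ _ Hg) as [B' [e' [hB' [he' L']]]].
  destruct Hf as [K [d [hK [hd H]]]]. destruct Hg as [K' [d' [hK' [hd' H']]]].
  exists (K * Cmod (g x) + Cmod (f x) * K' + B * B'), (Rmin (Rmin d d') (Rmin e e')).
  pose proof (Cmod_ge_0 (g x)). pose proof (Cmod_ge_0 (f x)).
  split; [|split]. assert (0 <= B * B') by nra. assert (0 <= K * Cmod (g x)) by now apply Rmult_le_pos.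
  assert (0 <= Cmod (f x) * K') by now apply Rmult_le_pos. lra.
  repeat apply Rmin_glb_lt; trivial.
  intros h hh. pose proof (Rmin_l (Rmin d d') (Rmin e e')). pose proof (Rmin_r (Rmin d d') (Rmin e e')).
  pose proof (Rmin_l d d'). pose proof (Rmin_r d d'). pose proof (Rmin_l e e'). pose proof (Rmin_r e e').
  specialize (H h ltac:(lra)). specialize (H' h ltac:(lra)). specialize (L h ltac:(lra)). specialize (L' h ltac:(lra)).
  replace (f (x + h) * g (x + h) - f x * g x - h * (l * g x + f x * m))%C
    with ((f (x + h) - f x - h * l) * g x + (f x * (g (x + h) - g x - h * m)
       + (f (x + h) - f x) * (g (x + h) - g x)))%C by ring.
  eapply Rle_trans. apply Cmod_triangle.
  eapply Rle_trans. apply Rplus_le_compat_l, Cmod_triangle. rewrite !Cmod_mult.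
  assert (Cmod (f (x + h) - f x)%C * Cmod (g (x + h) - g x)%C <= (B * Cmod h) * (B' * Cmod h)).
  { apply Rmult_le_compat; trivial; apply Cmod_ge_0. }
  apply (Rmult_le_compat_r (Cmod (g x))) in H; trivial. apply (Rmult_le_compat_l (Cmod (f x))) in H'; trivial. lra.
Qed.

Lemma Qderiv_comp (f g : C -> C) (x l m : C) :
  Qderiv f (g x) l -> Qderiv g x m -> Qderiv (fun z => f (g z)) x (m * l)%C.
Proof.
  intros [K [d [hK [hd H]]]] Hg. destruct (Qderiv_lipschitz _ _ _ Hg) as [B [e [hB [he L]]]].
  destruct Hg as [K' [d' [hK' [hd' H']]]].
  exists (K * (B * B) + K' * Cmod l), (Rmin (Rmin d' e) (d / B)).
  pose proof (Cmod_ge_0 l).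
  split; [|split]. assert (0 <= K * (B * B)) by (apply Rmult_le_pos; nra). assert (0 <= K' * Cmod l) by now apply Rmult_le_pos. lra.
  repeat apply Rmin_glb_lt; trivial. now apply Rdiv_lt_0_compat.
  intros h hh. pose proof (Rmin_l (Rmin d' e) (d / B)). pose proof (Rmin_r (Rmin d' e) (d / B)).
  pose proof (Rmin_l d' e). pose proof (Rmin_r d' e).
  specialize (H' h ltac:(lra)). specialize (L h ltac:(lra)).
  set (k := (g (x + h) - g x)%C) in *.
  assert (hk : Cmod k < d).
  { eapply Rle_lt_trans. exact L. assert (hb : Cmod h < d / B) by lra. apply (Rmult_lt_compat_l B) in hb; trivial.
    replace (B * (d / B)) with d in hb by (field; lra). exact hb. }
  specialize (H k hk). replace (g x + k)%C with (g (x + h)%C) in H by (unfold k; ring).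
  replace (f (g (x + h)) - f (g x) - h * (m * l))%C
    with ((f (g (x + h)) - f (g x) - k * l) + (k - h * m) * l)%C by ring.
  eapply Rle_trans. apply Cmod_triangle. rewrite Cmod_mult.
  assert (hkk : Cmod k * Cmod k <= (B * Cmod h) * (B * Cmod h)) by (apply Rmult_le_compat; trivial; apply Cmod_ge_0).
  apply (Rmult_le_compat_l K) in hkk; trivial. apply (Rmult_le_compat_r (Cmod l)) in H'; trivial. lra.
Qed.

Lemma Qderiv_neg_inv (x : C) : x <> 0 -> Qderiv (fun z => - / z)%C x (/ (x * x))%C.
Proof.
  intros hx. pose proof hx as h0. apply Cmod_gt_0 in h0. set (X := Cmod x) in *.
  exists (2 / (X * X * X)), (X / 2). split; [|split]. apply Rmult_le_pos. lra. left. apply Rinv_0_lt_compat.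
  repeat apply Rmult_lt_0_compat; trivial. lra.
  intros h hh.
  assert (hxh : X / 2 <= Cmod (x + h)%C) by (pose proof (Cmod_ge_sub x h); fold X in H; lra).
  assert (hne : (x + h)%C <> 0) by (apply Cmod_gt_0; lra).
  replace (- / (x + h) - - / x - h * / (x * x))%C with (- (h * h * / (x * x * (x + h))))%C by (field; auto).
  rewrite Cmod_opp, !Cmod_mult, Cmod_inv, !Cmod_mult by (repeat apply Cmult_neq_0; trivial). fold X.
  rewrite (Rmult_comm (2 / (X * X * X))). apply Rmult_le_compat_l. pose proof (Cmod_ge_0 h); nra.
  replace (2 / (X * X * X)) with (/ (X * X * (X / 2))) by (field; lra).
  apply Rinv_le_contravar. repeat apply Rmult_lt_0_compat; lra.
  apply Rmult_le_compat_l; nra.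
Qed.

Lemma Qderiv_qe (x : C) : Qderiv qe x (2 * PI * Ci * qe x)%C.
Proof.
  exists (1000 * Cmod (qe x)), (1 / 20). pose proof (Cmod_ge_0 (qe x)). split; [lra|split; [lra|]].
  intros h hh. rewrite qe_plus. pose proof (qe_first_order h ltac:(lra)) as H1.
  replace (qe x * qe h - qe x - h * (2 * PI * Ci * qe x))%C with (qe x * (qe h - 1 - 2 * PI * Ci * h))%C by ring.
  rewrite Cmod_mult. apply (Rmult_le_compat_l (Cmod (qe x))) in H1; trivial. simpl in H1. lra.
Qed.

(* If [x n] is a divided difference of [t ^ n] then [divdiff a x n] is the one with the extra node [a]. *)
Fixpoint divdiff (a : C) (x : nat -> C) (n : nat) : C :=
  match n with O => 0 | S m => a * divdiff a x m + x m end.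
Fixpoint rdivdiff (r : R) (x : nat -> R) (n : nat) : R :=
  match n with O => 0 | S m => r * rdivdiff r x m + x m end.

Lemma divdiff_ext (a : C) (x y : nat -> C) (n : nat) : (forall k, x k = y k) -> divdiff a x n = divdiff a y n.
Proof. intros E. induction n; simpl; trivial. now rewrite IHn, E. Qed.

Lemma divdiff_pow (a b : C) (n : nat) :
  ((a - b) * divdiff a (fun k => b ^ k) n)%C = (a ^ n - b ^ n)%C.
Proof.
  induction n. simpl. ring. cbn [divdiff Cpow].
  replace ((a - b) * (a * divdiff a (fun k => b ^ k) n + b ^ n))%C
    with (a * ((a - b) * divdiff a (fun k => b ^ k) n) + (a - b) * b ^ n)%C by ring. rewrite IHn. ring.
Qed.

Lemma divdiff_divdiff (a b : C) (x : nat -> C) (n : nat) :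
  ((a - b) * divdiff a (divdiff b x) n)%C = (divdiff a x n - divdiff b x n)%C.
Proof.
  induction n. simpl. ring. cbn [divdiff].
  replace ((a - b) * (a * divdiff a (divdiff b x) n + divdiff b x n))%C
    with (a * ((a - b) * divdiff a (divdiff b x) n) + (a - b) * divdiff b x n)%C by ring. rewrite IHn. ring.
Qed.

(** Divided differences are symmetric in their nodes. For distinct nodes this follows from
    [divdiff_divdiff], whose right side changes sign under the exchange. *)
Lemma divdiff_comm (a b : C) (x : nat -> C) (n : nat) :
  divdiff a (divdiff b x) n = divdiff b (divdiff a x) n.
Proof.
  induction n. reflexivity. cbn [divdiff]. rewrite IHn.
  destruct n; cbn [divdiff]. ring. 
  destruct (Ceq_dec a b) as [->|hab]. ring.
  pose proof (divdiff_divdiff a b x n) as H. pose proof (Csub_neq0 _ _ hab).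
  cbn [divdiff] in IHn. 
  assert (E : divdiff a (divdiff b x) n = divdiff b (divdiff a x) n).
  { pose proof (divdiff_divdiff b a x n) as H'.
    replace (divdiff a (divdiff b x) n) with (/ (a - b) * ((a - b) * divdiff a (divdiff b x) n))%C by (field; trivial).
    rewrite H. replace (divdiff a x n - divdiff b x n)%C with (- (divdiff b x n - divdiff a x n))%C by ring.
    rewrite <- H'. field; trivial. }
  rewrite <- E. rewrite E at 1.
  assert (G : ((a - b) * divdiff a (divdiff b x) n + divdiff b x n)%C = divdiff a x n) by (rewrite H; ring).
  rewrite <- G. rewrite E. ring.
Qed.

Lemma divdiff_pow_comm (a b : C) (n : nat) : divdiff a (fun k => b ^ k)%C n = divdiff b (fun k => a ^ k)%C n.
Proof.
  destruct (Ceq_dec a b) as [->|hab]; trivial. pose proof (Csub_neq0 _ _ hab).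
  replace (divdiff a (fun k => b ^ k)%C n) with (/ (a - b) * ((a - b) * divdiff a (fun k => b ^ k)%C n))%C by (field; trivial).
  rewrite divdiff_pow. replace (a ^ n - b ^ n)%C with (- (b ^ n - a ^ n))%C by ring.
  rewrite <- divdiff_pow. field; trivial.
Qed.

Lemma Cmod_divdiff_le (a : C) (r : R) (x : nat -> C) (y : nat -> R) :
  Cmod a <= r -> (forall n, Cmod (x n) <= y n) -> forall n, Cmod (divdiff a x n) <= rdivdiff r y n.
Proof.
  intros ha H. induction n. simpl. rewrite Cmod_0; lra.
  cbn [divdiff rdivdiff]. eapply Rle_trans. apply Cmod_triangle. rewrite Cmod_mult.
  apply Rplus_le_compat; trivial. apply Rmult_le_compat; trivial; apply Cmod_ge_0.
Qed.

(* [weight r k n = C(n, k) r ^ (n - k)], and [0] for [n < k]. *)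
Fixpoint weight (r : R) (k : nat) : nat -> R :=
  match k with O => fun n => r ^ n | S j => rdivdiff r (weight r j) end.

Lemma weight_nonneg (r : R) (k : nat) : 0 <= r -> forall n, 0 <= weight r k n.
Proof.
  intros hr. induction k; intros n; simpl. now apply pow_le.
  induction n; simpl. lra. specialize (IHk n). nra.
Qed.

(** This is [C(n, k) <= n^k], multiplied by [r^n] so that no negative exponent occurs. *)
Lemma weight_le (r : R) (k : nat) : 0 <= r -> forall n, r ^ k * weight r k n <= INR n ^ k * r ^ n.
Proof.
  intros hr. induction k; intros n. simpl; lra.
  induction n. simpl. rewrite !Rmult_0_r, !Rmult_0_l. lra.
  change (weight r (S k) (S n)) with (r * weight r (S k) n + weight r k n).
  specialize (IHk n). pose proof (pow_le r n hr). pose proof (pos_INR n).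
  pose proof (pow_le _ k H0).
  assert (hmono : INR n ^ k <= INR (S n) ^ k) by (apply pow_incr; rewrite S_INR; lra).
  assert (hz : 0 <= r ^ n * INR (S n)) by (apply Rmult_le_pos; [|apply pos_INR]; lra).
  replace (r ^ S k * (r * weight r (S k) n + weight r k n))
    with (r * (r ^ S k * weight r (S k) n) + r * (r ^ k * weight r k n)) by (simpl; ring).
  apply Rle_trans with (r * (INR n ^ S k * r ^ n) + r * (INR n ^ k * r ^ n)).
  { apply Rplus_le_compat; apply Rmult_le_compat_l; trivial. }
  replace (r * (INR n ^ S k * r ^ n) + r * (INR n ^ k * r ^ n)) with (r * (r ^ n * INR (S n)) * INR n ^ k)
    by (rewrite S_INR; simpl; ring).
  replace (INR (S n) ^ S k * r ^ S n) with (r * (r ^ n * INR (S n)) * INR (S n) ^ k) by (simpl; ring).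
  apply Rmult_le_compat_l; trivial. now apply Rmult_le_pos.
Qed.

Lemma Cmod_pow_le (a : C) (r : R) : Cmod a <= r -> forall n, Cmod (a ^ n)%C <= r ^ n.
Proof. intros h n. rewrite Cmod_pow. apply pow_incr. split. apply Cmod_ge_0. exact h. Qed.

(** * Power series and their divided differences *)

Definition polybounded (c : nat -> R) : Prop :=
  exists A p, 0 <= A /\ forall n, Rabs (c n) <= A * (INR n + 1) ^ p.

Lemma polybounded_weight_series (c : nat -> R) (r : R) (k : nat) :
  polybounded c -> 0 < r < 1 -> ex_series (fun n => Rabs (c n) * weight r k n).
Proof.
  intros [A [p [hA H]]] hr.
  pose proof (ex_series_shift _ (ex_series_poly_geom (p + k) r ltac:(lra))) as HS.
  apply (ex_series_le (V:=R_CompleteNormedModule) _ (fun n => A / r ^ k / r * (INR (S n) ^ (p + k) * r ^ S n))).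
  - intros n. pose proof (weight_nonneg r k ltac:(lra) n). pose proof (Rabs_pos (c n)).
    change (Rabs (Rabs (c n) * weight r k n) <= A / r ^ k / r * (INR (S n) ^ (p + k) * r ^ S n)).
    rewrite Rabs_right by (apply Rle_ge; now apply Rmult_le_pos).
    assert (hrk : 0 < r ^ k) by (apply pow_lt; lra).
    pose proof (weight_le r k ltac:(lra) n) as hw.
    assert (hw' : weight r k n <= / r ^ k * (INR (S n) ^ k * r ^ n)).
    { apply Rmult_le_reg_l with (r ^ k); trivial. rewrite <- Rmult_assoc, Rinv_r, Rmult_1_l by lra.
      eapply Rle_trans. exact hw. apply Rmult_le_compat_r. apply pow_le; lra.
      apply pow_incr. rewrite S_INR. pose proof (pos_INR n). lra. }
    specialize (H n). rewrite <- S_INR in H.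
    eapply Rle_trans. apply Rmult_le_compat; [exact H1|exact H0|exact H|exact hw'].
    right. rewrite pow_add. simpl (r ^ S n). field. lra.
  - apply ex_series_Rscal, HS.
Qed.

(** The sequence [x] is either [v^n] or a divided difference of these powers; in the second case [l]
    is the same divided difference of the power series. *)
Definition pser (c : nat -> R) (x : nat -> C) (l : C) : Prop := Cseries (fun n => RtoC (c n) * x n)%C l.

Lemma pser_ext (c : nat -> R) (x y : nat -> C) (l : C) : (forall n, x n = y n) -> pser c x l -> pser c y l.
Proof. intros E. apply Cseries_ext. intros n. now rewrite E. Qed.

Lemma pser_bounded (c : nat -> R) (r : R) (k : nat) (x : nat -> C) : polybounded c -> 0 < r < 1 ->
  (forall n, Cmod (x n) <= weight r k n) -> exists l, pser c x l.
Proof.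
  intros hc hr hx. destruct (polybounded_weight_series c r k hc hr) as [B HB].
  destruct (Cseries_dominated (fun n => RtoC (c n) * x n)%C (fun n => Rabs (c n) * weight r k n) B) as [l [hl _]].
  - intros n. rewrite Cmod_mult, Cmod_R. apply Rmult_le_compat_l. apply Rabs_pos. apply hx.
  - exact HB.
  - exists l. exact hl.
Qed.

(** The remainder is [h^2] times the divided difference at [a + h], [a], [a], which stays bounded
    near [a]. *)
Lemma pser_Qderiv (c : nat -> R) (f : C -> C) (a l : C) : polybounded c -> Cmod a < 1 ->
  (forall v, Cmod v < 1 -> pser c (fun n => v ^ n)%C (f v)) ->
  pser c (divdiff a (fun n => a ^ n)%C) l -> Qderiv f a l.
Proof.
  intros hc ha hf hl. pose proof (Cmod_ge_0 a).
  (* Halfway between [Cmod a] and [1]: leaves room for the increment while the majorant still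
     converges. *)
  set (r := (1 + Cmod a) / 2).
  destruct (polybounded_weight_series c r 2 hc ltac:(unfold r; lra)) as [B HB].
  assert (hB : 0 <= B).
  { eapply Rle_trans; [|apply (sum_n_le_is_series _ B 0 (fun n => Rmult_le_pos _ _ (Rabs_pos (c n)) (weight_nonneg r 2 ltac:(unfold r; lra) n)) HB)].
    rewrite sum_O. apply Rmult_le_pos. apply Rabs_pos. apply weight_nonneg. unfold r; lra. }
  exists B, (r - Cmod a). split; [trivial|split; [unfold r; lra|]].
  intros h hh. assert (hv : Cmod (a + h)%C <= r) by (eapply Rle_trans; [apply Cmod_triangle|lra]).
  set (v := (a + h)%C) in *.
  assert (Hs : pser c (divdiff v (divdiff a (fun n => a ^ n)%C)) (/ (h * h) * (f v - f a - h * l))%C \/ h = 0).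
  { destruct (Ceq_dec h 0) as [->|h0]; [now right|left].
    pose proof (Cseries_minus _ _ _ _ (Cseries_minus _ _ _ _ (hf v ltac:(unfold r in hv; lra)) (hf a ha)) (Cseries_scal h _ _ hl)) as H1.
    eapply Cseries_ext; [|exact (Cseries_scal (/ (h * h))%C _ _ H1)].
    assert (alg : forall k X Y D V A : C, (h * X = Y - D)%C -> (h * Y = V - A)%C ->
      (/ (h * h) * (k * V - k * A - h * (k * D)))%C = (k * X)%C).
    { intros k X Y D V A e1 e2. replace V with (h * Y + A)%C by (rewrite e2; ring).
      replace D with (Y - h * X)%C by (rewrite e1; ring). field. trivial. }
    intros n. cbv beta. apply alg with (divdiff v (fun n => a ^ n)%C n); replace h with (v - a)%C by (unfold v; ring).
    apply divdiff_divdiff. apply divdiff_pow. }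
  destruct Hs as [Hs| ->].
  - destruct (Ceq_dec h 0) as [->|h0]. 
    + unfold v. replace (a + 0)%C with a by ring. replace (f a - f a - 0 * l)%C with (RtoC 0) by ring. rewrite Cmod_0. lra.
    + assert (hb : Cmod (/ (h * h) * (f v - f a - h * l))%C <= B).
      { apply (Cseries_norm_le _ _ _ _ Hs) with (2 := HB). intros n. rewrite Cmod_mult, Cmod_R.
        apply Rmult_le_compat_l. apply Rabs_pos.
        apply (Cmod_divdiff_le v r); trivial. apply (Cmod_divdiff_le a r). unfold r; lra.
        apply Cmod_pow_le. unfold r; lra. }
      rewrite Cmod_mult, Cmod_inv, Cmod_mult in hb by now apply Cmult_neq_0.
      apply Cmod_gt_0 in h0. apply (Rmult_le_compat_l (Cmod h * Cmod h)) in hb; [|nra].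
      rewrite <- Rmult_assoc, Rinv_r, Rmult_1_l in hb by nra. lra.
  - unfold v. replace (a + 0)%C with a by ring. replace (f a - f a - 0 * l)%C with (RtoC 0) by ring. rewrite Cmod_0. lra.
Qed.

(** The new divided difference is the quotient by [a - b] of the difference of the two given ones.
    Repeated use brings in one zero after another. *)
Lemma pser_zero_divdiff (c : nat -> R) (a b : C) (x : nat -> C) : a <> b ->
  pser c (divdiff a x) 0 -> pser c (divdiff b x) 0 -> pser c (divdiff a (divdiff b x)) 0.
Proof.
  intros hab h1 h2. pose proof (Csub_neq0 _ _ hab) as hn.
  pose proof (Cseries_scal (/ (a - b))%C _ _ (Cseries_minus _ _ _ _ h1 h2)) as H.
  replace (/ (a - b) * (0 - 0))%C with (RtoC 0) in H by ring.
  eapply Cseries_ext; [|exact H]. intros n. cbv beta.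
  replace (c n * divdiff a x n - c n * divdiff b x n)%C with (c n * (divdiff a x n - divdiff b x n))%C by ring.
  rewrite <- divdiff_divdiff. field. trivial.
Qed.

Lemma pser_zero_pow (c : nat -> R) (a b : C) : a <> b ->
  pser c (fun n => a ^ n)%C 0 -> pser c (fun n => b ^ n)%C 0 -> pser c (divdiff a (fun n => b ^ n)%C) 0.
Proof.
  intros hab h1 h2. pose proof (Csub_neq0 _ _ hab) as hn.
  pose proof (Cseries_scal (/ (a - b))%C _ _ (Cseries_minus _ _ _ _ h1 h2)) as H.
  replace (/ (a - b) * (0 - 0))%C with (RtoC 0) in H by ring.
  eapply Cseries_ext; [|exact H]. intros n. cbv beta.
  replace (c n * a ^ n - c n * b ^ n)%C with (c n * (a ^ n - b ^ n))%C by ring.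
  rewrite <- divdiff_pow. field. trivial.
Qed.

(** * The [q]-series of [EtN] and its known zeros *)

Definition pval (c : nat -> R) (v : C) : C := Csum (fun n => RtoC (c n) * v ^ n)%C.

Lemma pval_eq (c : nat -> R) (v l : C) : pser c (fun n => v ^ n)%C l -> pval c v = l.
Proof. intros H. apply Csum_unique, H. Qed.

Lemma pval_pser (c : nat -> R) (v : C) : polybounded c -> Cmod v < 1 -> pser c (fun n => v ^ n)%C (pval c v).
Proof.
  intros hc hv. pose proof (Cmod_ge_0 v).
  destruct (pser_bounded c ((1 + Cmod v) / 2) 0 (fun n => v ^ n)%C hc) as [l hl]. lra.
  apply Cmod_pow_le. lra. rewrite (pval_eq _ _ _ hl). exact hl.
Qed.

Lemma pval_Qderiv (c : nat -> R) (a : C) : polybounded c -> Cmod a < 1 ->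
  exists l, pser c (divdiff a (fun n => a ^ n)%C) l /\ Qderiv (pval c) a l.
Proof.
  intros hc ha. pose proof (Cmod_ge_0 a).
  destruct (pser_bounded c ((1 + Cmod a) / 2) 1 (divdiff a (fun n => a ^ n)%C) hc) as [l hl]. lra.
  apply (Cmod_divdiff_le a _ (fun n => a ^ n)%C). lra. apply Cmod_pow_le. lra.
  exists l. split; trivial. apply (pser_Qderiv c); trivial. intros v hv. now apply pval_pser.
Qed.

Lemma fold_add_le (F : nat -> nat) (B : nat) : forall l,
  (forall d, In d l -> (F d <= B)%nat) -> (fold_right Nat.add 0%nat (map F l) <= length l * B)%nat.
Proof.
  induction l; intros H; simpl; trivial.
  apply Nat.add_le_mono. apply H; now left. apply IHl. intros d hd. apply H. now right.
Qed.

Lemma sigma1_le (n : nat) : (sigma1 n <= n * n)%nat.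
Proof.
  unfold sigma1. eapply Nat.le_trans. apply (fold_add_le _ n).
  - intros d hd. apply in_seq in hd. destruct (_ =? _)%nat; lia.
  - rewrite length_seq. lia.
Qed.

(** [N - 1] divides [24] at the four levels, so the division is exact and the [q]-series has integer
    coefficients; this makes an exact verification possible. *)
Definition coeff (N n : nat) : Z :=
  if (n =? 0)%nat then 1%Z else
  (24 / (Z.of_nat N - 1) * (Z.of_nat (sigma1 n) -
     if (n mod N =? 0)%nat then Z.of_nat (N * sigma1 (n / N)) else 0))%Z.

Definition good_level (N : nat) : Prop := N = 2%nat \/ N = 3%nat \/ N = 5%nat \/ N = 7%nat.

Lemma coeff_bound (N n : nat) : (2 <= N)%nat -> (n <> 0)%nat ->
  (Z.abs (coeff N n) <= 48 * (Z.of_nat n * Z.of_nat n))%Z.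
Proof.
  intros hN hn. unfold coeff. destruct (Nat.eqb_spec n 0); [lia|].
  rewrite Z.abs_mul.
  assert (h1 : (0 <= 24 / (Z.of_nat N - 1) <= 24)%Z).
  { split. apply Z.div_pos; lia. apply Z.div_le_upper_bound; nia. }
  assert (h2 : (Z.abs (Z.of_nat (sigma1 n) - (if (n mod N =? 0)%nat then Z.of_nat (N * sigma1 (n / N)) else 0))
     <= 2 * (Z.of_nat n * Z.of_nat n))%Z).
  { pose proof (sigma1_le n). pose proof (sigma1_le (n / N)).
    destruct (n mod N =? 0)%nat; [|lia].
    assert (N * sigma1 (n / N) <= n * n)%nat.
    { pose proof (Nat.Div0.mul_div_le n N). set (d := (n / N)%nat) in *. 
      apply Nat.le_trans with (N * (d * d))%nat. apply Nat.mul_le_mono_l; trivial.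
      apply Nat.le_trans with ((N * d) * (N * d))%nat. nia. now apply Nat.mul_le_mono. }
    nia. }
  nia.
Qed.

Lemma polybounded_IZR (c : nat -> Z) (A : Z) :
  (forall n, (n <> 0)%nat -> (Z.abs (c n) <= A * (Z.of_nat n * Z.of_nat n))%Z) -> polybounded (fun n => IZR (c n)).
Proof.
  intros H. exists (Rabs (IZR A) + Rabs (IZR (c 0%nat))), 2%nat.
  pose proof (Rabs_pos (IZR A)). pose proof (Rabs_pos (IZR (c 0%nat))).
  split. lra. intros n. pose proof (pos_INR n). destruct (Nat.eq_dec n 0) as [->|hn].
  - simpl INR. rewrite Rplus_0_l, pow1. lra.
  - specialize (H n hn). rewrite <- abs_IZR. apply IZR_le in H. rewrite !mult_IZR, <- INR_IZR_INZ in H.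
    pose proof (Rle_abs (IZR A)).
    assert (INR n * INR n <= (INR n + 1) ^ 2) by nra.
    apply Rle_trans with (Rabs (IZR A) * (INR n * INR n)).
    + eapply Rle_trans. exact H. apply Rmult_le_compat_r. nra. lra.
    + apply Rmult_le_compat; nra.
Qed.

Lemma coeff_polybounded (N : nat) : (2 <= N)%nat -> polybounded (fun n => IZR (coeff N n)).
Proof. intros hN. apply polybounded_IZR with 48%Z. intros n hn. now apply coeff_bound. Qed.

Lemma Cseries_sparse (a : nat -> C) (l : C) (N : nat) : (N <> 0)%nat -> Cseries a l ->
  Cseries (fun n => if (n mod N =? 0)%nat then a (n / N)%nat else RtoC 0) l.
Proof.
  intros hN H. apply Cseries_Clim in H. apply Cseries_Clim.
  assert (E : forall n, Csum_n (fun n => if (n mod N =? 0)%nat then a (n / N)%nat else RtoC 0) n = Csum_n a (n / N)).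
  { induction n. rewrite Nat.Div0.div_0_l, !Csum_n_0, Nat.Div0.mod_0_l, Nat.Div0.div_0_l. reflexivity.
    rewrite Csum_n_Sn, IHn.
    pose proof (Nat.div_mod n N hN) as e1. pose proof (Nat.div_mod (S n) N hN) as e2.
    pose proof (Nat.mod_upper_bound n N hN). pose proof (Nat.mod_upper_bound (S n) N hN).
    destruct (Nat.eqb_spec (S n mod N) 0) as [e|e].
    - replace (S n / N)%nat with (S (n / N)) by nia. now rewrite Csum_n_Sn.
    - replace (S n / N)%nat with (n / N)%nat by nia. ring. }
  intros eps he. destruct (H eps he) as [K HK]. exists (K * N)%nat. intros n hn. rewrite E. apply HK.
  apply Nat.div_le_lower_bound; lia.
Qed.

Lemma sigma_series_0 (q L : C) : Cseries (fun j => INR (sigma1 (S j)) * q ^ S j)%C L ->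
  Cseries (fun n => INR (sigma1 n) * q ^ n)%C L.
Proof.
  intros H. apply (Cseries_cons (fun n => INR (sigma1 n) * q ^ n)%C) in H.
  replace (INR (sigma1 0) * q ^ 0 + L)%C with L in H by (simpl; ring). exact H.
Qed.

Definition etN (N : nat) (z : C) : C := EtN N z.

Lemma etN_eq (N : nat) (z : C) :
  etN N z = (RtoC (/ (INR N - 1)) * (INR N * eis2 (INR N * z) - eis2 z))%C.
Proof. reflexivity. Qed.

Lemma mul_nat_Im (N : nat) (z : C) : snd (INR N * z)%C = INR N * snd z.
Proof. simpl. ring. Qed.

Lemma etN_series (N : nat) (tau : C) : good_level N -> 0 < snd tau ->
  pser (fun n => IZR (coeff N n)) (fun n => qe tau ^ n)%C (etN N tau).
Proof.
  intros hN ht.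
  assert (hN2 : (2 <= N)%nat) by (unfold good_level in hN; lia).
  destruct (eis2_series tau ht) as [L [h1 [_ h2]]].
  assert (htN : 0 < snd (INR N * tau)%C).
  { rewrite mul_nat_Im. apply Rmult_lt_0_compat; trivial. apply lt_0_INR; lia. }
  destruct (eis2_series _ htN) as [L' [h1' [_ h2']]].
  rewrite etN_eq, h2, h2'. apply sigma_series_0 in h1, h1'.
  pose proof (Cseries_sparse _ _ N ltac:(lia) h1') as hs.
  pose proof (Cseries_finite (fun n => if (n =? 0)%nat then RtoC 1 else RtoC 0) 1) as h0.
  specialize (h0 ltac:(intros [|k] hk; [lia|reflexivity])).
  set (k24 := IZR (24 / (Z.of_nat N - 1))).
  assert (hk : k24 * (INR N - 1) = 24).
  { unfold k24. destruct hN as [->|[->|[->| ->]]];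
      [replace (24 / (Z.of_nat 2 - 1))%Z with 24%Z by reflexivity
      |replace (24 / (Z.of_nat 3 - 1))%Z with 12%Z by reflexivity
      |replace (24 / (Z.of_nat 5 - 1))%Z with 6%Z by reflexivity
      |replace (24 / (Z.of_nat 7 - 1))%Z with 4%Z by reflexivity]; simpl; lra. }
  assert (hN1 : INR N - 1 <> 0) by (intros K; rewrite K in hk; lra).
  assert (hk' : (RtoC k24 * (INR N - 1))%C = 24) by (rewrite <- RtoC_minus, <- RtoC_mult, hk; reflexivity).
  pose proof (Cseries_plus _ _ _ _ h0 (Cseries_scal k24 _ _ (Cseries_minus _ _ _ _ h1 (Cseries_scal (INR N) _ _ hs)))) as H.
  match type of H with is_series _ ?l => match goal with |- pser _ _ ?l' => replace l' with l end end.
  - eapply Cseries_ext; [|exact H]. intros n. cbv beta. unfold coeff.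
    destruct (Nat.eqb_spec n 0) as [->|hn].
    + rewrite Nat.Div0.mod_0_l, Nat.Div0.div_0_l. simpl. ring.
    + rewrite mult_IZR, minus_IZR. fold k24. rewrite <- INR_IZR_INZ.
      destruct (Nat.eqb_spec (n mod N) 0) as [e|e].
      * rewrite <- INR_IZR_INZ, mult_INR, RtoC_mult, RtoC_minus, RtoC_mult.
        rewrite qe_pow, <- Cpow_mult_r.
        replace (N * (n / N))%nat with n. ring.
        pose proof (Nat.div_mod n N ltac:(lia)). lia.
      * rewrite RtoC_mult, RtoC_minus. ring.
  - simpl csum. rewrite RtoC_inv, RtoC_minus by trivial.
    assert (hc : (INR N - 1)%C <> 0) by (rewrite <- RtoC_minus; now apply RtoC_neq0).
    transitivity (/ (INR N - 1) * ((INR N - 1) + RtoC k24 * (INR N - 1) * (L - INR N * L')))%C.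
    + field. exact hc.
    + rewrite hk'. field. exact hc.
Qed.

Lemma eis2_Qderiv (tau : C) : 0 < snd tau -> exists D, Qderiv eis2 tau D.
Proof.
  intros ht. set (c := fun n => INR (sigma1 n)).
  assert (hc : polybounded c).
  { exists 1, 2%nat. split. lra. intros n. unfold c. rewrite Rabs_right by (apply Rle_ge, pos_INR).
    pose proof (sigma1_le n) as h. apply le_INR in h. rewrite mult_INR in h. pose proof (pos_INR n). nra. }
  destruct (pval_Qderiv c (qe tau) hc (qe_lt_1 tau ht)) as [l [_ hl]].
  pose proof (Qderiv_comp _ _ _ _ _ hl (Qderiv_qe tau)) as H1.
  pose proof (Qderiv_plus _ _ _ _ _ (Qderiv_const 1 tau) (Qderiv_mult _ _ _ _ _ (Qderiv_const (-24) tau) H1)) as H2.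
  eexists. eapply (Qderiv_ext_loc _ _ _ _ (snd tau)); [|
    |exact H2].
  - rewrite Cmod_R, Rabs_right; lra.
  - intros h hh. cbv beta. rewrite Cmod_R, Rabs_right in hh by lra.
    assert (hth : 0 < snd (tau + h)%C).
    { pose proof (Rabs_snd_le h) as k. assert (k' : Rabs (snd h) < snd tau) by lra. apply Rabs_def2 in k'. simpl. lra. }
    destruct (eis2_series _ hth) as [L [h1 [_ h2]]]. rewrite h2.
    rewrite (pval_eq c _ L). replace (RtoC (-24)) with (- (24))%C by (now rewrite <- RtoC_opp). ring.
    apply sigma_series_0, h1.
Qed.

(** * Values at [i] and [rho], and the known zeros *)

Lemma eis2_sub_nat (tau : C) (j : nat) : eis2 (tau - INR j)%C = eis2 tau.
Proof.
  induction j. f_equal. simpl. ring. rewrite <- IHj, <- eis2_add_1. f_equal. rewrite S_INR, RtoC_plus. ring.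
Qed.

Lemma Qderiv_shift (f : C -> C) (x D s : C) : (forall z, f (z + s)%C = f z) -> Qderiv f x D -> Qderiv f (x + s)%C D.
Proof.
  intros E [K [d [hK [hd H]]]]. exists K, d. split; [|split]; trivial. intros h hh.
  replace (x + s + h)%C with ((x + h) + s)%C by ring. rewrite !E. now apply H.
Qed.

Lemma eis2_deriv_S (t D : C) : 0 < snd t -> Qderiv eis2 t D ->
  Qderiv eis2 (- / t)%C (t * t * (2 * t * eis2 t + t * t * D + kappa))%C.
Proof.
  intros ht H. pose proof (tau_neq0 t ht) as h0.
  destruct (eis2_Qderiv _ (neg_inv_Im t ht)) as [D' H'].
  pose proof (Qderiv_comp eis2 (fun z => - / z)%C _ _ _ H' (Qderiv_neg_inv t h0)) as H1.
  pose proof (Qderiv_plus _ _ _ _ _ (Qderiv_mult _ _ _ _ _ (Qderiv_mult _ _ _ _ _ (Qderiv_id t) (Qderiv_id t)) H)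
     (Qderiv_mult _ _ _ _ _ (Qderiv_const kappa t) (Qderiv_id t))) as H2.
  assert (H3 : Qderiv (fun z => eis2 (- / z)%C) t
     ((1 * t + t * 1) * eis2 t + t * t * D + (0 * t + kappa * 1))%C).
  { eapply (Qderiv_ext_loc _ _ _ _ (snd t)); [| |exact H2].
    rewrite Cmod_R, Rabs_right; lra.
    intros h hh. cbv beta. rewrite Cmod_R, Rabs_right in hh by lra. symmetry. apply eis2_S.
    pose proof (Rabs_snd_le h) as k. assert (k' : Rabs (snd h) < snd t) by lra. apply Rabs_def2 in k'. simpl. lra. }
  pose proof (Qderiv_unique _ _ _ _ H1 H3) as E.
  replace (t * t * (2 * t * eis2 t + t * t * D + kappa))%C with D'; trivial.
  replace D' with (t * t * (/ (t * t) * D'))%C by (field; trivial). rewrite E. ring.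
Qed.

(** [i] is fixed by [S], so the law is a linear equation for [eis2 Ci]. The value is [3 / PI]. *)
Lemma eis2_i : eis2 Ci = (kappa * Ci / 2)%C.
Proof.
  assert (h : 0 < snd Ci) by (simpl; lra).
  pose proof (eis2_S Ci h) as E.
  assert (hi : (Ci * Ci)%C = (-1)%C) by (apply C_ext; simpl; ring).
  replace (- / Ci)%C with Ci in E by (apply C_ext; simpl; field).
  rewrite hi in E. replace (eis2 Ci) with ((eis2 Ci - -1 * eis2 Ci) / 2)%C.
  rewrite E at 1. field.
  replace (RtoC (-1)) with (- (1))%C by (now rewrite <- RtoC_opp). field.
Qed.

Definition crho : C := rho.

Lemma crho_eq : (crho * crho + crho + 1)%C = 0.
Proof. apply C_ext; unfold crho, rho; simpl; pose proof (sqrt_sqrt 3 ltac:(lra)); nra. Qed.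

Lemma crho_Im : 0 < snd crho.
Proof. unfold crho, rho. simpl. pose proof (sqrt_lt_R0 3 ltac:(lra)). lra. Qed.

Lemma crho_neg_inv : (- / (crho + 1))%C = crho.
Proof.
  assert (h : (crho + 1)%C <> 0) by (intros K; pose proof crho_Im as k; apply (f_equal snd) in K; simpl in K; simpl in k; lra).
  replace (- / (crho + 1))%C with (crho - (crho * crho + crho + 1) / (crho + 1))%C by (field; trivial).
  rewrite crho_eq. field. trivial.
Qed.

Lemma crho_add_1_Im : 0 < snd (crho + 1)%C.
Proof. pose proof crho_Im. simpl in *. lra. Qed.

Lemma eis2_rho : eis2 crho = (kappa * (2 * crho + 1) / 3)%C.
Proof.
  pose proof (eis2_S _ crho_add_1_Im) as E. rewrite crho_neg_inv, eis2_add_1 in E.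
  pose proof crho_eq as h. set (r := crho) in *. set (e := eis2 r) in *.
  assert (F : (e * (1 - r) - kappa * (r + 1))%C = 0).
  { replace (e * (1 - r) - kappa * (r + 1))%C with (e - ((r + 1) * (r + 1) * e + kappa * (r + 1)) + e * (r * r + r + 1))%C by ring.
    rewrite h, <- E. ring. }
  (* Linear combination of two vanishing quantities, the minimal polynomial of [r] and the equation
     [F], chosen to make the identity purely polynomial. *)
  transitivity (kappa * (2 * r + 1) / 3 + (kappa + e) * (r * r + r + 1) / 3 + (e * (1 - r) - kappa * (r + 1)) * (r + 2) / 3)%C.
  field. rewrite h, F. field.
Qed.

(** [rho] is fixed by [- / (z + 1)], so the differentiated law is a linear equation for the
    derivative. Its solution agrees with the Ramanujan identity [E2' = 2 PI i (E2^2 - E4) / 12],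
    since [E4] vanishes at [rho]. *)
Lemma eis2_rho_deriv : Qderiv eis2 crho (- kappa / 3)%C.
Proof.
  destruct (eis2_Qderiv crho crho_Im) as [D H].
  pose proof (eis2_deriv_S _ D crho_add_1_Im (Qderiv_shift _ _ _ _ eis2_add_1 H)) as H'.
  rewrite crho_neg_inv in H'. pose proof (Qderiv_unique _ _ _ _ H H') as E.
  rewrite eis2_add_1, eis2_rho in E.
  pose proof crho_eq as h. set (r := crho) in *.
  replace (- kappa / 3)%C with D; trivial.
  set (E' := ((r + 1) * (r + 1) * (2 * (r + 1) * (kappa * (2 * r + 1) / 3) + (r + 1) * (r + 1) * D + kappa))%C) in *.
  transitivity (- kappa / 3 + (1 - r) / 3 * (D - E') + (r * r + r + 1) *
    (D * (1 + r / 3 - 2 * r * r / 3 - r * r * r / 3) + kappa * (8 / 9 + r / 3 - 2 * r * r / 3 - 4 * r * r * r / 9)))%C.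
  - unfold E'. field.
  - rewrite h, <- E. field.
Qed.

Lemma eis2_add_nat (tau : C) (j : nat) : eis2 (tau + INR j)%C = eis2 tau.
Proof. rewrite <- (eis2_sub_nat _ j). f_equal. ring. Qed.

(* For [N] equal to the squared modulus of [w - j] this is [(w + k) / N] with [k = j] if [w = i], [k = j + 1] if [w = rho]. *)
Definition lower_pt (w : C) (j : nat) : C := (- / (w - INR j))%C.

Lemma sub_nat_Im (w : C) (j : nat) : snd (w - INR j)%C = snd w.
Proof. simpl. ring. Qed.

Lemma lower_pt_Im (w : C) (j : nat) : 0 < snd w -> 0 < snd (lower_pt w j).
Proof. intros h. apply neg_inv_Im. now rewrite sub_nat_Im. Qed.

Lemma eis2_lower_pt (w : C) (j : nat) : 0 < snd w ->
  eis2 (lower_pt w j) = ((w - INR j) * (w - INR j) * eis2 w + kappa * (w - INR j))%C.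
Proof. intros h. unfold lower_pt. rewrite eis2_S, eis2_sub_nat; trivial. now rewrite sub_nat_Im. Qed.

Lemma mul_lower_pt_i (j : nat) : (INR (1 + j * j) * lower_pt Ci j)%C = (Ci + INR j)%C.
Proof.
  assert (h : (Ci - INR j)%C <> 0) by (intros K; apply (f_equal snd) in K; rewrite sub_nat_Im in K; cbn in K; lra).
  assert (hi : (Ci * Ci + 1)%C = 0) by (apply C_ext; simpl; ring).
  unfold lower_pt. rewrite plus_INR, mult_INR, RtoC_plus, RtoC_mult. change (INR 1) with 1.
  transitivity (Ci + INR j - (Ci * Ci + 1) / (Ci - INR j))%C. field; trivial. rewrite hi. field; trivial.
Qed.

Lemma mul_lower_pt_rho (j : nat) : (INR (1 + j + j * j) * lower_pt crho j)%C = (crho + INR (1 + j))%C.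
Proof.
  assert (h : (crho - INR j)%C <> 0).
  { intros K; apply (f_equal snd) in K. rewrite sub_nat_Im in K. pose proof crho_Im as Q. change (snd crho = 0) in K. rewrite K in Q. lra. }
  unfold lower_pt. rewrite !plus_INR, mult_INR, !RtoC_plus, RtoC_mult. change (INR 1) with 1.
  transitivity (crho + (1 + INR j) - (crho * crho + crho + 1) / (crho - INR j))%C. field; trivial.
  rewrite crho_eq. field; trivial.
Qed.

(** The point is the image under [S] of a translate of [i], and [N] times the point is again a
    translate of [i]. Both values of [eis2] are thus multiples of [kappa], and their combination is
    divisible by [i^2 + 1]. *)
Lemma etN_zero_i (j : nat) : etN (1 + j * j) (lower_pt Ci j) = 0.
Proof.
  assert (hi : (Ci * Ci + 1)%C = 0) by (apply C_ext; simpl; ring).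
  rewrite etN_eq, mul_lower_pt_i, eis2_add_nat, eis2_lower_pt, eis2_i by (simpl; lra).
  rewrite plus_INR, mult_INR, RtoC_plus, RtoC_mult. change (INR 1) with 1.
  set (k := RtoC (/ _)). set (J := RtoC (INR j)).
  transitivity (k * (kappa * ((Ci * Ci + 1) * (J - Ci / 2))))%C. field. rewrite hi. ring.
Qed.

Lemma etN_zero_rho (j : nat) : etN (1 + j + j * j) (lower_pt crho j) = 0.
Proof.
  rewrite etN_eq, mul_lower_pt_rho, eis2_add_nat, eis2_lower_pt, eis2_rho by apply crho_Im.
  rewrite !plus_INR, mult_INR, !RtoC_plus, RtoC_mult. change (INR 1) with 1.
  set (k := RtoC (/ _)). set (J := RtoC (INR j)).
  transitivity (k * (kappa / 3 * ((crho * crho + crho + 1) * (4 * J + 1 - 2 * crho))))%C. field.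
  rewrite crho_eq. ring.
Qed.

Lemma etN_deriv_rho (j : nat) : j = 1%nat \/ j = 2%nat -> Qderiv (etN (1 + j + j * j)) (lower_pt crho j) 0.
Proof.
  intros hj. set (N := (1 + j + j * j)%nat). set (t := (crho - INR j)%C).
  assert (ht : 0 < snd t) by (unfold t; rewrite sub_nat_Im; apply crho_Im).
  assert (hD : Qderiv eis2 t (- kappa / 3)%C).
  { unfold t, Cminus. apply Qderiv_shift; [|apply eis2_rho_deriv]. intros z. apply eis2_sub_nat. }
  pose proof (eis2_deriv_S t _ ht hD) as H0. change (- / t)%C with (lower_pt crho j) in H0.
  assert (H1 : Qderiv eis2 (INR N * lower_pt crho j)%C (- kappa / 3)%C).
  { unfold N. rewrite mul_lower_pt_rho. apply Qderiv_shift; [|apply eis2_rho_deriv]. intros z. apply eis2_add_nat. }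
  pose proof (Qderiv_comp eis2 (fun z => INR N * z)%C _ _ _ H1 (Qderiv_mult _ _ _ _ _ (Qderiv_const (INR N) _) (Qderiv_id _))) as H2.
  pose proof (Qderiv_mult _ _ _ _ _ (Qderiv_const (RtoC (/ (INR N - 1))) _)
     (Qderiv_plus _ _ _ _ _ (Qderiv_mult _ _ _ _ _ (Qderiv_const (INR N) _) H2)
        (Qderiv_mult _ _ _ _ _ (Qderiv_const (-1) _) H0))) as H3. cbv beta in H3.
  match type of H3 with Qderiv _ _ ?l => assert (E : l = 0) end.
  { unfold t in *. rewrite eis2_sub_nat, eis2_rho. set (k := RtoC (/ _)).
    set (e1 := eis2 _). set (e2 := eis2 (lower_pt _ _)).
    (* For each numerical [j] the derivative is a polynomial in [crho]; the last factor displayed is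
       its quotient by the minimal polynomial. *)
    destruct hj as [-> | ->].
    - replace (RtoC (INR N)) with (RtoC 3) by (unfold N; simpl; f_equal; ring).
      replace (RtoC (INR 1)) with (RtoC 1) by (simpl; reflexivity).
      transitivity (- (k * (kappa / 3 * ((crho * crho + crho + 1) * (9 - 9 * crho + 3 * crho * crho)))))%C.
      field. rewrite crho_eq. ring.
    - replace (RtoC (INR N)) with (RtoC 7) by (unfold N; simpl; f_equal; ring).
      replace (RtoC (INR 2)) with (RtoC 2) by (simpl; reflexivity).
      transitivity (- (k * (kappa / 3 * ((crho * crho + crho + 1) * (29 - 17 * crho + 3 * crho * crho)))))%C.
      field. rewrite crho_eq. ring. }
  rewrite E in H3. eapply Qderiv_ext; [|exact H3]. intros z. cbv beta. rewrite etN_eq.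
  replace (RtoC (-1)) with (- (1))%C by (now rewrite <- RtoC_opp). ring.
Qed.

Definition zero_order_1 (N : nat) (a : C) : Prop :=
  pser (fun n => IZR (coeff N n)) (fun n => a ^ n)%C 0.
(** The divided difference at [a], [a] is the derivative, so a double zero is expressed in the same
    terms as the later uniqueness argument. *)
Definition zero_order_2 (N : nat) (a : C) : Prop :=
  zero_order_1 N a /\ pser (fun n => IZR (coeff N n)) (divdiff a (fun n => a ^ n)%C) 0.

Lemma qe_zero_order_1 (N : nat) (z : C) : good_level N -> 0 < snd z -> etN N z = 0 -> zero_order_1 N (qe z).
Proof. intros hN hz E. unfold zero_order_1. rewrite <- E. now apply etN_series. Qed.

(** By the chain rule the derivative in [z] is [2 PI i q] times the derivative in [q], and this
    factor is not zero. *)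
Lemma qe_zero_order_2 (N : nat) (z : C) : good_level N -> 0 < snd z -> etN N z = 0 ->
  Qderiv (etN N) z 0 -> zero_order_2 N (qe z).
Proof.
  intros hN hz E H. split. now apply qe_zero_order_1.
  set (c := fun n => IZR (coeff N n)).
  assert (hc : polybounded c) by (apply coeff_polybounded; unfold good_level in hN; lia).
  destruct (pval_Qderiv c (qe z) hc (qe_lt_1 z hz)) as [l [h1 h2]].
  assert (H' : Qderiv (etN N) z (2 * PI * Ci * qe z * l)%C).
  { eapply (Qderiv_ext_loc _ _ _ _ (snd z)); [| |exact (Qderiv_comp _ _ _ _ _ h2 (Qderiv_qe z))].
    rewrite Cmod_R, Rabs_right; lra.
    intros h hh. cbv beta. rewrite Cmod_R, Rabs_right in hh by lra.
    apply pval_eq. apply etN_series; trivial.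
    pose proof (Rabs_snd_le h) as k. assert (k' : Rabs (snd h) < snd z) by lra. apply Rabs_def2 in k'. simpl. lra. }
  pose proof (Qderiv_unique _ _ _ _ H H') as K.
  replace (RtoC 0) with l. exact h1.
  assert (hn : (2 * PI * Ci * qe z)%C <> 0) by (apply Cmult_neq_0; [apply two_pi_i_neq0|apply qe_neq0]).
  replace l with (/ (2 * PI * Ci * qe z) * (2 * PI * Ci * qe z * l))%C.
  rewrite <- K. ring. set (A := (2 * PI * Ci * qe z)%C) in *. field. exact hn.
Qed.

Lemma level2_zero : zero_order_1 2 (qe (lower_pt Ci 1)).
Proof. apply qe_zero_order_1. now left. apply lower_pt_Im; simpl; lra. apply (etN_zero_i 1). Qed.

Lemma level3_zero : zero_order_2 3 (qe (lower_pt crho 1)).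
Proof.
  apply qe_zero_order_2. right; now left. apply lower_pt_Im, crho_Im. apply (etN_zero_rho 1).
  apply (etN_deriv_rho 1). now left.
Qed.

Lemma level5_zero : zero_order_1 5 (qe (lower_pt Ci 2)).
Proof. apply qe_zero_order_1. do 2 right; now left. apply lower_pt_Im; simpl; lra. apply (etN_zero_i 2). Qed.

Lemma level7_zero : zero_order_2 7 (qe (lower_pt crho 2)).
Proof.
  apply qe_zero_order_2. do 3 right; reflexivity. apply lower_pt_Im, crho_Im. apply (etN_zero_rho 2).
  apply (etN_deriv_rho 2). now right.
Qed.

(** * Absence of further zeros *)

Section Convolution.
Variable c : nat -> Z.

(** Coefficient of index [n] in the product of the series with the polynomial [Q], whose constant
    term comes first. *)
Fixpoint conv (Q : list Z) (n : nat) : Z :=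
  match Q with
  | [] => 0
  | q :: Q' => q * c n + match n with O => 0 | S m => conv Q' m end
  end%Z.

Fixpoint norm1 (Q : list Z) : Z := match Q with [] => 0 | q :: Q' => Z.abs q + norm1 Q' end%Z.

Lemma norm1_nonneg (Q : list Z) : (0 <= norm1 Q)%Z.
Proof. induction Q; simpl; lia. Qed.

Lemma conv_bound (B : Z) : (0 <= B)%Z -> forall (Q : list Z) (n : nat),
  (forall i, (i <= n)%nat -> (Z.abs (c i) <= B)%Z) -> (Z.abs (conv Q n) <= norm1 Q * B)%Z.
Proof.
  intros hB. induction Q as [|q Q IH]; intros n H; simpl. lia.
  assert (h1 : (Z.abs (q * c n) <= Z.abs q * B)%Z).
  { rewrite Z.abs_mul. apply Z.mul_le_mono_nonneg_l. lia. apply H; lia. }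
  rewrite Z.mul_add_distr_r. destruct n as [|m].
  - pose proof (Z.mul_nonneg_nonneg _ _ (norm1_nonneg Q) hB). lia.
  - specialize (IH m). assert (h2 : (Z.abs (conv Q m) <= norm1 Q * B)%Z) by (apply IH; intros; apply H; lia). lia.
Qed.

Lemma conv_polybounded (Q : list Z) (A : Z) : (0 <= A)%Z -> (Z.abs (c 0%nat) <= A)%Z ->
  (forall n, (n <> 0)%nat -> (Z.abs (c n) <= A * (Z.of_nat n * Z.of_nat n))%Z) ->
  forall n, (n <> 0)%nat -> (Z.abs (conv Q n) <= norm1 Q * A * (Z.of_nat n * Z.of_nat n))%Z.
Proof.
  intros hA h0 H n hn. rewrite <- Z.mul_assoc. apply conv_bound. nia.
  assert (h1 : (1 <= Z.of_nat n * Z.of_nat n)%Z) by nia.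
  intros [|i] hi. nia. eapply Z.le_trans. apply H. lia. apply Z.mul_le_mono_nonneg_l. lia. nia.
Qed.

Lemma conv_zero_cons (q : Z) (Q : list Z) (x : nat -> C) :
  pser (fun n => IZR (c n)) x 0 -> pser (fun n => IZR (conv Q n)) (fun n => x (S n)) 0 ->
  pser (fun n => IZR (conv (q :: Q) n)) x 0.
Proof.
  intros h1 h2. unfold pser in *.
  pose proof (Cseries_cons (fun n => match n with O => 0 | S m => RtoC (IZR (conv Q m)) * x (S m) end)%C _ h2) as h3.
  pose proof (Cseries_plus _ _ _ _ (Cseries_scal (RtoC (IZR q)) _ _ h1) h3) as h4.
  cbv beta iota in h4. replace (RtoC (IZR q) * 0 + (0 + 0))%C with (RtoC 0) in h4 by ring.
  eapply Cseries_ext; [|exact h4]. intros [|n]; cbv beta; cbn [conv]; rewrite plus_IZR, mult_IZR, RtoC_plus, RtoC_mult; ring.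
Qed.

Lemma pser_zero (x : nat -> C) : pser (fun _ => 0) x 0.
Proof.
  apply (Cseries_ext (fun _ => RtoC 0)). intros; ring.
  apply (Cseries_finite (fun _ => RtoC 0) 0). trivial.
Qed.

Lemma conv_zero_1 (a : C) (Q : list Z) :
  pser (fun n => IZR (c n)) (fun n => a ^ n)%C 0 -> pser (fun n => IZR (conv Q n)) (fun n => a ^ n)%C 0.
Proof.
  intros h. induction Q. apply pser_zero. apply conv_zero_cons; trivial.
  pose proof (Cseries_scal a _ _ IHQ) as h1. replace (a * 0)%C with (RtoC 0) in h1 by ring.
  eapply Cseries_ext; [|exact h1]. intros n. simpl. ring.
Qed.

Lemma conv_zero_2 (a : C) (Q : list Z) :
  pser (fun n => IZR (c n)) (fun n => a ^ n)%C 0 ->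
  pser (fun n => IZR (c n)) (divdiff a (fun n => a ^ n)%C) 0 ->
  pser (fun n => IZR (conv Q n)) (divdiff a (fun n => a ^ n)%C) 0.
Proof.
  intros h h'. induction Q. apply pser_zero. apply conv_zero_cons; trivial.
  (* The shifted divided difference is [a] times the original one plus [a^n]; this is the product
     rule for multiplication by the variable. *)
  pose proof (Cseries_plus _ _ _ _ (Cseries_scal a _ _ IHQ) (conv_zero_1 a Q h)) as h1.
  replace (a * 0 + 0)%C with (RtoC 0) in h1 by ring.
  eapply Cseries_ext; [|exact h1]. intros n. cbv beta. cbn [divdiff]. ring.
Qed.
End Convolution.

Lemma conv_ext (c c' : nat -> Z) (Q : list Z) : forall n, (forall i, (i <= n)%nat -> c i = c' i) -> conv c Q n = conv c' Q n.
Proof.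
  induction Q; intros n H; simpl; trivial. rewrite H by lia. destruct n; trivial.
  rewrite (IHQ n). trivial. intros; apply H; lia.
Qed.

(** * Dominance of the coefficient of index [k] *)

Section Dominance.
Variables (c : nat -> R) (r : R) (k : nat).
Hypothesis hc : polybounded c.
Hypothesis hr : 0 < r < 1.

Definition tail_term (n : nat) : R := if (k <? n)%nat then Rabs (c n) * weight r k n else 0.

Lemma tail_term_nonneg (n : nat) : 0 <= tail_term n.
Proof. unfold tail_term. destruct (_ <? _)%nat; [|lra]. apply Rmult_le_pos. apply Rabs_pos. apply weight_nonneg; lra. Qed.

Lemma tail_term_series : ex_series tail_term.
Proof.
  apply (ex_series_le (V:=R_CompleteNormedModule) _ (fun n => Rabs (c n) * weight r k n)).
  - intros n. change (Rabs (tail_term n) <= Rabs (c n) * weight r k n).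
    rewrite Rabs_right by (apply Rle_ge, tail_term_nonneg). unfold tail_term. destruct (_ <? _)%nat. lra.
    apply Rmult_le_pos. apply Rabs_pos. apply weight_nonneg; lra.
  - now apply polybounded_weight_series.
Qed.

(** A divided difference of order [k] kills the powers below [k] and takes the value [1] on the
    [k]-th one. If the whole sum vanishes, [c k] is minus the sum of the later terms. *)
Lemma leading_coeff_le (x : nat -> C) : (forall n, Cmod (x n) <= weight r k n) ->
  (forall n, (n < k)%nat -> x n = 0) -> x k = 1 -> pser c x 0 -> Rabs (c k) <= Series tail_term.
Proof.
  intros hx h0 h1 H.
  pose proof (Cseries_finite (fun n => if (n =? k)%nat then RtoC (c k) else 0)%C (S k)) as F.
  specialize (F ltac:(intros n hn; cbv beta; destruct (Nat.eqb_spec n k); [lia|reflexivity])).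
  assert (E : csum (fun n => if (n =? k)%nat then RtoC (c k) else RtoC 0) (S k) = c k).
  { cbn [csum]. rewrite Nat.eqb_refl.
    assert (G : forall m, (m <= k)%nat -> csum (fun n => if (n =? k)%nat then RtoC (c k) else RtoC 0) m = 0).
    { induction m; intros hm; cbn [csum]; trivial. rewrite IHm by lia. destruct (Nat.eqb_spec m k); [lia|ring]. }
    rewrite G by lia. ring. }
  rewrite E in F.
  pose proof (Cseries_minus _ _ _ _ H F) as K.
  rewrite <- Cmod_R, <- Cmod_opp. replace (- c k)%C with (0 - c k)%C by ring.
  apply (Cseries_norm_le _ _ tail_term _ K).
  - intros n. cbv beta. unfold tail_term. destruct (Nat.eqb_spec n k) as [->|hn].
    + rewrite h1, Nat.ltb_irrefl. replace (c k * 1 - c k)%C with (RtoC 0) by ring. rewrite Cmod_0. lra.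
    + destruct (Nat.ltb_spec k n).
      * replace (c n * x n - 0)%C with (c n * x n)%C by ring. rewrite Cmod_mult, Cmod_R.
        apply Rmult_le_compat_l. apply Rabs_pos. apply hx.
      * rewrite h0 by lia. replace (c n * 0 - 0)%C with (RtoC 0) by ring. rewrite Cmod_0. lra.
  - apply Series_correct, tail_term_series.
Qed.

Variables (A : R) (m : nat).
Hypothesis hA : 0 <= A.
Hypothesis hm : (0 < m)%nat.
Hypothesis hcA : forall n, (n <> 0)%nat -> Rabs (c n) <= A * INR n ^ 2.
Hypothesis hratio : 3 * r * (INR m + 1) ^ (k + 2) <= 2 * INR m ^ (k + 2).

(** Of the exponent [k + 2], the part [k] comes from [weight_le] and [2] from the quadratic bound on
    the coefficients. *)
Definition majorant (n : nat) : R := A / r ^ k * (INR n ^ (k + 2) * r ^ n).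

Lemma tail_term_majorant (n : nat) : (n <> 0)%nat -> tail_term n <= majorant n.
Proof.
  intros hn. unfold tail_term, majorant. assert (hrk : 0 < r ^ k) by (apply pow_lt; lra).
  pose proof (pow_le (INR n) k (pos_INR n)). pose proof (pow_le (INR n) (k+2) (pos_INR n)). pose proof (pow_le r n ltac:(lra)).
  assert (h0 : 0 <= A / r ^ k * (INR n ^ (k + 2) * r ^ n)).
  { apply Rmult_le_pos. apply Rmult_le_pos; trivial. left; now apply Rinv_0_lt_compat. now apply Rmult_le_pos. }
  destruct (_ <? _)%nat; trivial.
  pose proof (weight_le r k ltac:(lra) n) as hw.
  assert (hw' : weight r k n <= / r ^ k * (INR n ^ k * r ^ n)).
  { apply Rmult_le_reg_l with (r ^ k); trivial. rewrite <- Rmult_assoc, Rinv_r, Rmult_1_l by lra. exact hw. }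
  eapply Rle_trans. apply Rmult_le_compat; [apply Rabs_pos|apply weight_nonneg; lra|apply hcA, hn|exact hw'].
  right. rewrite pow_add. field. lra.
Qed.

Lemma majorant_step (n : nat) : (m <= n)%nat -> majorant (S n) <= 2 / 3 * majorant n.
Proof.
  intros hn. unfold majorant. assert (hrk : 0 < r ^ k) by (apply pow_lt; lra).
  assert (hAk : 0 <= A / r ^ k) by (apply Rmult_le_pos; trivial; left; now apply Rinv_0_lt_compat).
  replace (2 / 3 * (A / r ^ k * (INR n ^ (k + 2) * r ^ n))) with (A / r ^ k * (2 / 3 * INR n ^ (k + 2) * r ^ n)) by ring.
  apply Rmult_le_compat_l; trivial. change (r ^ S n) with (r * r ^ n). rewrite S_INR.
  rewrite <- Rmult_assoc. apply Rmult_le_compat_r. apply pow_le; lra.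
  apply le_INR in hn. assert (h0 : 1 <= INR m) by (change 1 with (INR 1); apply le_INR; lia).
  (* The quotient [(n + 1) / n] decreases, so the condition on the ratio at [m] carries over to
     every [n >= m]. *)
  assert (hq : (INR n + 1) * INR m <= (INR m + 1) * INR n) by nra.
  assert (hp : ((INR n + 1) * INR m) ^ (k + 2) <= ((INR m + 1) * INR n) ^ (k + 2)) by (apply pow_incr; nra).
  rewrite !Rpow_mult_distr in hp.
  assert (hmp : 0 < INR m ^ (k + 2)) by (apply pow_lt; lra).
  assert (hnp : 0 < INR n ^ (k + 2)) by (apply pow_lt; lra).
  apply Rmult_le_reg_r with (INR m ^ (k + 2)); trivial.
  apply Rle_trans with (r * ((INR m + 1) ^ (k + 2) * INR n ^ (k + 2))). 
  - replace ((INR n + 1) ^ (k + 2) * r * INR m ^ (k + 2)) with (r * ((INR n + 1) ^ (k + 2) * INR m ^ (k + 2))) by ring.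
    apply Rmult_le_compat_l; lra.
  - nra.
Qed.


Lemma majorant_geom (j : nat) : majorant (m + j) <= majorant m * (2 / 3) ^ j.
Proof.
  induction j. rewrite Nat.add_0_r. simpl. lra.
  rewrite Nat.add_succ_r. eapply Rle_trans. apply majorant_step. lia. simpl. lra.
Qed.

(** The factor [3] is [1 / (1 - 2/3)], the sum of the geometric series dominating the terms from [m]
    on. *)
Lemma tail_series_le : Series tail_term <= sum_n tail_term (pred m) + 3 * majorant m.
Proof.
  rewrite (Series_incr_n tail_term m hm tail_term_series), sum_n_Reals. apply Rplus_le_compat_l.
  assert (hg : is_series (fun j => majorant m * (2 / 3) ^ j) (3 * majorant m)).
  { replace (3 * majorant m) with (majorant m * (/ (1 - 2 / 3))) by field.
    apply (is_series_scal_l (V:=R_NormedModule) (majorant m)). apply is_series_geom. rewrite Rabs_right; lra. }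
  rewrite <- (is_series_unique _ _ hg). apply Series_le; [|eexists; exact hg].
  intros j. split. apply tail_term_nonneg.
  eapply Rle_trans; [apply tail_term_majorant; lia|apply majorant_geom].
Qed.
End Dominance.

(** * Verification of the dominance in integers *)

Section Certificate.
Variables (g : nat -> Z) (p q : Z) (k : nat).

Fixpoint weight_step (prev : Z) (l : list Z) : list Z :=
  match l with [] => [] | w :: l' => (p * w + q * prev)%Z :: weight_step w l' end.
(** The entry [j] is [q^n] times [weight (p / q) j n], computed by the Pascal recurrence with
    denominators cleared. [scaled_sum n] is likewise [q^n] times the partial sum of the tail
    terms. *)
Definition weights (n : nat) : list Z := Nat.iter n (weight_step 0) (1%Z :: repeat 0%Z k).
Fixpoint scaled_sum (n : nat) : Z :=
  match n with
  | O => 0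
  | S m => q * scaled_sum m + if (k <? n)%nat then Z.abs (g n) * nth k (weights n) 0 else 0
  end%Z.
(* The tail beyond [M] is at most three times its first majorant, the ratio being at most [2/3] by the first
   test; the second test is the resulting inequality multiplied by [p ^ k * q ^ (M + 1)]. *)
Definition certificate (A : Z) (M : nat) : bool :=
  ((3 * p * (Z.of_nat M + 2) ^ Z.of_nat (k + 2) <=? 2 * q * (Z.of_nat M + 1) ^ Z.of_nat (k + 2)) &&
   (p ^ Z.of_nat k * (q * scaled_sum M) + 3 * A * (Z.of_nat M + 1) ^ Z.of_nat (k + 2) * p ^ (Z.of_nat M + 1) * q ^ Z.of_nat k
     <? p ^ Z.of_nat k * Z.abs (g k) * q ^ (Z.of_nat M + 1)))%Z%bool.

Hypothesis hpq : (0 < p < q)%Z.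
Let r : R := IZR p / IZR q.

Lemma weight_step_length (l : list Z) : forall prev, length (weight_step prev l) = length l.
Proof. induction l; intros; simpl; auto. Qed.

Lemma weights_length (n : nat) : length (weights n) = S k.
Proof. induction n. simpl. now rewrite repeat_length. simpl. now rewrite weight_step_length. Qed.

Lemma nth_weight_step (l : list Z) : forall prev j, (j < length l)%nat ->
  nth j (weight_step prev l) 0%Z = (p * nth j l 0 + q * match j with O => prev | S i => nth i l 0 end)%Z.
Proof.
  induction l as [|w l IH]; intros prev j hj; simpl in hj. lia.
  destruct j as [|j]; simpl. reflexivity. rewrite IH by lia. destruct j; reflexivity.
Qed.

Lemma weights_spec (n : nat) : forall j, (j <= k)%nat -> IZR (nth j (weights n) 0%Z) = IZR q ^ n * weight r j n.
Proof.
  assert (hq : IZR q <> 0) by (apply eq_IZR_contrapositive; lia).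
  induction n; intros j hj.
  - destruct j; simpl. lra. rewrite nth_repeat. lra.
  - change (weights (S n)) with (weight_step 0 (weights n)). rewrite nth_weight_step by (rewrite weights_length; lia).
    rewrite plus_IZR, !mult_IZR, IHn by trivial. destruct j.
    + simpl. unfold r. field; trivial.
    + rewrite IHn by lia. change (weight r (S j) (S n)) with (r * weight r (S j) n + weight r j n).
      unfold r at 3. simpl (IZR q ^ S n). field. trivial.
Qed.

Lemma scaled_sum_spec (n : nat) : IZR (scaled_sum n) = IZR q ^ n * sum_n (tail_term (fun n => IZR (g n)) r k) n.
Proof.
  induction n.
  - rewrite sum_O. unfold tail_term. replace (k <? 0)%nat with false by (symmetry; apply Nat.ltb_ge; lia). simpl. ring.
  - rewrite sum_Sn. cbn [scaled_sum]. rewrite plus_IZR, mult_IZR, IHn. unfold tail_term at 3.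
    change plus with Rplus. destruct (k <? S n)%nat.
    + rewrite mult_IZR, abs_IZR, weights_spec by lia. simpl. ring.
    + simpl. ring.
Qed.

Lemma IZR_pow_nat (x : Z) (n : nat) : IZR (x ^ Z.of_nat n) = IZR x ^ n.
Proof. symmetry. apply pow_IZR. Qed.

Theorem certificate_sound (A : Z) (M : nat) (x : nat -> C) : (0 <= A)%Z ->
  (forall n, (n <> 0)%nat -> (Z.abs (g n) <= A * (Z.of_nat n * Z.of_nat n))%Z) ->
  certificate A M = true ->
  (forall n, Cmod (x n) <= weight r k n) -> (forall n, (n < k)%nat -> x n = 0) -> x k = 1 ->
  ~ pser (fun n => IZR (g n)) x 0.
Proof.
  intros hA hg hcert hx h0 h1 H.
  assert (hp0 : 0 < IZR p) by (apply IZR_lt; lia).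
  assert (hq0 : IZR p < IZR q) by (apply IZR_lt; lia).
  assert (hr : 0 < r < 1).
  { unfold r. split. apply Rdiv_lt_0_compat; lra. apply Rmult_lt_reg_r with (IZR q). lra. field_simplify; lra. }
  assert (hc : polybounded (fun n => IZR (g n))) by now apply polybounded_IZR with A.
  pose proof (leading_coeff_le _ r k hc hr x hx h0 h1 H) as L.
  unfold certificate in hcert. apply andb_prop in hcert. destruct hcert as [c1 c2].
  apply Z.leb_le in c1. apply Z.ltb_lt in c2. apply IZR_le in c1. apply IZR_lt in c2.
  (* [M + 1] is the index at which the geometric majorant takes over from the explicit sum. *)
  replace (Z.of_nat M + 1)%Z with (Z.of_nat (S M)) in * by lia.
  replace (Z.of_nat M + 2)%Z with (Z.of_nat (S M) + 1)%Z in * by lia.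
  repeat first [rewrite plus_IZR in c1|rewrite mult_IZR in c1|rewrite IZR_pow_nat in c1|rewrite <- INR_IZR_INZ in c1].
  repeat first [rewrite plus_IZR in c2|rewrite mult_IZR in c2|rewrite IZR_pow_nat in c2|rewrite <- INR_IZR_INZ in c2
    |rewrite scaled_sum_spec in c2|rewrite abs_IZR in c2].
  assert (T := tail_series_le (fun n => IZR (g n)) r k hc hr (IZR A) (S M) (IZR_le _ _ hA) ltac:(lia)).
  assert (hr' : r * IZR q = IZR p) by (unfold r; field; lra).
  assert (T1 : forall n, (n <> 0)%nat -> Rabs (IZR (g n)) <= IZR A * INR n ^ 2).
  { intros n hn. specialize (hg n hn). apply IZR_le in hg. rewrite abs_IZR, !mult_IZR, <- INR_IZR_INZ in hg. lra. }
  assert (T2 : 3 * r * (INR (S M) + 1) ^ (k + 2) <= 2 * INR (S M) ^ (k + 2)).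
  { apply Rmult_le_reg_r with (IZR q); [lra|]. rewrite <- hr' in c1. lra. }
  specialize (T T1 T2).
  simpl pred in T. unfold majorant in T.
  set (SM := sum_n (tail_term (fun n => IZR (g n)) r k) M) in *.
  assert (hpk : 0 < IZR p ^ k) by now apply pow_lt.
  assert (hqk : 0 < IZR q ^ k) by (apply pow_lt; lra).
  assert (hqM : 0 < IZR q ^ S M) by (apply pow_lt; lra).
  assert (K : Rabs (IZR (g k)) * (IZR p ^ k * IZR q ^ S M) <=
     (SM + 3 * (IZR A / r ^ k * (INR (S M) ^ (k + 2) * r ^ S M))) * (IZR p ^ k * IZR q ^ S M)).
  { apply Rmult_le_compat_r. apply Rmult_le_pos; lra. change (fun n : nat => IZR (g n)) with (fun n : nat => IZR (g n)) in L. lra. }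
  replace ((SM + 3 * (IZR A / r ^ k * (INR (S M) ^ (k + 2) * r ^ S M))) * (IZR p ^ k * IZR q ^ S M))
    with (IZR p ^ k * (IZR q * (IZR q ^ M * SM)) + 3 * IZR A * INR (S M) ^ (k + 2) * IZR p ^ S M * IZR q ^ k) in K.
  lra.
  rewrite <- hr', !Rpow_mult_distr.
  assert (0 < r ^ k) by (apply pow_lt; lra).
  change (IZR q ^ S M) with (IZR q * IZR q ^ M). field. lra.
Qed.
End Certificate.

(** The list is built before the index is supplied, so that an evaluation computes each divisor sum
    only once. *)
Definition tabulate (c : nat -> Z) (M : nat) : nat -> Z :=
  let l := map c (seq 0 (S M)) in fun n => nth n l 0%Z.

Lemma tabulate_eq (c : nat -> Z) (M n : nat) : (n <= M)%nat -> tabulate c M n = c n.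
Proof.
  intros h. unfold tabulate. rewrite (nth_indep _ 0%Z (c 0%nat)) by (rewrite length_map, length_seq; lia).
  rewrite map_nth, seq_nth by lia. reflexivity.
Qed.

Fixpoint dot (c : nat -> Z) (l : list Z) : Z :=
  match l with [] => 0 | x :: l' => c 0%nat * x + dot (fun i => c (S i)) l' end%Z.

(* First [n] coefficients, in reverse order, of the power series [D / c], for [c 0 = 1]. *)
Fixpoint quotient (c : nat -> Z) (D : list Z) (n : nat) : list Z :=
  match n with
  | O => []
  | S m => let l := quotient c D m in (nth m D 0 - dot (fun i => c (S i)) l)%Z :: l
  end.

(** The product of the series with [Q] agrees with [D] in all indices below [d]. As [D] has degree
    at most [k], its coefficients strictly between [k] and [d] vanish, and only a remote tail
    competes with the coefficient of index [k]. [M] bounds the explicit part, and [norm1 Q * 48] is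
    the quadratic bound beyond it. *)
Definition level_check (N k : nat) (p q : Z) (D : list Z) (d M : nat) : bool :=
  let c := tabulate (coeff N) M in
  let Q := rev (quotient c D d) in
  ((k <=? M)%nat && certificate (conv c Q) p q k (norm1 Q * 48) M)%bool.

Lemma scaled_sum_ext (g g' : nat -> Z) (p q : Z) (k n : nat) :
  (forall i, (i <= n)%nat -> g i = g' i) -> scaled_sum g p q k n = scaled_sum g' p q k n.
Proof. induction n; intros H; trivial. cbn [scaled_sum]. rewrite IHn, H; auto. Qed.

Lemma level_check_sound (N k : nat) (p q : Z) (D : list Z) (d M : nat) :
  (2 <= N)%nat -> (0 < p < q)%Z -> level_check N k p q D d M = true ->
  exists Q, forall x : nat -> C,
    (forall n, Cmod (x n) <= weight (IZR p / IZR q) k n) -> (forall n, (n < k)%nat -> x n = 0) -> x k = 1 ->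
    ~ pser (fun n => IZR (conv (coeff N) Q n)) x 0.
Proof.
  intros hN hpq h. unfold level_check in h.
  set (c := tabulate (coeff N) M) in *. set (Q := rev (quotient c D d)) in *.
  apply andb_prop in h. destruct h as [hk h]. apply Nat.leb_le in hk.
  assert (E : forall n, (n <= M)%nat -> conv c Q n = conv (coeff N) Q n).
  { intros n hn. apply conv_ext. intros i hi. apply tabulate_eq. lia. }
  exists Q. intros x. apply certificate_sound with (norm1 Q * 48)%Z M; trivial.
  - pose proof (norm1_nonneg Q). lia.
  - apply conv_polybounded. lia. vm_compute; discriminate. intros n hn. now apply coeff_bound.
  - unfold certificate in *. now rewrite (scaled_sum_ext _ (conv c Q)), <- E by (trivial; intros; symmetry; apply E; trivial).
Qed.

(** Here the multiplier is the constant [1]: the coefficient [24] of the first power already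
    dominates on the disc of radius [1/10]. *)
Lemma level2_check : level_check 2 1 1 10 [1%Z] 1 60 = true.
Proof. vm_compute. reflexivity. Qed.

(* The entries of [D] approximate the coefficients of [(1 - v / a) ^ 2]. *)
Lemma level3_check : level_check 3 2 1 5 [100; 1227; 3762]%Z 4 60 = true.
Proof. vm_compute. reflexivity. Qed.

(* Here [D] approximates [(1 - v / a) (1 - v / conj a)]. *)
Lemma level5_check : level_check 5 2 37 100 [1000000; 5685101; 12345284]%Z 21 60 = true.
Proof. vm_compute. reflexivity. Qed.

(* Here [D] approximates [((1 - v / a) (1 - v / conj a)) ^ 2]. *)
Lemma level7_check :
  level_check 7 4 49 100 [1000000000; 5426064360; 16827735628; 25684796600; 22406931180]%Z 41 80 = true.
Proof. vm_compute. reflexivity. Qed.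

(** * Uniqueness of the zeros in the disc *)

Lemma divdiff_weight (a : C) (r : R) (k : nat) (x : nat -> C) : Cmod a <= r ->
  (forall n, Cmod (x n) <= weight r k n) -> forall n, Cmod (divdiff a x n) <= weight r (S k) n.
Proof. intros ha hx. now apply Cmod_divdiff_le. Qed.

(** A second zero would make the divided difference at [v], [a] vanish, against the verified
    dominance. The other levels use the nodes [v, a, a] for [N = 3], [v, a, b] for [N = 5] and
    [v, a, a, b, b] for [N = 7]. *)
Lemma level2_unique (v a : C) : Cmod v <= 1 / 10 -> Cmod a <= 1 / 10 ->
  zero_order_1 2 v -> zero_order_1 2 a -> v = a.
Proof.
  intros hv ha zv za. destruct (Ceq_dec v a) as [|n]; trivial. exfalso.
  destruct (level_check_sound 2 1 1 10 _ _ _ ltac:(lia) ltac:(lia) level2_check) as [Q hQ].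
  apply (hQ (divdiff v (fun n => a ^ n)%C)).
  - apply divdiff_weight; trivial. now apply Cmod_pow_le.
  - intros [|m] hm; [reflexivity|lia].
  - simpl. ring.
  - apply pser_zero_pow; trivial; now apply conv_zero_1.
Qed.

Lemma level3_unique (v a : C) : Cmod v <= 1 / 5 -> Cmod a <= 1 / 5 ->
  zero_order_1 3 v -> zero_order_2 3 a -> v = a.
Proof.
  intros hv ha zv [za za']. destruct (Ceq_dec v a) as [|n]; trivial. exfalso.
  destruct (level_check_sound 3 2 1 5 _ _ _ ltac:(lia) ltac:(lia) level3_check) as [Q hQ].
  apply (hQ (divdiff v (divdiff a (fun n => a ^ n)%C))).
  - repeat (apply divdiff_weight; trivial). now apply Cmod_pow_le.
  - intros [|[|m]] hm; [| |lia]; simpl; ring.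
  - simpl. ring.
  - apply pser_zero_divdiff; trivial. apply pser_zero_pow; trivial; now apply conv_zero_1.
    now apply conv_zero_2.
Qed.

Lemma level5_unique (v a b : C) : Cmod v <= 37 / 100 -> Cmod a <= 37 / 100 -> Cmod b <= 37 / 100 -> a <> b ->
  zero_order_1 5 v -> zero_order_1 5 a -> zero_order_1 5 b -> v = a \/ v = b.
Proof.
  intros hv ha hb hab zv za zb. destruct (Ceq_dec v a) as [|n]; [now left|].
  destruct (Ceq_dec v b) as [|n']; [now right|]. exfalso.
  destruct (level_check_sound 5 2 37 100 _ _ _ ltac:(lia) ltac:(lia) level5_check) as [Q hQ].
  apply (hQ (divdiff v (divdiff a (fun n => b ^ n)%C))).
  - repeat (apply divdiff_weight; trivial). now apply Cmod_pow_le.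
  - intros [|[|m]] hm; [| |lia]; simpl; ring.
  - simpl. ring.
  - apply pser_zero_divdiff; trivial; apply pser_zero_pow; trivial; now apply conv_zero_1.
Qed.

Lemma level7_unique (v a b : C) : Cmod v <= 49 / 100 -> Cmod a <= 49 / 100 -> Cmod b <= 49 / 100 -> a <> b ->
  zero_order_1 7 v -> zero_order_2 7 a -> zero_order_2 7 b -> v = a \/ v = b.
Proof.
  intros hv ha hb hab zv [za za'] [zb zb']. destruct (Ceq_dec v a) as [|n]; [now left|].
  destruct (Ceq_dec v b) as [|n']; [now right|]. exfalso.
  destruct (level_check_sound 7 4 49 100 _ _ _ ltac:(lia) ltac:(lia) level7_check) as [Q hQ].
  set (g := fun n => IZR (conv (coeff 7) Q n)) in *.
  assert (gv : pser g (fun n => v ^ n)%C 0) by now apply conv_zero_1.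
  assert (ga : pser g (fun n => a ^ n)%C 0) by now apply conv_zero_1.
  assert (gb : pser g (fun n => b ^ n)%C 0) by now apply conv_zero_1.
  assert (ga' : pser g (divdiff a (fun n => a ^ n)%C) 0) by now apply conv_zero_2.
  assert (gb' : pser g (divdiff b (fun n => b ^ n)%C) 0) by now apply conv_zero_2.
  assert (gab : pser g (divdiff a (fun n => b ^ n)%C) 0) by now apply pser_zero_pow.
  apply (hQ (divdiff v (divdiff a (divdiff a (divdiff b (fun n => b ^ n)%C))))).
  - repeat (apply divdiff_weight; trivial). now apply Cmod_pow_le.
  - intros [|[|[|[|m]]]] hm; [| | | |lia]; simpl; ring.
  - simpl. ring.
  - assert (H1 : pser g (divdiff a (divdiff b (fun n => b ^ n)%C)) 0) by now apply pser_zero_divdiff.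
    apply pser_zero_divdiff; trivial.
    + apply pser_zero_divdiff; trivial. apply pser_zero_divdiff; trivial. now apply pser_zero_pow.
    (* The difference quotient needs distinct outer nodes, so [a, a, b, b] is rearranged as
       [a, b, a, b], and below [a, a, b] as [a, b, a]. *)
    + apply pser_ext with (divdiff a (divdiff b (divdiff a (fun n => b ^ n)%C))).
      intros n0. apply divdiff_ext. intros k. apply divdiff_comm.
      apply pser_zero_divdiff; trivial.
      * apply pser_ext with (divdiff a (divdiff b (fun n => a ^ n)%C)).
        intros n0. apply divdiff_ext. intros k. symmetry. apply divdiff_pow_comm.
        apply pser_zero_divdiff; trivial. apply pser_zero_pow; auto.
      * apply pser_ext with (divdiff a (divdiff b (fun n => b ^ n)%C)); trivial.
        intros n0. apply divdiff_comm.
Qed.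

(** * Conjugate zeros and injectivity of [qe] modulo integers *)

Lemma pser_conj (c : nat -> R) (x : nat -> C) (l : C) : pser c x l -> pser c (fun n => Cconj (x n)) (Cconj l).
Proof.
  intros H. apply Cseries_Clim in H. apply Cseries_Clim. intros eps he. destruct (H eps he) as [N HN].
  exists N. intros n hn. specialize (HN n hn). rewrite <- Cmod_conj in HN.
  replace (Csum_n (fun n => RtoC (c n) * Cconj (x n))%C n) with (Cconj (Csum_n (fun n => RtoC (c n) * x n)%C n)).
  replace (Cconj (Csum_n (fun n => RtoC (c n) * x n)%C n) - Cconj l)%C
    with (Cconj (Csum_n (fun n => RtoC (c n) * x n)%C n - l)) by (apply C_ext; simpl; ring). exact HN.
  rewrite !Csum_n_csum. generalize (S n). clear. induction n; cbn [csum].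
  - apply C_ext; simpl; ring.
  - rewrite <- IHn. apply C_ext; simpl; ring.
Qed.



Lemma Cconj_divdiff (a : C) (x : nat -> C) (n : nat) :
  Cconj (divdiff a x n) = divdiff (Cconj a) (fun k => Cconj (x k)) n.
Proof.
  induction n; cbn [divdiff]. apply C_ext; simpl; ring. rewrite <- IHn, <- Cmult_conj. apply C_ext; simpl; ring.
Qed.

Lemma Cconj_0 : Cconj 0 = 0.
Proof. apply C_ext; simpl; ring. Qed.

Lemma zero_order_1_conj (N : nat) (a : C) : zero_order_1 N a -> zero_order_1 N (Cconj a).
Proof.
  intros H. apply pser_conj in H. rewrite Cconj_0 in H. revert H. apply pser_ext. intros n. apply Cpow_conj.
Qed.

Lemma zero_order_2_conj (N : nat) (a : C) : zero_order_2 N a -> zero_order_2 N (Cconj a).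
Proof.
  intros [H H']. split. now apply zero_order_1_conj.
  apply pser_conj in H'. rewrite Cconj_0 in H'. revert H'. apply pser_ext. intros n. rewrite Cconj_divdiff.
  apply divdiff_ext. intros k. apply Cpow_conj.
Qed.

Lemma qe_conj (z : C) : Cconj (qe z) = qe (- Cconj z)%C.
Proof.
  apply C_ext; unfold qe, qexp; simpl; rewrite ?Ropp_involutive.
  - replace (2 * PI * - fst z) with (- (2 * PI * fst z)) by ring. rewrite cos_neg. reflexivity.
  - replace (2 * PI * - fst z) with (- (2 * PI * fst z)) by ring. rewrite sin_neg. ring.
Qed.

Lemma qe_eq_1 (z : C) : qe z = 1 -> exists m : Z, z = RtoC (IZR m).
Proof.
  intros H. assert (h0 : snd z = 0).
  { destruct (Req_dec (snd z) 0); trivial. exfalso. now apply (qe_neq1 z). }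
  pose proof (f_equal snd H) as hs. unfold qe, qexp in hs. cbn [snd RtoC] in hs. rewrite h0, Rmult_0_r, exp_0, Rmult_1_l in hs.
  apply sin_eq_0_0 in hs. destruct hs as [k hk].
  assert (hx : fst z = IZR k / 2) by (pose proof PI_RGT_0; apply Rmult_eq_reg_r with (2 * PI); lra).
  assert (hz : z = RtoC (IZR k / 2)) by (apply C_ext; simpl; trivial).
  (* The sine only yields a half-integer; at a proper half-integer [qe] is [-1]. *)
  destruct (Zeven_odd_dec k) as [e|e].
  - apply Zeven_ex in e. destruct e as [m ->]. exists m. rewrite hz, mult_IZR. f_equal. field.
  - apply Zodd_ex in e. destruct e as [m ->]. exfalso.
    assert (E : qe z = -1).
    { rewrite hz, plus_IZR, mult_IZR. replace ((2 * IZR m + 1) / 2) with (IZR m + 1 / 2) by field.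
      rewrite RtoC_plus, qe_plus, qe_Z, RtoC_div, qe_half by lra. ring. }
    rewrite E in H. injection H; lra.
Qed.

Lemma qe_inj (z w : C) : qe z = qe w -> exists m : Z, z = (w + IZR m)%C.
Proof.
  intros H. destruct (qe_eq_1 (z - w)%C) as [m hm].
  { unfold Cminus. rewrite qe_plus, qe_opp, H. pose proof (qe_neq0 w). field. trivial. }
  exists m. rewrite <- hm. ring.
Qed.

(** A rational bound for the exponential from [exp (x/16) >= 1 + x/16]; the power [16] is sharp
    enough for the four radii in use. *)
Lemma exp_neg_le (x : R) : 0 <= x -> exp (- x) * (1 + x / 16) ^ 16 <= 1.
Proof.
  intros hx.
  assert (h : (1 + x / 16) ^ 16 <= exp x).
  { replace (exp x) with (exp (x / 16) ^ 16).
    - apply pow_incr. split. lra. apply exp_ineq1_le.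
    - simpl. rewrite Rmult_1_r, <- !exp_plus. f_equal. field. }
  apply Rle_trans with (exp (- x) * exp x). apply Rmult_le_compat_l. left; apply exp_pos. exact h.
  rewrite <- exp_plus. replace (- x + x) with 0 by ring. rewrite exp_0. lra.
Qed.

Lemma sqrt3_gt : 1.73 < sqrt 3.
Proof. rewrite <- (sqrt_pow2 1.73) by lra. apply sqrt_lt_1; lra. Qed.

(* A lower bound for the imaginary part of [(w + k) / N] with [w] in [F_Gamma]. *)
Definition height (N : nat) : R := sqrt 3 / 2 / INR N.

(** At the minimal height, [2 PI] times the imaginary part is [PI sqrt 3 / N], and [5.19 = 3 * 1.73]
    lies below [PI sqrt 3]. *)
Lemma Cmod_qe_le (N : nat) (z : C) (r : R) : (0 < N)%nat -> height N <= snd z ->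
  1 <= r * (1 + 5.19 / INR N / 16) ^ 16 -> Cmod (qe z) <= r.
Proof.
  intros hN hz hr. rewrite Cmod_qe. apply lt_INR in hN. simpl INR in hN.
  set (x := 5.19 / INR N) in *.
  assert (hx : 0 <= x) by (apply Rmult_le_pos; [lra|left; now apply Rinv_0_lt_compat]).
  assert (hP : 0 < (1 + x / 16) ^ 16) by (apply pow_lt; apply Rplus_lt_le_0_compat; [apply Rlt_0_1|];
    apply Rmult_le_pos; [exact hx|left; apply Rinv_0_lt_compat, (IZR_lt 0 16); reflexivity]).
  pose proof (exp_neg_le x hx) as hE.
  set (P := (1 + x / 16) ^ 16) in *. clearbody P.
  assert (hxz : x <= 2 * PI * snd z).
  { unfold height in hz. pose proof PI2_3_2. pose proof sqrt3_gt.
    apply Rle_trans with (2 * PI * (sqrt 3 / 2 / INR N)).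
    - replace (2 * PI * (sqrt 3 / 2 / INR N)) with (PI * sqrt 3 / INR N) by (field; lra).
      apply Rmult_le_compat_r. left; now apply Rinv_0_lt_compat. nra.
    - apply Rmult_le_compat_l; lra. }
  apply Rle_trans with (exp (- x)). apply exp_mono. lra.
  apply Rmult_le_reg_r with P; lra.
Qed.

Lemma height_2 (z : C) : height 2 <= snd z -> Cmod (qe z) <= 1 / 10.
Proof. intros h. apply (Cmod_qe_le 2); trivial. lia. simpl INR. lra. Qed.
Lemma height_3 (z : C) : height 3 <= snd z -> Cmod (qe z) <= 1 / 5.
Proof. intros h. apply (Cmod_qe_le 3); trivial. lia. simpl INR. lra. Qed.
Lemma height_5 (z : C) : height 5 <= snd z -> Cmod (qe z) <= 37 / 100.
Proof. intros h. apply (Cmod_qe_le 5); trivial. lia. simpl INR. lra. Qed.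
Lemma height_7 (z : C) : height 7 <= snd z -> Cmod (qe z) <= 49 / 100.
Proof. intros h. apply (Cmod_qe_le 7); trivial. lia. simpl INR. lra. Qed.

(** Here [u] stands for [N z]. A zero fixes [q], hence [z] modulo [1] and [u] modulo [N]; the
    residues are the values of [k] in [zero_set]. *)
Definition zero_shift (N : nat) (u : C) : Prop :=
  match N with
  | 2%nat => exists m, u = (Ci + IZR (1 + 2 * m))%C
  | 3%nat => exists m, u = (crho + IZR (2 + 3 * m))%C
  | 5%nat => exists m, u = (Ci + IZR (2 + 5 * m))%C \/ u = (Ci + IZR (3 + 5 * m))%C
  | 7%nat => exists m, u = (crho + IZR (3 + 7 * m))%C \/ u = (crho + IZR (5 + 7 * m))%C
  | _ => False
  end.

Lemma good_level_pos (N : nat) : good_level N -> (0 < N)%nat.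
Proof. unfold good_level. lia. Qed.

Lemma zero_order_1_etN (N : nat) (z : C) : good_level N -> 0 < snd z -> zero_order_1 N (qe z) <-> etN N z = 0.
Proof.
  intros hN hz. pose proof (etN_series N z hN hz) as H. split.
  - intros K. exact (Cseries_unique _ _ _ H K).
  - intros K. rewrite K in H. exact H.
Qed.

Lemma qe_eq_mul (N : nat) (z w : C) : (0 < N)%nat ->
  qe z = qe w <-> exists m : Z, (INR N * z)%C = (INR N * w + IZR (Z.of_nat N * m))%C.
Proof.
  intros hN. assert (h0 : RtoC (INR N) <> 0) by (apply RtoC_neq0, not_0_INR; lia). split.
  - intros H. destruct (qe_inj _ _ H) as [m ->]. exists m. rewrite mult_IZR, <- INR_IZR_INZ, RtoC_mult. ring.
  - intros [m hm]. rewrite mult_IZR, <- INR_IZR_INZ, RtoC_mult in hm.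
    assert (E : z = (w + IZR m)%C).
    { replace z with (/ INR N * (INR N * z))%C by (field; trivial). rewrite hm. field; trivial. }
    rewrite E, qe_plus, qe_Z. ring.
Qed.

Lemma mul_neg_conj (N : nat) (z : C) : (INR N * - Cconj z)%C = (- Cconj (INR N * z))%C.
Proof. apply C_ext; simpl; ring. Qed.

Lemma height_lower_i (N j : nat) : N = (1 + j * j)%nat -> height N <= snd (lower_pt Ci j).
Proof.
  intros ->. pose proof (f_equal snd (mul_lower_pt_i j)) as E. rewrite mul_nat_Im in E. cbn [snd Ci Cplus RtoC] in E.
  unfold height. set (M := INR (1 + j * j)) in *.
  assert (hM : 0 < M) by (apply lt_0_INR; lia).
  assert (hs : sqrt 3 <= 2). { rewrite <- (sqrt_pow2 2) by lra. apply sqrt_le_1; lra. }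
  apply Rmult_le_reg_l with M; trivial. rewrite E. replace (M * (sqrt 3 / 2 / M)) with (sqrt 3 / 2) by (field; lra). lra.
Qed.

Lemma height_lower_rho (N j : nat) : N = (1 + j + j * j)%nat -> height N <= snd (lower_pt crho j).
Proof.
  intros ->. pose proof (f_equal snd (mul_lower_pt_rho j)) as E. rewrite mul_nat_Im in E.
  unfold crho, rho in E. cbn [snd Cplus RtoC] in E. fold rho crho in E.
  unfold height. set (M := INR (1 + j + j * j)) in *.
  assert (hM : 0 < M) by (apply lt_0_INR; lia).
  apply Rmult_le_reg_l with M; trivial.
  replace (M * (sqrt 3 / 2 / M)) with (sqrt 3 / 2) by (field; lra).
  change (rho : C) with crho in E. rewrite E. lra.
Qed.

Lemma neg_conj_Im (z : C) : snd (- Cconj z)%C = snd z.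
Proof. simpl. ring. Qed.

Lemma height_pos (N : nat) (z : C) : (0 < N)%nat -> height N <= snd z -> 0 < snd z.
Proof.
  intros hN h. eapply Rlt_le_trans; [|exact h]. unfold height.
  apply Rdiv_lt_0_compat. pose proof sqrt3_gt; lra. now apply lt_0_INR.
Qed.

Lemma neg_conj_i (j : nat) : (- Cconj (Ci + INR j))%C = (Ci - INR j)%C.
Proof. apply C_ext; simpl; ring. Qed.

Lemma neg_conj_rho (j : nat) : (- Cconj (crho + INR (1 + j)))%C = (crho - INR j)%C.
Proof. rewrite plus_INR. unfold crho, rho. apply C_ext; simpl; field. Qed.

Theorem etN_zero_iff (N : nat) (z : C) : good_level N -> height N <= snd z ->
  etN N z = 0 <-> zero_shift N (INR N * z).
Proof.
  intros hN hz. pose proof (height_pos N z (good_level_pos N hN) hz) as hz0.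
  rewrite <- zero_order_1_etN by trivial.
  destruct hN as [->|[->|[->| ->]]]; unfold zero_shift.
  - assert (E : zero_order_1 2 (qe z) <-> qe z = qe (lower_pt Ci 1)).
    { split. intros H. apply level2_unique; trivial; try apply height_2; trivial.
      now apply height_lower_i. apply level2_zero. intros ->. apply level2_zero. }
    rewrite E, (qe_eq_mul 2) by lia.
    pose proof (mul_lower_pt_i 1) as M. change (1 + 1 * 1)%nat with 2%nat in M. rewrite M.
    split; intros [m ->]; exists m; rewrite !plus_IZR, ?mult_IZR, ?RtoC_plus; simpl; ring.
  - assert (E : zero_order_1 3 (qe z) <-> qe z = qe (lower_pt crho 1)).
    { split. intros H. apply level3_unique; trivial; try apply height_3; trivial.
      now apply height_lower_rho. apply level3_zero. intros ->. apply level3_zero. }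
    rewrite E, (qe_eq_mul 3) by lia.
    pose proof (mul_lower_pt_rho 1) as M. change (1 + 1 + 1 * 1)%nat with 3%nat in M. rewrite M.
    split; intros [m ->]; exists m; rewrite !plus_IZR, ?mult_IZR, ?RtoC_plus;
      change (INR (1 + 1)) with (1 + 1); rewrite ?RtoC_plus; replace (RtoC 2) with (1 + 1)%C by (now rewrite <- RtoC_plus; f_equal; lra); simpl; ring.
  - pose proof (mul_lower_pt_i 2) as M. change (1 + 2 * 2)%nat with 5%nat in M.
    set (z0 := lower_pt Ci 2) in *.
    pose proof (mul_neg_conj 5 z0) as M'. rewrite M, neg_conj_i in M'.
    assert (hz1 : height 5 <= snd z0) by now apply height_lower_i.
    assert (hz2 : height 5 <= snd (- Cconj z0)%C) by now rewrite neg_conj_Im.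
    pose proof level5_zero as L. fold z0 in L. pose proof (zero_order_1_conj _ _ L) as L'. rewrite qe_conj in L'.
    assert (E : zero_order_1 5 (qe z) <-> qe z = qe z0 \/ qe z = qe (- Cconj z0)%C).
    { split. 2: intros [-> | ->]; trivial. intros H.
      apply level5_unique; trivial; try apply height_5; trivial.
      (* The two zeros differ: after multiplication by [5] their real parts are [2] and [-2], and
         [5] does not divide [4]. At level 7 they differ by [5], which [7] does not divide. *)
      intros K. apply (qe_eq_mul 5) in K; [|lia]. destruct K as [m K]. rewrite M, M' in K.
      apply (f_equal fst) in K. rewrite mult_IZR in K. simpl in K.
      assert (K' : IZR 4 = IZR (5 * m)) by (rewrite mult_IZR; lra). apply eq_IZR in K'. lia. }
    rewrite E, !(qe_eq_mul 5) by lia. rewrite M, M'. split.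
    (* The mirror point gives the residue [-2], listed as [3 = -2 + 5]; hence the change of [m] by
       one. *)
    + intros [[m ->]|[m ->]]; [exists m; left|exists (m - 1)%Z; right];
        rewrite ?plus_IZR, ?mult_IZR, ?minus_IZR; apply C_ext; simpl; ring.
    + intros [m [->| ->]]; [left; exists m|right; exists (m + 1)%Z];
        rewrite ?plus_IZR, ?mult_IZR, ?plus_IZR; apply C_ext; simpl; ring.
  - pose proof (mul_lower_pt_rho 2) as M. change (1 + 2 + 2 * 2)%nat with 7%nat in M.
    set (z0 := lower_pt crho 2) in *.
    pose proof (mul_neg_conj 7 z0) as M'. rewrite M, neg_conj_rho in M'.
    assert (hz1 : height 7 <= snd z0) by now apply height_lower_rho.
    assert (hz2 : height 7 <= snd (- Cconj z0)%C) by now rewrite neg_conj_Im.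
    pose proof level7_zero as L. fold z0 in L. pose proof (zero_order_2_conj _ _ L) as L'. rewrite qe_conj in L'.
    assert (E : zero_order_1 7 (qe z) <-> qe z = qe z0 \/ qe z = qe (- Cconj z0)%C).
    { split. 2: intros [-> | ->]; [apply L|apply L']. intros H.
      apply level7_unique; trivial; try apply height_7; trivial.
      intros K. apply (qe_eq_mul 7) in K; [|lia]. destruct K as [m K]. rewrite M, M' in K.
      apply (f_equal fst) in K. rewrite mult_IZR in K. simpl in K.
      assert (K' : IZR 5 = IZR (7 * m)) by (rewrite mult_IZR; lra). apply eq_IZR in K'. lia. }
    rewrite E, !(qe_eq_mul 7) by lia. rewrite M, M'. split.
    + intros [[m ->]|[m ->]]; [exists m; left|exists (m - 1)%Z; right];
        rewrite ?plus_IZR, ?mult_IZR, ?minus_IZR; apply C_ext; simpl; ring.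
    + intros [m [->| ->]]; [left; exists m|right; exists (m + 1)%Z];
        rewrite ?plus_IZR, ?mult_IZR, ?plus_IZR; apply C_ext; simpl; ring.
Qed.

(** * The fundamental domain *)

Lemma div_nat_Im (t : C) (N : nat) : (0 < N)%nat -> snd (t / INR N)%C = snd t / INR N.
Proof.
  intros h. apply lt_0_INR in h.
  assert (E : t = (INR N * (t / INR N))%C) by (field; apply RtoC_neq0; lra).
  rewrite E at 2. rewrite mul_nat_Im. field. lra.
Qed.

(** Multiplication by [N] exchanges [- / t] with [- / (t / N)], and in the combination defining
    [etN] the two terms with [kappa] cancel. *)
Lemma etN_fricke (N : nat) (t : C) : (0 < N)%nat -> 0 < snd t ->
  etN N (- / t)%C = (- (t * t / INR N) * etN N (t / INR N))%C.
Proof.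
  intros hN ht. pose proof (tau_neq0 t ht) as h0.
  assert (hn : RtoC (INR N) <> 0) by (apply RtoC_neq0, not_0_INR; lia).
  assert (hn0 := lt_0_INR _ hN).
  assert (htN : 0 < snd (t / INR N)%C) by (rewrite div_nat_Im by trivial; now apply Rdiv_lt_0_compat).
  rewrite !etN_eq.
  replace (INR N * - / t)%C with (- / (t / INR N))%C by (field; auto).
  replace (INR N * (t / INR N))%C with t by (field; trivial).
  rewrite !eis2_S by trivial. field. trivial.
Qed.

Lemma STk_eq (k : nat) (w : C) : STk k w = (- / (w + INR k))%C.
Proof. reflexivity. Qed.

Lemma F_Gamma_Im (w : C) : F_Gamma w -> sqrt 3 / 2 <= snd w.
Proof.
  intros [h1 [h2 h3]]. unfold in_H in h1.
  apply Rsqr_incr_0_var; [|lra]. unfold Rsqr. pose proof (sqrt_sqrt 3 ltac:(lra)). nra.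
Qed.

Lemma etN_STk_zero_iff (N k : nat) (w : C) : good_level N -> F_Gamma w ->
  etN N (STk k w) = 0 <-> zero_shift N (w + INR k).
Proof.
  intros hN hw. pose proof (good_level_pos N hN) as hp. pose proof (lt_0_INR _ hp) as hp'.
  pose proof (F_Gamma_Im w hw) as hI. pose proof sqrt3_gt.
  set (t := (w + INR k)%C). assert (hs : snd t = snd w) by (simpl; ring).
  assert (ht : 0 < snd t) by lra. pose proof (tau_neq0 t ht) as h0.
  assert (hn : RtoC (INR N) <> 0) by (apply RtoC_neq0; lra).
  rewrite STk_eq. fold t. rewrite etN_fricke by trivial.
  assert (hz : height N <= snd (t / INR N)%C).
  { rewrite div_nat_Im, hs by trivial. unfold height. apply Rmult_le_compat_r; trivial. left; now apply Rinv_0_lt_compat. }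
  pose proof (etN_zero_iff N _ hN hz) as I. replace (INR N * (t / INR N))%C with t in I by (field; trivial).
  rewrite <- I. split.
  - intros E. replace (etN N (t / INR N)) with (- (INR N / (t * t)) * (- (t * t / INR N) * etN N (t / INR N)))%C by (field; auto).
    rewrite E. ring.
  - intros ->. ring.
Qed.

(** At a zero in the region covered by [etN_zero_iff] the imaginary part of [N z] is at most [1],
    whereas on [F_Gamma] it is at least [sqrt 3]. *)
Lemma etN_F_Gamma_neq0 (N : nat) (w : C) : good_level N -> F_Gamma w -> etN N w <> 0.
Proof.
  intros hN hw E. pose proof (F_Gamma_Im w hw) as hI. pose proof sqrt3_gt as h3.
  assert (hs : sqrt 3 <= 2). { rewrite <- (sqrt_pow2 2) by lra. apply sqrt_le_1; lra. }
  assert (hp : 2 <= INR N) by (change 2 with (INR 2); apply le_INR; unfold good_level in hN; lia).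
  apply etN_zero_iff in E; trivial.
  2: { eapply Rle_trans; [|exact hI]. unfold height. apply Rmult_le_reg_r with (INR N). lra.
       replace (sqrt 3 / 2 / INR N * INR N) with (sqrt 3 / 2) by (field; lra). nra. }
  assert (K : snd (INR N * w)%C <= 1).
  { destruct hN as [->|[->|[->| ->]]]; destruct E as [m E]; [|  |destruct E as [E|E]|destruct E as [E|E]];
      rewrite E; unfold crho, rho; simpl; lra. }
  rewrite mul_nat_Im in K. nra.
Qed.

Lemma IZR_small (n : Z) : -1 < IZR n < 1 -> n = 0%Z.
Proof. intros [h1 h2]. apply lt_IZR in h1, h2. lia. Qed.

Lemma F_Gamma_add_i (w : C) (k : nat) (n : Z) : F_Gamma w -> (w + INR k)%C = (Ci + IZR n)%C -> Z.of_nat k = n /\ w = Ci.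
Proof.
  intros [_ [h _]] E. pose proof (f_equal fst E) as e1. pose proof (f_equal snd E) as e2. simpl in e1, e2.
  assert (hk : n = Z.of_nat k).
  { assert (n - Z.of_nat k = 0)%Z; [|lia]. apply IZR_small. rewrite minus_IZR, <- INR_IZR_INZ. lra. }
  split. lia. apply C_ext; simpl; [|lra]. rewrite hk, <- INR_IZR_INZ in e1. lra.
Qed.

(** The half-open strip matters: its left edge contains [rho], while [rho + 1] on the right edge is
    excluded. *)
Lemma F_Gamma_add_rho (w : C) (k : nat) (n : Z) : F_Gamma w -> (w + INR k)%C = (crho + IZR n)%C -> Z.of_nat k = n /\ w = rho.
Proof.
  intros [_ [h _]] E. pose proof (f_equal fst E) as e1. pose proof (f_equal snd E) as e2.
  unfold crho, rho in e1, e2. simpl in e1, e2.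
  assert (hk : n = Z.of_nat k).
  { assert (n - Z.of_nat k = 0)%Z; [|lia]. apply IZR_small. rewrite minus_IZR, <- INR_IZR_INZ. lra. }
  split. lia. apply C_ext; simpl; [|lra]. rewrite hk, <- INR_IZR_INZ in e1. lra.
Qed.

Lemma F_Gamma_i : F_Gamma Ci.
Proof. unfold F_Gamma, in_H. simpl. lra. Qed.

Lemma F_Gamma_rho : F_Gamma rho.
Proof.
  unfold F_Gamma, in_H, rho. cbn [fst snd]. pose proof sqrt3_gt. pose proof (sqrt_sqrt 3 ltac:(lra)).
  repeat split; nra.
Qed.

Lemma zero_intro (N k : nat) (w : C) : good_level N -> (k < N)%nat -> F_Gamma w -> zero_shift N (w + INR k) ->
  F_p N (STk k w) /\ etN N (STk k w) = 0.
Proof.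
  intros hN hk hw hz. split. right. exists k. split; trivial. exists w. now split.
  now apply etN_STk_zero_iff.
Qed.

Theorem theorem1 (N : nat) (hN : N = 2%nat \/ N = 3%nat \/ N = 5%nat \/ N = 7%nat)
  (tau : Cplx) :
  (F_p N tau /\ EtN N tau = C0) <-> zero_set N tau.
Proof.
  change (EtN N tau = C0) with (etN N tau = RtoC 0). split.
  - intros [[hF|[k [hk [w [hw ->]]]]] E].
    + exfalso. now apply (etN_F_Gamma_neq0 N tau).
    + apply etN_STk_zero_iff in E; trivial.
      destruct hN as [->|[->|[->| ->]]]; destruct E as [m E];
        [| |destruct E as [E|E]|destruct E as [E|E]];
        (apply F_Gamma_add_i in E || apply F_Gamma_add_rho in E); trivial; destruct E as [E ->].
      (* With [0 <= k < N], an equation [k = r + N m] for one of the listed residues [r] leaves only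
         [m = 0]. *)
      * replace k with 1%nat by lia. reflexivity.
      * replace k with 2%nat by lia. reflexivity.
      * left. replace k with 2%nat by lia. reflexivity.
      * right. replace k with 3%nat by lia. reflexivity.
      * left. replace k with 3%nat by lia. reflexivity.
      * right. replace k with 5%nat by lia. reflexivity.
  - intros h. assert (hN' := hN). destruct hN as [->|[->|[->| ->]]]; [| |destruct h as [h|h]|destruct h as [h|h]];
      try rewrite h; apply zero_intro; trivial; try lia; try apply F_Gamma_i; try apply F_Gamma_rho; exists 0%Z.
    + apply C_ext; simpl; ring.
    + apply C_ext; simpl; ring.
    + left. apply C_ext; simpl; ring.
    + right. apply C_ext; simpl; ring.
    + left. apply C_ext; simpl; ring.
    + right. apply C_ext; simpl; ring.
Qed.
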